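(* Consider the degenerate third Painlevé equation of type $D_7$ with $c\neq0$, and let \[ \mathcal{G}(c,\eta)=\sum_{n=1}^{\infty}\frac{B_{2n}}{2n(2n-1)}\,(c\eta)^{1-2n}, \] with $B_{2n}$ the Bernoulli numbers ($\frac{w}{e^w-1}=1-\frac w2+\sum_{n\ge1}\frac{B_{2n}}{(2n)!}w^{2n}$). Then the Voros coefficients of $(P_{\rm III'})_{D_7}$ are \[ W_{\infty_{j,\pm}}(c,\eta)=0\quad(j=1,2,3),\qquad W_{0_{c,\pm}}(c,\eta)=\mp3\,\mathcal{G}(c,\eta). \]
   Context: Let $\eta>0$ be a large parameter and $c\in\mathbb{C}\setminus\{0\}$. The equation $(P_{\rm III'})_{D_7}$ is \[ \frac{d^2\lambda}{dt^2}=\frac1\lambda\Big(\frac{d\lambda}{dt}\Big)^2-\frac1t\frac{d\lambda}{dt}+\eta^2F_{D_7}(\lambda,t,c),\qquad F_{D_7}(\lambda,t,c)=-\frac{2\lambda^2}{t^2}+\frac ct-\frac1\lambda. \] Let $\lambda_0(t,c)$ be a branch of the algebraic function $F_{D_7}(\lambda_0,t,c)=0$, and $\Delta=\partial_\lambda F_{D_7}(\lambda_0,t,c)$. A turning point is a zero $\tau\ne0$ of $\Delta$; the simple-pole is $t=0$ on the branch $\lambda_0=\pm(c/2)^{1/2}t^{1/2}(1+O(t^{1/2}))$. Let $\lambda^{(0)}=\sum_{\ell\ge0}\eta^{-\ell}\lambda^{(0)}_\ell$, $\lambda^{(0)}_0=\lambda_0$, be the formal power series solution of $(P_{\rm III'})_{D_7}$.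 The Riccati equation \[ R^2+\frac{dR}{dt}=\Big(\frac{2}{\lambda^{(0)}}\frac{d\lambda^{(0)}}{dt}-\frac1t\Big)R+\eta^2\Big\{\partial_\lambda F_{D_7}(\lambda^{(0)},t,c)-\eta^{-2}\Big(\frac1{\lambda^{(0)}}\frac{d\lambda^{(0)}}{dt}\Big)^2\Big\} \] has two formal solutions $R_\pm=\pm\eta\sqrt\Delta+O(1)$; set $R_{\rm odd}=\frac12(R_+-R_-)=\sum_{\ell\ge0}\eta^{1-2\ell}R_{2\ell-1}$, $R_{-1}=\sqrt\Delta$. For $\tau$ the turning point or the simple-pole and $*=\infty_{j,\pm}$ or $0_{c,\pm}$, the Voros coefficient for a path $\Gamma(\tau,* )$ is the formal series $W_*(c,\eta)=\int_{\Gamma(\tau,* )}(R_{\rm odd}-\eta R_{-1})dt$, integrals from $\tau$ being one half of contour integrals on the Riemann surface of $\sqrt\Delta$ encircling $\tau$. Endpoint symbols, with $\omega=e^{2\pi i/3}$: as $t\to\infty_{j,\pm}$ ($j=1,2,3$), $\lambda_0=(-2)^{-1/3}\omega^jt^{2/3}(1+O(t^{-1/3}))$ and $R_{-1}=\pm6^{1/2}(-2)^{-1/6}\omega^{j/2}t^{1/3}(1+O(t^{-1/3}))$; as $t\to0_{c,\pm}$, $\lambda_0=t/c+O(t^2)$ and $R_{-1}=\pm c\,t^{-1}(1+O(t))$.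
   Formalization: The stated asymptotics R_{-1} ~ ±6^{1/2}(-2)^{-1/6}ω^{j/2}t^{1/3} at ∞_{j,±} contradict Δ = ∂_λF, which gives Δ ~ 3/λ_0²; the formal statement uses R_{-1} ~ ±√3/λ_0 there instead, for all j and both signs. *)

(* Defs.v *)
From Stdlib Require Import Reals Lra List.
From Coquelicot Require Import Coquelicot.

Open Scope C_scope.

(* Bernoulli numbers, w/(e^w-1) = sum_n B_n w^n/n!, via the standard   *)
(* recurrence  B_0 = 1,  sum_{k=0}^{n} binom(n+1,k) B_k = 0  (n >= 1). *)
Fixpoint rsum (f : nat -> R) (n : nat) : R :=
  match n with
  | O => f O
  | S m => (rsum f m + f (S m))%R
  end.

Fixpoint bern_list (n : nat) : list R :=
  match n with
  | O => 1%R :: nil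
  | S m =>
      let l := bern_list m in
      l ++ ((- / INR (S (S m))) *
            rsum (fun k => Binomial.C (S (S m)) k * nth k l 0) m)%R :: nil
  end.

Definition bernoulli (n : nat) : R := nth n (bern_list n) 0%R.

(* Formal power series in eta^{-1}: coefficient sequences nat -> C.    *)
Fixpoint csum (f : nat -> C) (n : nat) : C :=
  match n with
  | O => f O
  | S m => csum f m + f (S m)
  end.

Definition cprod (a b : nat -> C) (k : nat) : C :=
  csum (fun i => a i * b (k - i)%nat) k.

(* multiplication by eta^{-1} (shift1) and eta^{-2} (shift2) *)
Definition shift1 (a : nat -> C) (m : nat) : C :=
  match m with O => 0 | S m' => a m' end.
Definition shift2 (a : nat -> C) (m : nat) : C :=
  match m with O => 0 | S O => 0 | S (S m') => a m' end.

Definition kron0 (m : nat) : C := match m with O => 1 | _ => 0 end.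

Definition F_D7 (c lam t : C) : C :=
  - 2 * lam * lam / (t * t) + c / t - / lam.

Definition dF_D7 (lam t : C) : C :=
  - 4 * lam / (t * t) + / (lam * lam).

(* Coefficient (at eta^{2-m}) form of the equation
     lam * (P_III')_{D7} :
     lam lam'' = lam'^2 - lam lam'/t + eta^2 lam F_D7(lam,t,c)
   for the series lam = sum_k eta^{-k} L_k, with L1, L2 the sequences of
   first and second t-derivatives of the coefficients. *)
Definition PIII_coef_eq (c t : C) (L L1 L2 : nat -> C) (m : nat) : Prop :=
  shift2 (fun k => cprod L L2 k - cprod L1 L1 k + cprod L L1 k / t) m
  = - 2 * cprod L (cprod L L) m / (t * t) + c * L m / t - kron0 m.

(* Coefficient (at eta^{2-m}) form of lam^2 * (Riccati equation)
     lam^2 R^2 + lam^2 R' = (2 lam lam' - lam^2/t) R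
                            + eta^2 lam^2 dF_D7(lam,t) - lam'^2
   for R = sum_k eta^{1-k} P_k, P1 = t-derivatives of the P_k. *)
Definition Riccati_coef_eq (t : C) (L L1 P P1 : nat -> C) (m : nat) : Prop :=
  cprod (cprod L L) (cprod P P) m + cprod (cprod L L) (shift1 P1) m
  = cprod (fun k => 2 * cprod L L1 k - cprod L L k / t) (shift1 P) m
    - 4 * cprod L (cprod L L) m / (t * t) + kron0 m
    - shift2 (cprod L1 L1) m.

(* Data along a path.  gam : (0,1) -> C is a C^1 path in the t-plane   *)
(* (derivative gam'), and along it:                                     *)
(*   L k s  = lambda^{(0)}_k (gam s),  L1, L2 = its t-derivatives;      *)
(*   P k s  = coefficient of eta^{1-k} of R_+ at gam s, P1 t-derivative;*)
(*   M k s  = same for R_-.                                             *)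
(* t-derivatives along the path are expressed by the chain rule         *)
(*   d/ds f(gam s) = f'(gam s) * gam'(s).                               *)
(* The branch lambda_0 is continued along the path, the path avoids     *)
(* t = 0 and the turning points (dF_D7 <> 0), and R_{-1} = P 0 is the   *)
(* continuation of sqrt(Delta) along the path (its sheet may change).   *)
Definition path_data (c : C) (gam gam' : R -> C)
  (L L1 L2 P P1 M M1 : nat -> R -> C) : Prop :=
  forall s : R, (0 < s < 1)%R ->
    is_derive gam s (gam' s) /\ continuous gam' s /\ gam' s <> 0 /\
    gam s <> 0 /\ L 0%nat s <> 0 /\
    F_D7 c (L 0%nat s) (gam s) = 0 /\
    dF_D7 (L 0%nat s) (gam s) <> 0 /\
    (forall k, is_derive (L k) s (L1 k s * gam' s)) /\
    (forall k, is_derive (L1 k) s (L2 k s * gam' s)) /\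
    (forall k, is_derive (P k) s (P1 k s * gam' s)) /\
    (forall k, is_derive (M k) s (M1 k s * gam' s)) /\
    (forall m, PIII_coef_eq c (gam s) (fun k => L k s) (fun k => L1 k s)
                 (fun k => L2 k s) m) /\
    (* R_+ and R_- are the two formal solutions of the Riccati equation,
       R_+ = eta sqrt(Delta) + O(1), R_- = - eta sqrt(Delta) + O(1) *)
    (forall m, Riccati_coef_eq (gam s) (fun k => L k s) (fun k => L1 k s)
                 (fun k => P k s) (fun k => P1 k s) m) /\
    (forall m, Riccati_coef_eq (gam s) (fun k => L k s) (fun k => L1 k s)
                 (fun k => M k s) (fun k => M1 k s) m) /\
    M 0%nat s = - P 0%nat s.

(* R_odd = (R_+ - R_-)/2 = sum_k eta^{1-k} (P_k - M_k)/2;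
   the coefficient of eta^{1-k} of the Voros coefficient
   int_{Gamma(tau, star)} (R_odd - eta R_{-1}) dt  (k >= 1), where the integral
   from tau is half the integral along the path from the copy of star on the
   opposite sheet, around tau, to star. *)
Definition voros_coef_is (gam' : R -> C) (P M : nat -> R -> C) (k : nat)
  (w : C) : Prop :=
  is_RInt_gen (fun s => / 2 * ((P k s - M k s) / 2 * gam' s))
    (at_right 0) (at_left 1) w.

(* Endpoint 0_{c,sigma} at s -> 1, its opposite-sheet copy 0_{c,-sigma}
   at s -> 0:  t -> 0, lambda_0 = t/c + O(t^2), R_{-1} = sigma c/t (1+O(t)). *)
Definition ends_at_0c (c : C) (sigma : R) (gam : R -> C)
  (L P : nat -> R -> C) : Prop :=
  filterlim gam (at_right 0) (locally 0) /\
  filterlim gam (at_left 1) (locally 0) /\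
  filterlim (fun s => L 0%nat s / gam s) (at_right 0) (locally (/ c)) /\
  filterlim (fun s => L 0%nat s / gam s) (at_left 1) (locally (/ c)) /\
  filterlim (fun s => P 0%nat s * gam s) (at_right 0)
    (locally (- RtoC sigma * c)) /\
  filterlim (fun s => P 0%nat s * gam s) (at_left 1)
    (locally (RtoC sigma * c)).

(* Endpoint infty_{j,sigma} at s -> 1, its opposite-sheet copy at s -> 0:
   t -> infinity with lambda_0^3 ~ -t^2/2 (i.e. lambda_0 ~
   (-2)^{-1/3} omega^j t^{2/3} for some j in {1,2,3}), and
   R_{-1} = sqrt(Delta) ~ sigma sqrt 3 / lambda_0. *)
Definition ends_at_infty (sigma : R) (gam : R -> C)
  (L P : nat -> R -> C) : Prop :=
  filterlim (fun s => Cmod (gam s)) (at_right 0) (Rbar_locally p_infty) /\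
  filterlim (fun s => Cmod (gam s)) (at_left 1) (Rbar_locally p_infty) /\
  filterlim (fun s => L 0%nat s * L 0%nat s * L 0%nat s / (gam s * gam s))
    (at_right 0) (locally (- / 2)) /\
  filterlim (fun s => L 0%nat s * L 0%nat s * L 0%nat s / (gam s * gam s))
    (at_left 1) (locally (- / 2)) /\
  filterlim (fun s => P 0%nat s * L 0%nat s) (at_right 0)
    (locally (- RtoC (sigma * sqrt 3))) /\
  filterlim (fun s => P 0%nat s * L 0%nat s) (at_left 1)
    (locally (RtoC (sigma * sqrt 3))).

(* Coefficient of eta^{1-k} in  G(c,eta) = sum_{n>=1} B_{2n}/(2n(2n-1)) (c eta)^{1-2n} *)
Definition G_coef (c : C) (k : nat) : C :=
  if Nat.even k then
    match k with
    | O => 0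
    | _ => RtoC (bernoulli k / (INR k * INR (k - 1))) / Cpow c (k - 1)
    end
  else 0.

(* Main.v *)
Require Import Defs.
From Stdlib Require Import Reals Lra Lia Ring Arith List FunctionalExtensionality ProofIrrelevance
  Classical ClassicalEpsilon.
From Coquelicot Require Import Coquelicot.

(* Put u = lambda_0 / t and v = lambda_0 * sqrt Delta. The Riemann surface of sqrt Delta is the v-sphere, v^2 = 3 - 2 c u:
   the endpoints 0_c and infinity_j are v = 1, -1 and v^2 = 3, the sheet exchange is v -> - v, and with y = 1 / v every formal
   coefficient is rational in u and y. Besides theta = t d/dt there is the derivation d/dc at fixed t, and with eps = 1 / eta
   the shift S = exp (eps d/dc) acts on formal series. The Baecklund transformation reads
     2 lambda (S lambda) / t = H := c + eps - t / lambda - eps theta (log lambda),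
   and its linearization relates S R_+ to R_+ and S R_- to R_- ; for a primitive Phi of R_odd dt this amounts to
     (S - 1) Phi = log H - (1/2) (log a_- + log b_+)   up to constants,
   with explicit a_-, a_+, b_-, b_+ such that a_- b_- = a_+ b_+ = H^2. Applying d/dc and inverting (S - 1) / (eps d/dc) by the
   generating function of the Bernoulli numbers determines the second c-derivative of Phi. Euler's identity
   3 theta + c d/dc = - u d/du and homogeneity then recover each coefficient of Phi from it without integration. As Phi is odd
   in v, the Voros coefficient is its value at the endpoint: homogeneity makes it 0 at infinity, where u = 0, and at v = 1 the
   logarithmic derivatives are those of 2 c, 2 (c + eps) and c (c + eps), which produces the factor 3. *)

(** * Calculus of C-valued functions of a real variable *)

Open Scope C_scope.

(** The coefficients of R_odd are known only through recursions, and a difference equation in c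
    alone would leave a primitive undetermined. Two c-derivatives remove both difficulties: one
    turns the logarithms into rational functions, the other is the factor eps d/dc that separates S
    - 1 from an invertible operator. No constant of integration is lost on the way back: t, c,
    lambda carry the weights 3, 1, 2, every coefficient is homogeneous in u, and division by its
    degree, nonzero in the orders that matter, recovers the primitive from its derivatives. All
    inversions must take place among functions regular at the endpoint v = 1. Only 1 / (1 + y) is
    adjoined, which is why a_- and b_+ enter and not a_+ and b_-: the leading coefficients of the
    latter two vanish at y = 1. The path enters only at the end: the coefficient equations determine
    all orders from lambda_0 and the sign of sqrt Delta, so the given data are restrictions of the
    formal series. *)

Notation CN := (prod_NormedModule R_AbsRing R_NormedModule R_NormedModule).

Lemma is_derive_C_Re (f : R -> C) (x : R) (l : C) :
  is_derive f x l -> is_derive (fun s => Re (f s)) x (Re l).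
Proof.
  intros H.
  eapply filterdiff_ext_lin.
  - apply (filterdiff_comp' f (fun t : CN => fst t : R_NormedModule) x _ (fun t : CN => fst t : R_NormedModule) H).
    apply filterdiff_linear, is_linear_fst.
  - intros y; reflexivity.
Qed.

Lemma is_derive_C_Im (f : R -> C) (x : R) (l : C) :
  is_derive f x l -> is_derive (fun s => Im (f s)) x (Im l).
Proof.
  intros H.
  eapply filterdiff_ext_lin.
  - apply (filterdiff_comp' f (fun t : CN => snd t : R_NormedModule) x _ (fun t : CN => snd t : R_NormedModule) H).
    apply filterdiff_linear, is_linear_snd.
  - intros y; reflexivity.
Qed.

Lemma is_derive_C_pair (f : R -> C) (x : R) (l : C) :
  is_derive (fun s => Re (f s)) x (Re l) -> is_derive (fun s => Im (f s)) x (Im l) ->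
  is_derive f x l.
Proof.
  intros H1 H2.
  assert (H3 := is_derive_scal_l (V := CN)
                 _ x _ (1%R, 0%R) H1).
  assert (H4 := is_derive_scal_l (V := CN)
                 _ x _ (0%R, 1%R) H2).
  assert (H5 := is_derive_plus _ _ x _ _ H3 H4).
  apply (is_derive_ext _ f) in H5.
  - replace l with (plus (scal (Re l) (1%R,0%R)) (scal (Im l) (0%R,1%R))
       : CN); [exact H5|].
    destruct l as [a b]; unfold plus, scal; simpl; unfold prod_plus, prod_scal, scal, plus; simpl;
      unfold mult; simpl. f_equal; ring.
  - intros t; destruct (f t) as [a b]; unfold plus, scal; simpl; unfold prod_plus, prod_scal, scal, plus; simpl;
      unfold mult; simpl. f_equal; ring.
Qed.

Lemma is_derive_C_eq (f : R -> C) (x : R) (l m : C) :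
  is_derive f x l -> l = m -> is_derive f x m.
Proof. now intros H <-. Qed.

Lemma is_derive_C_uniq (f : R -> C) (x : R) (l m : C) :
  is_derive f x l -> is_derive f x m -> l = m.
Proof.
  intros H K; apply injective_projections.
  - apply is_derive_C_Re, is_derive_unique in H. apply is_derive_C_Re, is_derive_unique in K.
    unfold Re in *; congruence.
  - apply is_derive_C_Im, is_derive_unique in H. apply is_derive_C_Im, is_derive_unique in K.
    unfold Im in *; congruence.
Qed.

Lemma is_derive_C_const (c : C) (x : R) : is_derive (fun _ : R => c) x (RtoC 0).
Proof. exact (is_derive_const (c : CN) x). Qed.

Lemma is_derive_C_plus (f g : R -> C) (x : R) (l m : C) :
  is_derive f x l -> is_derive g x m -> is_derive (fun s => f s + g s) x (l + m).
Proof. intros H K; exact (is_derive_plus _ _ x _ _ H K). Qed.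

Lemma is_derive_C_mult (f g : R -> C) (x : R) (l m : C) :
  is_derive f x l -> is_derive g x m ->
  is_derive (fun s => f s * g s) x (l * g x + f x * m).
Proof.
  intros H K.
  pose proof (is_derive_C_Re _ _ _ H) as H1. pose proof (is_derive_C_Im _ _ _ H) as H2.
  pose proof (is_derive_C_Re _ _ _ K) as K1. pose proof (is_derive_C_Im _ _ _ K) as K2.
  apply is_derive_C_pair; simpl.
  - evar_last.
    + apply (is_derive_minus (fun s => Re (f s) * Re (g s))%R (fun s => Im (f s) * Im (g s))%R);
        eapply Derive.is_derive_mult; eassumption.
    + unfold minus, plus, opp; simpl; unfold Re, Im; ring.
  - evar_last.
    + apply (is_derive_plus (fun s => Re (f s) * Im (g s))%R (fun s => Im (f s) * Re (g s))%R);
        eapply Derive.is_derive_mult; eassumption.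
    + unfold minus, plus, opp; simpl; unfold Re, Im; ring.
Qed.

(** Differentiability is read off from the two components; the value of the derivative is then
    forced by differentiating [f * / f = 1], which spares a computation with real and imaginary
    parts. *)
Lemma is_derive_C_inv (f : R -> C) (x : R) (l : C) :
  is_derive f x l -> f x <> 0 -> is_derive (fun s => / f s) x (- l / (f x * f x)).
Proof.
  intros H Hn.
  pose proof (is_derive_C_Re _ _ _ H) as H1. pose proof (is_derive_C_Im _ _ _ H) as H2.
  assert (Hd : (Re (f x) ^ 2 + Im (f x) ^ 2 <> 0)%R).
  { intros E. apply Hn. apply injective_projections; simpl; unfold Re, Im in E; nra. }
  assert (Hq : is_derive (fun s => (Re (f s) ^ 2 + Im (f s) ^ 2)%R) x
       (Re l * Re (f x) + Re (f x) * Re l + (Im l * Im (f x) + Im (f x) * Im l))%R).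
    { apply (is_derive_ext (fun s => Re (f s) * Re (f s) + Im (f s) * Im (f s))%R).
      - intros t; simpl; ring.
      - apply (is_derive_plus (fun s => Re (f s) * Re (f s))%R (fun s => Im (f s) * Im (f s))%R);
        apply Derive.is_derive_mult; assumption. }
  assert (H3 : exists m : C, is_derive (fun s => / f s) x m).
  { pose proof (is_derive_inv _ _ _ Hq Hd) as Hi.
    eexists (_, _). apply is_derive_C_pair; simpl.
    - apply (Derive.is_derive_mult (fun s => Re (f s)) _ _ _ _ H1 Hi).
    - apply (Derive.is_derive_mult (fun s => - Im (f s))%R (fun s => / (Re (f s) ^ 2 + Im (f s) ^ 2))%R x (- Im l)%R).
      + exact (is_derive_opp _ _ _ H2).
      + exact Hi. }
  destruct H3 as [m H3].
  pose proof (is_derive_C_mult _ _ _ _ _ H H3) as H4.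
  assert (H5 : is_derive (fun s => f s * / f s) x (RtoC 0)).
  { apply (is_derive_ext_loc (V := CN) (fun _ : R => RtoC 1)); [|apply is_derive_C_const].
    assert (Hc : continuous (fun s => Re (f s) ^ 2 + Im (f s) ^ 2)%R x).
    { apply (ex_derive_continuous (fun s => Re (f s) ^ 2 + Im (f s) ^ 2)%R).
      eexists; exact Hq. }
    pose proof (continuous_comp _ Rabs x Hc (continuous_Rabs _)) as Hc2.
    assert (Hp : (0 < Rabs (Re (f x) ^ 2 + Im (f x) ^ 2))%R) by now apply Rabs_pos_lt.
    specialize (Hc2 (fun z => 0 < z)%R (open_gt 0 _ Hp)).
    destruct Hc2 as [eps He]; exists eps; intros t Hb. assert (Ht := He t Hb); clear He; simpl in Ht.
    symmetry; apply Cinv_r. intros E; rewrite E in Ht. simpl in Ht.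
    replace (0 * (0 * 1) + 0 * (0 * 1))%R with 0%R in Ht by ring.
    rewrite Rabs_R0 in Ht; lra. }
  pose proof (is_derive_C_uniq _ _ _ _ H4 H5) as E.
  apply (is_derive_C_eq _ _ _ _ H3).
  transitivity ((l * / f x + f x * m - l * / f x) * / f x).
  - field; assumption.
  - rewrite E; field; assumption.
Qed.

Lemma is_derive_line (p q : C) (x : R) : is_derive (fun s : R => p + RtoC s * q) x q.
Proof.
  assert (Hid : is_derive (fun s : R => RtoC s) x (RtoC 1)).
  { apply is_derive_C_pair; simpl; [apply (is_derive_id (K := R_AbsRing))|apply (is_derive_const (V := R_NormedModule))]. }
  apply (is_derive_C_eq _ _ _ _ (is_derive_C_plus _ _ _ _ _ (is_derive_C_const p x)
       (is_derive_C_mult _ _ _ _ _ Hid (is_derive_C_const q x)))). ring.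
Qed.

Section Limits.
Context {T : Type} (F : (T -> Prop) -> Prop) {FF : Filter F}.

Lemma lim_Re (f : T -> C) (z : C) :
  filterlim f F (locally z) -> filterlim (fun s => Re (f s)) F (locally (Re z)).
Proof. destruct z as [a b]; intros H; exact (filterlim_comp _ _ _ f (fun t : C => fst t) F _ _ H (continuous_fst a b)). Qed.

Lemma lim_Im (f : T -> C) (z : C) :
  filterlim f F (locally z) -> filterlim (fun s => Im (f s)) F (locally (Im z)).
Proof. destruct z as [a b]; intros H; exact (filterlim_comp _ _ _ f (fun t : C => snd t) F _ _ H (continuous_snd a b)). Qed.

Lemma lim_C_pair (f : T -> C) (z : C) :
  filterlim (fun s => Re (f s)) F (locally (Re z)) ->
  filterlim (fun s => Im (f s)) F (locally (Im z)) -> filterlim f F (locally z).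
Proof.
  intros H K P [e HP].
  specialize (H (ball (Re z) e) (locally_ball _ _)). specialize (K (ball (Im z) e) (locally_ball _ _)).
  unfold filtermap in *.
  refine (filter_imp _ _ _ (filter_and _ _ H K)). intros s [h k]. apply HP. split; assumption.
Qed.

Lemma lim_C_const (c : C) : filterlim (fun _ : T => c) F (locally c).
Proof. apply filterlim_const. Qed.

Lemma lim_C_plus (f g : T -> C) (z w : C) :
  filterlim f F (locally z) -> filterlim g F (locally w) ->
  filterlim (fun s => f s + g s) F (locally (z + w)).
Proof.
  intros H K. apply lim_C_pair; simpl;
  (eapply (filterlim_comp_2 _ _ Rplus); [..|apply (filterlim_plus (V := R_NormedModule))]).
  - now apply lim_Re. - now apply lim_Re. - now apply lim_Im. - now apply lim_Im.
Qed.

Lemma lim_R_mult (f g : T -> R) (z w : R) :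
  filterlim f F (locally z) -> filterlim g F (locally w) ->
  filterlim (fun s => f s * g s)%R F (locally (z * w)%R).
Proof.
  intros H K. eapply (filterlim_comp_2 _ _ Rmult); [exact H|exact K|apply (filterlim_mult (K := R_AbsRing))].
Qed.
Lemma lim_R_plus (f g : T -> R) (z w : R) :
  filterlim f F (locally z) -> filterlim g F (locally w) ->
  filterlim (fun s => f s + g s)%R F (locally (z + w)%R).
Proof.
  intros H K. eapply (filterlim_comp_2 _ _ Rplus); [exact H|exact K|apply (filterlim_plus (V := R_NormedModule))].
Qed.
Lemma lim_R_opp (f : T -> R) (z : R) :
  filterlim f F (locally z) -> filterlim (fun s => - f s)%R F (locally (- z)%R).
Proof. intros H. eapply filterlim_comp; [exact H|apply (filterlim_opp (V := R_NormedModule))]. Qed.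

Lemma lim_C_mult (f g : T -> C) (z w : C) :
  filterlim f F (locally z) -> filterlim g F (locally w) ->
  filterlim (fun s => f s * g s) F (locally (z * w)).
Proof.
  intros H K. apply lim_Re in H as H1. apply lim_Im in H as H2.
  apply lim_Re in K as K1. apply lim_Im in K as K2.
  apply lim_C_pair; simpl.
  - apply lim_R_plus; [|apply lim_R_opp]; now apply lim_R_mult.
  - apply lim_R_plus; now apply lim_R_mult.
Qed.

Lemma lim_C_inv (f : T -> C) (z : C) :
  filterlim f F (locally z) -> z <> 0 -> filterlim (fun s => / f s) F (locally (/ z)).
Proof.
  intros H Hn. apply lim_Re in H as H1. apply lim_Im in H as H2.
  assert (Hd : (Re z ^ 2 + Im z ^ 2 <> 0)%R).
  { intros E. apply Hn. apply injective_projections; simpl; unfold Re, Im in E; nra. }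
  assert (Hi : filterlim (fun s => / (Re (f s) ^ 2 + Im (f s) ^ 2))%R F (locally (/ (Re z ^ 2 + Im z ^ 2))%R)).
  { assert (Hq : filterlim (fun s => (Re (f s) ^ 2 + Im (f s) ^ 2))%R F (locally (Re z ^ 2 + Im z ^ 2)%R)).
    { apply lim_R_plus; repeat apply lim_R_mult; try assumption; apply filterlim_const. }
    eapply filterlim_comp; [exact Hq|].
    apply (filterlim_Rbar_inv (Finite (Re z ^ 2 + Im z ^ 2))).
    intros E; apply Hd; injection E; auto. }
  apply lim_C_pair; simpl; apply lim_R_mult; try assumption.
  now apply lim_R_opp.
Qed.
End Limits.

Lemma is_derive_C_continuous (f : R -> C) (x : R) (l : C) :
  is_derive f x l -> filterlim f (locally x) (locally (f x)).
Proof. intros H. apply (ex_derive_continuous f x). now exists l. Qed.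

Lemma locally_neq0 (f : R -> C) (x : R) :
  filterlim f (locally x) (locally (f x)) -> f x <> 0 -> locally x (fun s => f s <> 0).
Proof.
  intros H Hn. 
  assert (K := lim_C_mult _ _ _ _ _ H (lim_C_inv _ _ _ H Hn)).
  apply lim_Re in K. rewrite (Cinv_r _ Hn) in K.
  specialize (K (fun z => 0 < z)%R (open_gt 0 1%R Rlt_0_1)).
  destruct K as [eps He]; exists eps; intros s Hb E. assert (Hs := He s Hb); clear He. simpl in Hs. rewrite E in Hs. simpl in Hs. lra.
Qed.

Lemma is_RInt_gen_C_derive (f df : R -> C) (la lb : C) :
  (forall s, (0 < s < 1)%R -> is_derive f s (df s)) ->
  (forall s, (0 < s < 1)%R -> filterlim df (locally s) (locally (df s))) ->
  filterlim f (at_right 0) (locally la) -> filterlim f (at_left 1) (locally lb) ->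
  is_RInt_gen df (at_right 0) (at_left 1) (lb - la).
Proof.
  intros Hd Hc H0 H1.
  intros P HP. unfold filtermapi.
  assert (L : filterlim (fun ab : R * R => f (snd ab) + - f (fst ab))
     (filter_prod (at_right 0) (at_left 1)) (locally (lb + - la))).
  { apply lim_C_plus. typeclasses eauto.
    - apply (filterlim_comp (R*R) R C snd f _ (at_left 1) _); [apply filterlim_snd|exact H1].
    - apply lim_C_pair. typeclasses eauto.
      + apply (lim_R_opp _ (fun ab => Re (f (fst ab)))).
        apply (filterlim_comp (R*R) R R fst (fun a => Re (f a)) _ (at_right 0) _); [apply filterlim_fst|now apply lim_Re].
      + apply (lim_R_opp _ (fun ab => Im (f (fst ab)))).
        apply (filterlim_comp (R*R) R R fst (fun a => Im (f a)) _ (at_right 0) _); [apply filterlim_fst|now apply lim_Im]. }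
  specialize (L P HP). unfold filtermap in L.
  assert (B : filter_prod (at_right 0) (at_left 1) (fun ab : R * R => (0 < fst ab < 1 /\ 0 < snd ab < 1)%R)).
  { apply (Filter_prod _ _ _ (fun a => 0 < a < 1)%R (fun a => 0 < a < 1)%R).
    - exists (mkposreal 1 Rlt_0_1). intros y Hy Hl. unfold ball in Hy; simpl in Hy.
      unfold AbsRing_ball, abs, minus, plus, opp in Hy; simpl in Hy. apply Rabs_def2 in Hy. lra.
    - exists (mkposreal 1 Rlt_0_1). intros y Hy Hl. unfold ball in Hy; simpl in Hy.
      unfold AbsRing_ball, abs, minus, plus, opp in Hy; simpl in Hy. apply Rabs_def2 in Hy. lra.
    - intros x y Hx Hy; simpl; auto. }
  refine (filter_imp _ _ _ (filter_and _ _ L B)). intros [a b] [Hp [Ha Hb]]; simpl in *.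
  exists (f b + - f a). split; [|exact Hp].
  (* As chosen here, the neighbourhoods of the two ends overlap, so [a <= b] is not known. *)
  assert (Hm : forall x, (Rmin a b <= x <= Rmax a b)%R -> (0 < x < 1)%R).
  { intros x Hx. revert Hx. unfold Rmin, Rmax; destruct (Rle_dec a b); lra. }
  apply (is_RInt_fct_extend_pair df a b).
  - apply (is_RInt_derive (V := R_CompleteNormedModule) (fun s => Re (f s)) (fun s => Re (df s)) a b).
    + intros x Hx. apply is_derive_C_Re, Hd, Hm, Hx.
    + intros x Hx. apply lim_Re, Hc, Hm, Hx.
  - apply (is_RInt_derive (V := R_CompleteNormedModule) (fun s => Im (f s)) (fun s => Im (df s)) a b).
    + intros x Hx. apply is_derive_C_Im, Hd, Hm, Hx.
    + intros x Hx. apply lim_Im, Hc, Hm, Hx.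
Qed.

(** * Rational functions of (u, y) *)

(** Derivatives are taken on syntax: they are then total and visibly stay in the algebra generated
    by these atoms. [Ez] serves to invert the leading coefficients of a_- and b_+. *)
Inductive expr : Type :=
| Ec (z : C) | Eu | Eui | Ey | Eyi | Ez
| Eadd (e f : expr) | Emul (e f : expr).

Fixpoint sem (e : expr) (u y : C) : C :=
  match e with
  | Ec z => z | Eu => u | Eui => / u | Ey => y | Eyi => / y | Ez => / (1 + y)
  | Eadd e f => sem e u y + sem f u y
  | Emul e f => sem e u y * sem f u y
  end.

(** This is u d/du rather than d/du: its eigenvalues are the degrees in u. *)
Fixpoint dru (e : expr) : expr :=
  match e with
  | Ec _ | Ey | Eyi | Ez => Ec 0
  | Eu => Eu
  | Eui => Emul (Ec (-1)) Eui
  | Eadd e f => Eadd (dru e) (dru f)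
  | Emul e f => Eadd (Emul (dru e) f) (Emul e (dru f))
  end.

Fixpoint dry (e : expr) : expr :=
  match e with
  | Ec _ | Eu | Eui => Ec 0
  | Ey => Ec 1
  | Eyi => Emul (Ec (-1)) (Emul Eyi Eyi)
  | Ez => Emul (Ec (-1)) (Emul Ez Ez)
  | Eadd e f => Eadd (dry e) (dry f)
  | Emul e f => Eadd (Emul (dry e) f) (Emul e (dry f))
  end.

(* The logarithmic derivatives below have a pole on one of the two sheets over the endpoint t = 0,
   which is y = -1; the value y = 1 must stay admissible. *)
Definition ok (u y : C) : Prop := u <> 0 /\ y <> 0 /\ 1 + y <> 0.

Lemma sem_derive (e : expr) (U Y : R -> C) (x : R) (a b : C) :
  ok (U x) (Y x) -> is_derive U x a -> is_derive Y x b ->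
  is_derive (fun s => sem e (U s) (Y s)) x
    (sem (dru e) (U x) (Y x) * / U x * a + sem (dry e) (U x) (Y x) * b).
Proof.
  intros (Hu & Hy & Hz) HU HY.
  induction e as [z| | | | | |e IHe f IHf|e IHe f IHf]; simpl.
  - apply (is_derive_C_eq _ _ 0); [apply is_derive_C_const|ring].
  - apply (is_derive_C_eq _ _ _ _ HU). field; repeat split; assumption.
  - apply (is_derive_C_eq _ _ _ _ (is_derive_C_inv _ _ _ HU Hu)). field; repeat split; assumption.
  - apply (is_derive_C_eq _ _ _ _ HY). ring.
  - apply (is_derive_C_eq _ _ _ _ (is_derive_C_inv _ _ _ HY Hy)). field; repeat split; assumption.
  - assert (H1 := is_derive_C_plus _ _ x _ _ (is_derive_C_const 1 x) HY).
    apply (is_derive_C_eq _ _ _ _ (is_derive_C_inv _ _ _ H1 Hz)). field; repeat split; assumption.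
  - apply (is_derive_C_eq _ _ _ _ (is_derive_C_plus _ _ _ _ _ IHe IHf)). ring.
  - apply (is_derive_C_eq _ _ _ _ (is_derive_C_mult _ _ _ _ _ IHe IHf)). ring.
Qed.

Lemma sem_lim {T : Type} (F : (T -> Prop) -> Prop) {FF : Filter F} (e : expr) (U Y : T -> C) (u y : C) :
  ok u y -> filterlim U F (locally u) -> filterlim Y F (locally y) ->
  filterlim (fun s => sem e (U s) (Y s)) F (locally (sem e u y)).
Proof.
  intros (Hu & Hy & Hz) HU HY.
  induction e as [z| | | | | |e IHe f IHf|e IHe f IHf]; simpl.
  - apply lim_C_const, FF.
  - exact HU.
  - now apply lim_C_inv.
  - exact HY.
  - now apply lim_C_inv.
  - apply lim_C_inv; [exact FF| |exact Hz]. apply lim_C_plus; [exact FF| |exact HY]. apply lim_C_const, FF.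
  - now apply lim_C_plus.
  - now apply lim_C_mult.
Qed.

Lemma ok_near (U Y : R -> C) (x : R) (a b : C) :
  is_derive U x a -> is_derive Y x b -> ok (U x) (Y x) -> locally x (fun s => ok (U s) (Y s)).
Proof.
  intros HU HY (Hu & Hy & Hz).
  assert (H1 := is_derive_C_plus _ _ x _ _ (is_derive_C_const 1 x) HY).
  apply is_derive_C_continuous in HU, HY, H1.
  destruct (locally_neq0 _ _ HU Hu) as [e1 E1]. destruct (locally_neq0 _ _ HY Hy) as [e2 E2].
  destruct (locally_neq0 _ _ H1 Hz) as [e3 E3].
  apply filter_and; [exists e1; exact E1|apply filter_and; [exists e2; exact E2|exists e3; exact E3]].
Qed.

(** The domain is open, so two expressions of one function have the same derivative along the line
    through (u, y) with direction (a, b). This makes the syntactic derivatives well defined on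
    functions. *)
Lemma sem_derive_uniq (e f : expr) (u y a b : C) :
  (forall u y, ok u y -> sem e u y = sem f u y) -> ok u y ->
  sem (dru e) u y * / u * a + sem (dry e) u y * b =
  sem (dru f) u y * / u * a + sem (dry f) u y * b.
Proof.
  intros H Ho.
  assert (HL := fun p q : C => is_derive_line p q 0%R).
  set (U := fun s : R => u + RtoC s * a). set (Y := fun s : R => y + RtoC s * b).
  assert (EU : U 0%R = u) by (unfold U; ring). assert (EY : Y 0%R = y) by (unfold Y; ring).
  assert (Ho' : ok (U 0%R) (Y 0%R)) by (rewrite EU, EY; exact Ho).
  pose proof (sem_derive e U Y 0%R a b Ho' (HL u a) (HL y b)) as H1.
  pose proof (sem_derive f U Y 0%R a b Ho' (HL u a) (HL y b)) as H2.
  rewrite EU, EY in H1, H2.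
  refine (is_derive_C_uniq (fun s => sem f (U s) (Y s)) 0%R _ _ _ H2).
  apply (is_derive_ext_loc (V := CN)) with (2 := H1).
  destruct (ok_near U Y 0%R a b (HL u a) (HL y b) Ho') as [eps He].
  exists eps. intros s Hs. apply H, He, Hs.
Qed.

(* Normalized to 0 off the domain, so that Leibniz equality is equality on the domain. *)
Definition nsem (e : expr) (u y : C) : C :=
  if excluded_middle_informative (ok u y) then sem e u y else 0.

Lemma nsem_ok (e : expr) (u y : C) : ok u y -> nsem e u y = sem e u y.
Proof. intros H; unfold nsem; destruct excluded_middle_informative; [reflexivity|contradiction]. Qed.

Definition FA : Type := { f : C -> C -> C | exists e, f = nsem e }.

Definition ev (f : FA) (u y : C) : C := proj1_sig f u y.

Definition mk (e : expr) : FA := exist _ (nsem e) (ex_intro _ e eq_refl).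

Definition repr (f : FA) : expr := proj1_sig (constructive_indefinite_description _ (proj2_sig f)).

Lemma ev_mk (e : expr) (u y : C) : ok u y -> ev (mk e) u y = sem e u y.
Proof. intros H; exact (nsem_ok e u y H). Qed.

Lemma ev_repr (f : FA) (u y : C) : ok u y -> sem (repr f) u y = ev f u y.
Proof.
  intros H. unfold repr, ev. destruct constructive_indefinite_description as [e E]; simpl.
  rewrite E. symmetry; now apply nsem_ok.
Qed.

Lemma FA_ext (f g : FA) : (forall u y, ok u y -> ev f u y = ev g u y) -> f = g.
Proof.
  intros H. destruct f as [f pf], g as [g pg]. unfold ev in H; simpl in H.
  assert (K : f = g).
  { destruct pf as [e E], pg as [e' E'].
    extensionality u; extensionality y. destruct (classic (ok u y)) as [Ho|Hn]; [auto|].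
    rewrite E, E'; unfold nsem. destruct excluded_middle_informative; [contradiction|reflexivity]. }
  subst g. now rewrite (proof_irrelevance _ pf pg).
Qed.

Definition fadd (f g : FA) : FA := mk (Eadd (repr f) (repr g)).
Definition fmul (f g : FA) : FA := mk (Emul (repr f) (repr g)).
Definition fcst (z : C) : FA := mk (Ec z).
Definition fopp (f : FA) : FA := fmul (fcst (-1)) f.
Definition fsub (f g : FA) : FA := fadd f (fopp g).
Definition fu : FA := mk Eu.
Definition fui : FA := mk Eui.
Definition fy : FA := mk Ey.
Definition fyi : FA := mk Eyi.
Definition fz : FA := mk Ez.
Definition D1 (f : FA) : FA := mk (dru (repr f)).
Definition Dy (f : FA) : FA := mk (dry (repr f)).

Lemma ev_add f g u y : ok u y -> ev (fadd f g) u y = ev f u y + ev g u y.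
Proof. intros H; unfold fadd; rewrite ev_mk by assumption; simpl; now rewrite !ev_repr. Qed.
Lemma ev_mul f g u y : ok u y -> ev (fmul f g) u y = ev f u y * ev g u y.
Proof. intros H; unfold fmul; rewrite ev_mk by assumption; simpl; now rewrite !ev_repr. Qed.
Lemma ev_cst z u y : ok u y -> ev (fcst z) u y = z.
Proof. apply ev_mk. Qed.
Lemma ev_opp f u y : ok u y -> ev (fopp f) u y = - ev f u y.
Proof. intros H; unfold fopp; rewrite ev_mul, ev_cst by assumption; ring. Qed.
Lemma ev_sub f g u y : ok u y -> ev (fsub f g) u y = ev f u y - ev g u y.
Proof. intros H; unfold fsub; rewrite ev_add, ev_opp by assumption; ring. Qed.
Lemma ev_u u y : ok u y -> ev fu u y = u.
Proof. apply ev_mk. Qed.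
Lemma ev_ui u y : ok u y -> ev fui u y = / u.
Proof. apply ev_mk. Qed.
Lemma ev_y u y : ok u y -> ev fy u y = y.
Proof. apply ev_mk. Qed.
Lemma ev_yi u y : ok u y -> ev fyi u y = / y.
Proof. apply ev_mk. Qed.
Lemma ev_z u y : ok u y -> ev fz u y = / (1 + y).
Proof. apply ev_mk. Qed.

Ltac evs := repeat first [rewrite ev_add by assumption | rewrite ev_mul by assumption
  | rewrite ev_sub by assumption | rewrite ev_opp by assumption | rewrite ev_cst by assumption
  | rewrite ev_u by assumption | rewrite ev_ui by assumption | rewrite ev_y by assumption
  | rewrite ev_yi by assumption | rewrite ev_z by assumption].
Ltac fa_ext := apply FA_ext; let u := fresh "u" in let y := fresh "y" in intros u y ?; evs.
Ltac fa_ring := fa_ext; ring.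

Lemma FA_ring : ring_theory (fcst 0) (fcst 1) fadd fmul fsub fopp eq.
Proof. constructor; intros; fa_ring. Qed.
Add Ring FAring : FA_ring.

(** The derivations are defined on an arbitrarily chosen representative; by [sem_derive_uniq] any
    other expression of the same function gives the same result, so they can be computed on the
    expression at hand. *)
Lemma D_mk (e : expr) : D1 (mk e) = mk (dru e) /\ Dy (mk e) = mk (dry e).
Proof.
  assert (H : forall u y, ok u y -> sem (repr (mk e)) u y = sem e u y).
  { intros u y Ho; rewrite ev_repr, ev_mk by assumption; reflexivity. }
  split; apply FA_ext; intros u y Ho; unfold D1, Dy; rewrite !ev_mk by assumption.
  - pose proof (sem_derive_uniq _ _ u y u 0 H Ho) as K.
    destruct Ho as (Hu & _ & _).
    transitivity (sem (dru (repr (mk e))) u y * / u * u + sem (dry (repr (mk e))) u y * 0); [field; repeat split; assumption|].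
    rewrite K; field; repeat split; assumption.
  - pose proof (sem_derive_uniq _ _ u y 0 1 H Ho) as K.
    transitivity (sem (dru (repr (mk e))) u y * / u * 0 + sem (dry (repr (mk e))) u y * 1); [ring|].
    rewrite K; ring.
Qed.

Lemma mk_repr (f : FA) : mk (repr f) = f.
Proof. apply FA_ext; intros u y H; rewrite ev_mk by assumption; now apply ev_repr. Qed.

Lemma D1_add f g : D1 (fadd f g) = fadd (D1 f) (D1 g).
Proof. unfold fadd at 1. rewrite (proj1 (D_mk _)). apply FA_ext; intros u y H.
  unfold D1; rewrite ev_add, !ev_mk by assumption; reflexivity. Qed.
Lemma Dy_add f g : Dy (fadd f g) = fadd (Dy f) (Dy g).
Proof. unfold fadd at 1. rewrite (proj2 (D_mk _)). apply FA_ext; intros u y H.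
  unfold Dy; rewrite ev_add, !ev_mk by assumption; reflexivity. Qed.
Lemma D1_mul f g : D1 (fmul f g) = fadd (fmul (D1 f) g) (fmul f (D1 g)).
Proof. unfold fmul at 1. rewrite (proj1 (D_mk _)). apply FA_ext; intros u y H.
  unfold D1; evs; rewrite !ev_mk by assumption; simpl; rewrite !ev_repr by assumption; reflexivity. Qed.
Lemma Dy_mul f g : Dy (fmul f g) = fadd (fmul (Dy f) g) (fmul f (Dy g)).
Proof. unfold fmul at 1. rewrite (proj2 (D_mk _)). apply FA_ext; intros u y H.
  unfold Dy; evs; rewrite !ev_mk by assumption; simpl; rewrite !ev_repr by assumption; reflexivity. Qed.
Lemma D1_cst z : D1 (fcst z) = fcst 0.
Proof. apply (proj1 (D_mk (Ec z))). Qed.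
Lemma Dy_cst z : Dy (fcst z) = fcst 0.
Proof. apply (proj2 (D_mk (Ec z))). Qed.
Lemma D1_u : D1 fu = fu.
Proof. apply (proj1 (D_mk Eu)). Qed.
Lemma D1_y : D1 fy = fcst 0.
Proof. apply (proj1 (D_mk Ey)). Qed.
Lemma D1_ui : D1 fui = fopp fui.
Proof. unfold fui. rewrite (proj1 (D_mk Eui)); simpl. apply FA_ext; intros u y H; rewrite ev_opp, !ev_mk by assumption; simpl; ring. Qed.
Lemma D1_yi : D1 fyi = fcst 0.
Proof. apply (proj1 (D_mk Eyi)). Qed.
Lemma Dy_u : Dy fu = fcst 0.
Proof. apply (proj2 (D_mk Eu)). Qed.
Lemma Dy_ui : Dy fui = fcst 0.
Proof. apply (proj2 (D_mk Eui)). Qed.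
Lemma Dy_y : Dy fy = fcst 1.
Proof. apply (proj2 (D_mk Ey)). Qed.
Lemma Dy_yi : Dy fyi = fopp (fmul fyi fyi).
Proof. unfold fyi. rewrite (proj2 (D_mk Eyi)); simpl. apply FA_ext; intros u y H; rewrite ev_opp, ev_mul, !ev_mk by assumption; simpl; ring. Qed.

Lemma D_comm f : D1 (Dy f) = Dy (D1 f).
Proof.
  rewrite <- (mk_repr f). generalize (repr f) as e; intros e.
  rewrite (proj1 (D_mk _)), (proj2 (D_mk _)), (proj1 (D_mk _)), (proj2 (D_mk _)).
  apply FA_ext; intros u y H. rewrite !ev_mk by assumption.
  induction e as [z| | | | | |e IHe g IHg|e IHe g IHg]; simpl; try ring.
  - now rewrite IHe, IHg.
  - rewrite IHe, IHg; ring.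
Qed.

Lemma ev_derive (f : FA) (U Y : R -> C) (x : R) (a b : C) :
  ok (U x) (Y x) -> is_derive U x a -> is_derive Y x b ->
  is_derive (fun s => ev f (U s) (Y s)) x
    (ev (D1 f) (U x) (Y x) * / U x * a + ev (Dy f) (U x) (Y x) * b).
Proof.
  intros Ho HU HY. rewrite <- (mk_repr f). generalize (repr f) as e; intros e.
  rewrite (proj1 (D_mk _)), (proj2 (D_mk _)). rewrite !ev_mk by assumption.
  apply (is_derive_ext_loc (V := CN)) with (2 := sem_derive e U Y x a b Ho HU HY).
  destruct (ok_near U Y x a b HU HY Ho) as [eps He].
  exists eps. intros s Hs. symmetry; apply ev_mk, He, Hs.
Qed.

Lemma ev_lim {T : Type} (F : (T -> Prop) -> Prop) {FF : Filter F} (f : FA) (U Y : T -> C) (u y : C) :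
  ok u y -> filterlim U F (locally u) -> filterlim Y F (locally y) -> F (fun s => ok (U s) (Y s)) ->
  filterlim (fun s => ev f (U s) (Y s)) F (locally (ev f u y)).
Proof.
  intros Ho HU HY Hn. rewrite <- (ev_repr f u y Ho).
  apply (filterlim_ext_loc (fun s => sem (repr f) (U s) (Y s))).
  - refine (filter_imp _ _ _ Hn). intros s Hs. now apply ev_repr.
  - now apply sem_lim.
Qed.

(** * Formal power series over a commutative ring *)

Section Series.
Local Open Scope nat_scope.
Context {A : Type} (a0 a1 : A) (add mul sub : A -> A -> A) (opp : A -> A)
  (rth : ring_theory a0 a1 add mul sub opp eq).
Add Ring Aring : rth.
Local Infix "+!" := add (at level 50, left associativity).
Local Infix "*!" := mul (at level 40, left associativity).
Local Infix "-!" := sub (at level 50, left associativity).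
Local Notation ser := (nat -> A).

(** The ring is abstract because series are needed over [FA], over C for values at a point, and over
    C again for the symbols of operators in eps d/dc. *)
Fixpoint gsum (f : ser) (n : nat) : A :=
  match n with O => f O | S m => gsum f m +! f (S m) end.
Definition gmul (a b : ser) : ser := fun k => gsum (fun i => a i *! b (k - i)%nat) k.
Definition gadd (a b : ser) : ser := fun k => a k +! b k.
Definition gsub (a b : ser) : ser := fun k => a k -! b k.
Definition gopp (a : ser) : ser := fun k => opp (a k).
Definition gcst (a : A) : ser := fun k => match k with O => a | S _ => a0 end.
Definition geps : ser := fun k => match k with S O => a1 | _ => a0 end.
Definition gtl (a : ser) : ser := fun k => a (S k).

Lemma gsum_ext (f g : ser) (n : nat) :
  (forall i, i <= n -> f i = g i) -> gsum f n = gsum g n.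
Proof.
  induction n as [|n IH]; intros H; simpl; [apply H; lia|].
  rewrite IH by (intros i Hi; apply H; lia). now rewrite H by lia.
Qed.

Lemma gsum_add (f g : ser) (n : nat) : gsum (fun i => f i +! g i) n = gsum f n +! gsum g n.
Proof. induction n as [|n IH]; simpl; [reflexivity|rewrite IH; ring]. Qed.

Lemma gsum_scal (z : A) (f : ser) (n : nat) : gsum (fun i => z *! f i) n = z *! gsum f n.
Proof. induction n as [|n IH]; simpl; [reflexivity|rewrite IH; ring]. Qed.

Lemma gsum_zero (f : ser) (n : nat) : (forall i, i <= n -> f i = a0) -> gsum f n = a0.
Proof.
  induction n as [|n IH]; intros H; simpl; [apply H; lia|].
  rewrite IH by (intros i Hi; apply H; lia). rewrite H by lia. ring.
Qed.

Lemma gsum_S (f : ser) (n : nat) : gsum f (S n) = f O +! gsum (gtl f) n.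
Proof. induction n as [|n IH]; [reflexivity|]. simpl in *. rewrite IH. unfold gtl. ring. Qed.

Lemma gmul_S (a b : ser) (n : nat) : gmul a b (S n) = a O *! b (S n) +! gmul (gtl a) b n.
Proof. unfold gmul. rewrite gsum_S. simpl. reflexivity. Qed.

Lemma gmul_S' (a b : ser) (n : nat) : gmul a b (S n) = gmul a (gtl b) n +! a (S n) *! b O.
Proof.
  unfold gmul. cbn [gsum].
  rewrite Nat.sub_diag. f_equal.
  apply gsum_ext; intros i Hi. unfold gtl. now replace (S n - i) with (S (n - i)) by lia.
Qed.

Lemma gtl_mul (a b : ser) : gtl (gmul a b) = gadd (fun k => a O *! gtl b k) (gmul (gtl a) b).
Proof. extensionality k. unfold gtl at 1, gadd. now rewrite gmul_S. Qed.

Lemma gmul_comm (a b : ser) : gmul a b = gmul b a.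
Proof.
  extensionality k. revert a b; induction k as [|k IH]; intros a b.
  - unfold gmul; simpl; ring.
  - rewrite gmul_S, gmul_S', IH. ring.
Qed.

Lemma gmul_addl (a b c : ser) : gmul (gadd a b) c = gadd (gmul a c) (gmul b c).
Proof.
  extensionality k. unfold gadd, gmul. rewrite <- gsum_add. apply gsum_ext; intros; ring.
Qed.

Lemma gmul_scal (z : A) (a b : ser) : gmul (fun k => z *! a k) b = fun k => z *! gmul a b k.
Proof.
  extensionality k. unfold gmul. rewrite <- gsum_scal. apply gsum_ext; intros; ring.
Qed.

Lemma gmul_assoc (a b c : ser) : gmul a (gmul b c) = gmul (gmul a b) c.
Proof.
  extensionality k. revert a b c; induction k as [|k IH]; intros a b c.
  - unfold gmul; simpl; ring.
  - rewrite !gmul_S, gtl_mul, gmul_addl. unfold gadd. rewrite gmul_scal, IH.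
    change (gmul a b 0) with (a O *! b O). ring.
Qed.

Lemma gcst_mul (z : A) (a : ser) : gmul (gcst z) a = fun k => z *! a k.
Proof.
  extensionality k. destruct k as [|k]; [reflexivity|]. rewrite gmul_S. simpl.
  unfold gmul. rewrite gsum_zero; [ring|]. intros i _. unfold gtl; simpl. ring.
Qed.

Lemma geps_mul (a : ser) : gmul geps a = fun k => match k with O => a0 | S m => a m end.
Proof.
  extensionality k. destruct k as [|k]; [unfold gmul; simpl; ring|]. rewrite gmul_S.
  replace (gtl geps) with (gcst a1).
  - rewrite gcst_mul. simpl. ring.
  - extensionality j; destruct j; reflexivity.
Qed.

Lemma g_ring : ring_theory (gcst a0) (gcst a1) gadd gmul gsub gopp eq.
Proof.
  constructor; intros.
  - extensionality k; unfold gadd, gcst; destruct k; ring.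
  - extensionality k; unfold gadd; ring.
  - extensionality k; unfold gadd; ring.
  - rewrite gcst_mul; extensionality k; ring.
  - apply gmul_comm.
  - apply gmul_assoc.
  - apply gmul_addl.
  - extensionality k; unfold gsub, gadd, gopp; ring.
  - extensionality k; unfold gadd, gopp, gcst; destruct k; ring.
Qed.

Lemma g_split (a : ser) : a = gadd (gcst (a O)) (gmul geps (gtl a)).
Proof. rewrite geps_mul. extensionality k. unfold gadd, gcst, gtl. destruct k; ring. Qed.

Lemma gmul_top (a a' b b' : ser) (n : nat) :
  (forall j, j < S n -> a j = a' j) -> (forall j, j < S n -> b j = b' j) ->
  gmul a b (S n) -! gmul a' b' (S n) = a O *! (b (S n) -! b' (S n)) +! (a (S n) -! a' (S n)) *! b O.
Proof.
  intros Ha Hb. unfold gmul at 1 2. rewrite !gsum_S.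
  assert (E : gsum (gtl (fun i => a i *! b (S n - i))) n =
    gsum (gtl (fun i => a' i *! b' (S n - i))) n +! (a (S n) -! a' (S n)) *! b O).
  { destruct n as [|n].
    - unfold gtl; simpl. rewrite <- (Hb 0) by lia. ring.
    - cbn [gsum]. rewrite (gsum_ext _ (gtl (fun i => a' i *! b' (S (S n) - i))) n).
      + unfold gtl. rewrite Nat.sub_diag, <- (Hb 0) by lia. ring.
      + intros i Hi; unfold gtl. rewrite Ha, Hb by lia. reflexivity. }
  rewrite E, <- (Ha 0) by lia. simpl. ring.
Qed.

Lemma gmul_low (a f : ser) (n : nat) :
  (forall j, j < n -> f j = a0) -> gmul a f n = a O *! f n.
Proof.
  intros H. destruct n as [|n]; [reflexivity|].
  unfold gmul. rewrite gsum_S, gsum_zero; [simpl; ring|].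
  intros i Hi. unfold gtl. rewrite H by lia. ring.
Qed.

(* Truncated agreement: the topology in which the fixed-point maps below are contractions. *)
Definition agree (n : nat) (f g : ser) : Prop := forall j, j <= n -> f j = g j.

Lemma agree_refl n f : agree n f f. Proof. intros j _; reflexivity. Qed.
Lemma agree_add n f f' g g' : agree n f f' -> agree n g g' -> agree n (gadd f g) (gadd f' g').
Proof. intros H K j Hj; unfold gadd; rewrite H, K by assumption; reflexivity. Qed.
Lemma agree_sub n f f' g g' : agree n f f' -> agree n g g' -> agree n (gsub f g) (gsub f' g').
Proof. intros H K j Hj; unfold gsub; rewrite H, K by assumption; reflexivity. Qed.
Lemma agree_opp n f f' : agree n f f' -> agree n (gopp f) (gopp f').
Proof. intros H j Hj; unfold gopp; rewrite H by assumption; reflexivity. Qed.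
Lemma agree_mul n f f' g g' : agree n f f' -> agree n g g' -> agree n (gmul f g) (gmul f' g').
Proof.
  intros H K j Hj; unfold gmul. apply gsum_ext; intros i Hi. rewrite H, K by lia. reflexivity.
Qed.

Section Fix.
Context (b : A) (T : ser -> ser)
  (HT : forall n f g, agree n f g -> agree n (T f) (T g)).

Definition gstep (w : ser) : ser := fun n => match n with O => b | S m => T w m end.
Fixpoint giter (k : nat) : ser := match k with O => fun _ => b | S m => gstep (giter m) end.
Definition gfix : ser := fun n => giter (S n) n.

Lemma giter_stable (k m n : nat) : n < k -> n < m -> giter k n = giter m n.
Proof.
  revert k m; induction n as [n IH] using lt_wf_ind; intros k m Hk Hm.
  destruct k as [|k]; [lia|]. destruct m as [|m]; [lia|].
  destruct n as [|n]; [reflexivity|]. simpl.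
  apply (HT n); [|lia]. intros j Hj. apply IH; lia.
Qed.

Lemma gfix_eq : gfix = gadd (gcst b) (gmul geps (T gfix)).
Proof.
  rewrite geps_mul. extensionality n. destruct n as [|n].
  - change (b = b +! a0). ring.
  - change (T (giter (S n)) n = a0 +! T gfix n).
    rewrite (HT n (giter (S n)) gfix); [ring| |lia]. intros j Hj. unfold gfix.
    exact (giter_stable (S n) (S j) j ltac:(lia) ltac:(lia)).
Qed.

Lemma gfix_uniq (w : ser) : w = gadd (gcst b) (gmul geps (T w)) -> w = gfix.
Proof.
  intros E. extensionality n. induction n as [n IH] using lt_wf_ind.
  rewrite E, gfix_eq, !geps_mul. unfold gadd. destruct n as [|n]; [reflexivity|].
  f_equal. apply (HT n); [|lia]. intros j Hj. apply IH; lia.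
Qed.

(** Transfers a graded condition on coefficients from the recursion to its solution; it will carry
    homogeneity and parity. *)
Lemma gfix_ind (P : nat -> A -> Prop) :
  (forall n, P n a0) -> P O b ->
  (forall w, (forall n, P n (w n)) -> forall n, P n (gmul geps (T w) n)) ->
  forall n, P n (gfix n).
Proof.
  intros H0 Hb Hs.
  assert (K : forall k n, n < k -> P n (giter k n)).
  { induction k as [|k IH]; intros n Hn; [lia|].
    (* [Hs] wants the condition at every order, while the iterate satisfies it only below [k];
       cutting the iterate off by zeros does not change the coefficient in question. *)
    pose (w := fun j => if lt_dec j k then giter k j else a0).
    assert (Hw : forall j, P j (w j)) by (intros j; unfold w; destruct lt_dec; auto).
    destruct n as [|n]; [exact Hb|].
    specialize (Hs w Hw (S n)). rewrite geps_mul in Hs.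
    simpl. replace (T (giter k) n) with (T w n); [exact Hs|].
    apply (HT n); [|lia]. intros j Hj. unfold w. destruct lt_dec; [reflexivity|lia]. }
  intros n; apply K; lia.
Qed.
End Fix.

(** The inverse is the fixed point of w = g0 - eps g0 (tl f) w, where tl f is f without its constant
    term, divided by eps. *)
Lemma g_inverse (f : ser) (g0 : A) : f O *! g0 = a1 ->
  exists g, gmul f g = gcst a1 /\ g O = g0.
Proof.
  intros H.
  pose (T := fun w => gopp (gmul (fun k => g0 *! gtl f k) w)).
  assert (HT : forall n f g, agree n f g -> agree n (T f) (T g)).
  { intros; unfold T; apply agree_opp, agree_mul; auto using agree_refl. }
  exists (gfix g0 T). split; [|reflexivity].
  pose proof (gfix_eq g0 T HT) as E. set (w := gfix g0 T) in *. clearbody w. unfold T in E. clear T HT.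
  rewrite gmul_scal, geps_mul in E.
  assert (ES : forall n, w (S n) = a0 +! opp (g0 *! gmul (gtl f) w n)).
  { intros n. exact (f_equal (fun h => h (S n)) E). }
  assert (E0 : w O = g0) by (transitivity (g0 +! a0); [exact (f_equal (fun h => h O) E)|ring]).
  extensionality n. destruct n as [|n].
  - transitivity (f O *! w O); [reflexivity|]. rewrite E0; exact H.
  - rewrite gmul_S, ES. simpl.
    transitivity (gmul (gtl f) w n *! (a1 -! f O *! g0)); [ring|rewrite H; ring].
Qed.

(** The hypothesis on [gmul a f n] is conditional on the vanishing of the lower coefficients so that
    it covers equations a f = eps theta f, whose right side at order n involves only lower orders of
    f. *)
Lemma g_lead_zero (a f : ser) (b : A) :
  b *! a O = a1 -> (forall n, (forall j, j < n -> f j = a0) -> gmul a f n = a0) -> f = gcst a0.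
Proof.
  intros Hb H.
  assert (K : forall n, f n = a0).
  { intros n. induction n as [n IH] using lt_wf_ind.
    specialize (H n IH). rewrite gmul_low in H by exact IH.
    transitivity (b *! a O *! f n); [rewrite Hb; ring|].
    transitivity (b *! (a O *! f n)); [ring|rewrite H; ring]. }
  extensionality n; rewrite K; destruct n; reflexivity.
Qed.

Lemma g_cancel (a f : ser) (b : A) : b *! a O = a1 -> gmul a f = gcst a0 -> f = gcst a0.
Proof.
  intros Hb H. apply (g_lead_zero a f b Hb). intros n _. rewrite H. destruct n; reflexivity.
Qed.
End Series.

(** * Power series in eps = 1 / eta *)

Definition PS : Type := nat -> FA.
Definition padd : PS -> PS -> PS := gadd fadd.
Definition pmul : PS -> PS -> PS := gmul fadd fmul.
Definition psub : PS -> PS -> PS := gsub fsub.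
Definition popp : PS -> PS := gopp fopp.
Definition pc : FA -> PS := gcst (fcst 0).
Definition P0 : PS := pc (fcst 0).
Definition P1 : PS := pc (fcst 1).
Definition eps : PS := geps (fcst 0) (fcst 1).

Declare Scope ps_scope.
Delimit Scope ps_scope with ps.
Bind Scope ps_scope with PS.
Infix "+" := padd : ps_scope.
Infix "*" := pmul : ps_scope.
Infix "-" := psub : ps_scope.
Notation "- x" := (popp x) : ps_scope.
Open Scope R_scope.
Open Scope ps_scope.

Lemma PS_ring : ring_theory P0 P1 padd pmul psub popp eq.
Proof. exact (g_ring _ _ _ _ _ _ FA_ring). Qed.
Add Ring PSring : PS_ring.

Lemma ps_sub0 (f g : PS) : f - g = P0 -> f = g.
Proof. intros H. transitivity (f - g + g); [ring|rewrite H; ring]. Qed.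
(** For proofs by certificate: [lin e] proves an equality whose defect is the combination [e] of the
    defects of known equalities. [ring] checks the identity, and [dif0] makes [e] vanish. *)
Definition dif {l r : PS} (_ : l = r) : PS := l - r.
Lemma dif0 {l r : PS} (H : l = r) : dif H = P0.
Proof. unfold dif; rewrite H; ring. Qed.
Ltac lin e := apply ps_sub0; transitivity e; [unfold dif; ring|rewrite !dif0; ring].

Lemma ps_ext (f g : PS) : (forall k, f k = g k) -> f = g.
Proof. intros H; extensionality k; apply H. Qed.
Lemma padd_k f g k : (f + g) k = fadd (f k) (g k). Proof. reflexivity. Qed.
Lemma psub_k f g k : (f - g) k = fsub (f k) (g k). Proof. reflexivity. Qed.
Lemma popp_k f k : (- f) k = fopp (f k). Proof. reflexivity. Qed.
Lemma pc_mul_k a f k : (pc a * f) k = fmul a (f k).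
Proof. unfold pmul, pc. now rewrite (gcst_mul _ _ _ _ _ _ FA_ring). Qed.
Lemma eps_mul_S f k : (eps * f) (S k) = f k.
Proof. unfold pmul, eps. now rewrite (geps_mul _ _ _ _ _ _ FA_ring). Qed.
Lemma eps_mul_0 f : (eps * f) O = fcst 0.
Proof. unfold pmul, eps. now rewrite (geps_mul _ _ _ _ _ _ FA_ring). Qed.
Lemma pmul_0 f g : (f * g) O = fmul (f O) (g O).
Proof. reflexivity. Qed.

Lemma pc_add a b : pc (fadd a b) = pc a + pc b.
Proof. apply ps_ext; intros [|k]; unfold padd, gadd, pc, gcst; [reflexivity|]. ring. Qed.
Lemma pc_mul a b : pc (fmul a b) = pc a * pc b.
Proof. apply ps_ext; intros [|k]; rewrite pc_mul_k; [reflexivity|]. unfold pc, gcst. ring. Qed.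
Lemma pc_opp a : pc (fopp a) = - pc a.
Proof. apply ps_ext; intros [|k]; unfold popp, gopp, pc, gcst; [reflexivity|]. ring. Qed.

Lemma ps_split (f : PS) : f = pc (f O) + eps * gtl f.
Proof. exact (g_split _ _ _ _ _ _ FA_ring f). Qed.

Record isder (d : FA -> FA) : Prop := {
  der_add : forall a b, d (fadd a b) = fadd (d a) (d b);
  der_mul : forall a b, d (fmul a b) = fadd (fmul (d a) b) (fmul a (d b));
  der_cst : forall z, d (fcst z) = fcst 0 }.

Lemma isder_D1 : isder D1.
Proof. constructor; [exact D1_add|exact D1_mul|exact D1_cst]. Qed.
Lemma isder_Dy : isder Dy.
Proof. constructor; [exact Dy_add|exact Dy_mul|exact Dy_cst]. Qed.
Lemma isder_comb p q d e : isder d -> isder e -> isder (fun a => fadd (fmul p (d a)) (fmul q (e a))).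
Proof.
  intros H K; constructor; intros.
  - rewrite (der_add d H), (der_add e K); ring.
  - rewrite (der_mul d H), (der_mul e K); ring.
  - rewrite (der_cst d H), (der_cst e K); ring.
Qed.
Lemma der_cmul d z a : isder d -> d (fmul (fcst z) a) = fmul (fcst z) (d a).
Proof. intros H; rewrite (der_mul d H), (der_cst d H). ring. Qed.
Lemma der_opp d a : isder d -> d (fopp a) = fopp (d a).
Proof. intros H. apply (der_cmul d (-1) a H). Qed.
Lemma der_sub d a b : isder d -> d (fsub a b) = fsub (d a) (d b).
Proof. intros H; unfold fsub; rewrite (der_add d H), (der_opp d _ H). reflexivity. Qed.

Lemma der_gsum d (f : nat -> FA) n : isder d -> d (gsum fadd f n) = gsum fadd (fun i => d (f i)) n.
Proof. intros H; induction n as [|n IH]; simpl; [reflexivity|]. now rewrite (der_add d H), IH. Qed.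

Definition pm (d : FA -> FA) (f : PS) : PS := fun k => d (f k).

Section Pm.
Context (d : FA -> FA) (Hd : isder d).
Lemma pm_add f g : pm d (f + g) = pm d f + pm d g.
Proof. apply ps_ext; intros k; apply (der_add d Hd). Qed.
Lemma pm_opp f : pm d (- f) = - pm d f.
Proof. apply ps_ext; intros k; apply (der_opp d _ Hd). Qed.
Lemma pm_sub f g : pm d (f - g) = pm d f - pm d g.
Proof. apply ps_ext; intros k; apply (der_sub d _ _ Hd). Qed.
Lemma pm_pc a : pm d (pc a) = pc (d a).
Proof. apply ps_ext; intros [|k]; [reflexivity|]. apply (der_cst d Hd). Qed.
Lemma pm_eps : pm d eps = P0.
Proof. apply ps_ext; intros [|[|k]]; apply (der_cst d Hd). Qed.
Lemma pm_mul f g : pm d (f * g) = pm d f * g + f * pm d g.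
Proof.
  apply ps_ext; intros k. unfold pm, padd, gadd, pmul, gmul.
  rewrite <- (gsum_add _ _ _ _ _ _ FA_ring).
  rewrite (der_gsum d _ _ Hd). apply gsum_ext; intros i _. apply (der_mul d Hd).
Qed.
Lemma pm_cmul z f : pm d (pc (fcst z) * f) = pc (fcst z) * pm d f.
Proof. rewrite pm_mul, pm_pc, (der_cst d Hd). unfold P0. change (pc (fcst 0)) with P0. ring. Qed.
Lemma pm_epsmul f : pm d (eps * f) = eps * pm d f.
Proof. rewrite pm_mul, pm_eps. ring. Qed.
End Pm.

Lemma agree_pm n d f g : agree n f g -> agree n (pm d f) (pm d g).
Proof. intros H j Hj; unfold pm; now rewrite H. Qed.

Definition nsc (n : nat) : FA := fcst (INR n).
(* The Euler operator eps * d/deps. *)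
Definition pN (f : PS) : PS := fun k => fmul (nsc k) (f k).

Lemma nsc_add n m : nsc (n + m) = fadd (nsc n) (nsc m).
Proof. unfold nsc. fa_ext. rewrite plus_INR, RtoC_plus. reflexivity. Qed.
Lemma nsc_0 : nsc 0 = fcst 0. Proof. reflexivity. Qed.
Lemma nsc_1 : nsc 1 = fcst 1. Proof. reflexivity. Qed.
Lemma nsc_inv n : fmul (fcst (/ INR (S n))) (nsc (S n)) = fcst 1.
Proof.
  unfold nsc. fa_ext. apply Cinv_l. intros E. apply (not_0_INR (S n)); [lia|]. now apply RtoC_inj.
Qed.
Lemma nsc_cancel n a b : fmul (nsc (S n)) a = fmul (nsc (S n)) b -> a = b.
Proof.
  intros H. transitivity (fmul (fmul (fcst (/ INR (S n))) (nsc (S n))) a); [rewrite nsc_inv; ring|].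
  transitivity (fmul (fcst (/ INR (S n))) (fmul (nsc (S n)) a)); [ring|]. rewrite H.
  transitivity (fmul (fmul (fcst (/ INR (S n))) (nsc (S n))) b); [ring|rewrite nsc_inv; ring].
Qed.

Lemma pN_add f g : pN (f + g) = pN f + pN g.
Proof. apply ps_ext; intros k; unfold pN, padd, gadd; ring. Qed.
Lemma pN_sub f g : pN (f - g) = pN f - pN g.
Proof. apply ps_ext; intros k; unfold pN, psub, gsub; ring. Qed.
Lemma pN_opp f : pN (- f) = - pN f.
Proof. apply ps_ext; intros k; unfold pN, popp, gopp; ring. Qed.
Lemma pN_pc a : pN (pc a) = P0.
Proof. apply ps_ext; intros [|k]; unfold pN, pc, P0, pc, gcst; [rewrite nsc_0|]; ring. Qed.
Lemma pN_eps : pN eps = eps.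
Proof. apply ps_ext; intros [|[|k]]; unfold pN, eps, geps; [|rewrite nsc_1|]; ring. Qed.
Lemma pN_mul f g : pN (f * g) = pN f * g + f * pN g.
Proof.
  apply ps_ext; intros k. unfold pN, padd, gadd, pmul, gmul.
  rewrite <- (gsum_scal _ _ _ _ _ _ FA_ring), <- (gsum_add _ _ _ _ _ _ FA_ring).
  apply gsum_ext. intros i Hi. replace k with (i + (k - i))%nat at 1 by lia.
  rewrite nsc_add. ring.
Qed.
Lemma pN_pm d f : isder d -> pN (pm d f) = pm d (pN f).
Proof. intros H; apply ps_ext; intros k; unfold pN, pm, nsc. now rewrite (der_cmul d _ _ H). Qed.

Definition sg (k : nat) : FA := fcst ((- 1) ^ k).
(** The substitution eps -> -eps at fixed (u, y). Up to sign it exchanges the two Riccati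
    solutions. *)
Definition star (f : PS) : PS := fun k => fmul (sg k) (f k).

Lemma sg_add n m : sg (n + m) = fmul (sg n) (sg m).
Proof. unfold sg. fa_ext. apply Cpow_add_r. Qed.
Lemma star_add f g : star (f + g) = star f + star g.
Proof. apply ps_ext; intros k; unfold star, padd, gadd; ring. Qed.
Lemma star_sub f g : star (f - g) = star f - star g.
Proof. apply ps_ext; intros k; unfold star, psub, gsub; ring. Qed.
Lemma star_opp f : star (- f) = - star f.
Proof. apply ps_ext; intros k; unfold star, popp, gopp; ring. Qed.
Lemma star_pc a : star (pc a) = pc a.
Proof.
  apply ps_ext; intros [|k]; unfold star, pc, gcst; [|ring].
  unfold sg. replace (fcst ((-1) ^ 0)) with (fcst 1) by (fa_ext; simpl; ring). ring.
Qed.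
Lemma star_eps : star eps = - eps.
Proof.
  apply ps_ext; intros [|[|k]]; unfold star, popp, gopp, eps, geps; try ring.
  unfold sg. replace (fcst ((-1) ^ 1)) with (fopp (fcst 1)) by (fa_ext; simpl; ring). ring.
Qed.
Lemma star_mul f g : star (f * g) = star f * star g.
Proof.
  apply ps_ext; intros k. unfold star, pmul, gmul.
  rewrite <- (gsum_scal _ _ _ _ _ _ FA_ring).
  apply gsum_ext. intros i Hi. replace k with (i + (k - i))%nat at 1 by lia.
  rewrite sg_add. ring.
Qed.
Lemma star_pm d f : isder d -> star (pm d f) = pm d (star f).
Proof. intros H; apply ps_ext; intros k; unfold star, pm, sg. now rewrite (der_cmul d _ _ H). Qed.

Section Op.
Context (d : FA -> FA) (Hd : isder d).

(* [Op c f] is  sum_n c_n eps^n d^n f. *)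
Fixpoint opk (n : nat) (c : nat -> C) (f : PS) : FA :=
  match n with
  | O => fmul (fcst (c O)) (f O)
  | S m => fadd (fmul (fcst (c O)) (f (S m))) (opk m (gtl c) (pm d f))
  end.
Definition Op (c : nat -> C) (f : PS) : PS := fun n => opk n c f.

Lemma Op_rec c f : Op c f = pc (fcst (c O)) * f + eps * Op (gtl c) (pm d f).
Proof.
  apply ps_ext; intros [|n]; rewrite padd_k, pc_mul_k; [rewrite eps_mul_0|rewrite eps_mul_S];
    unfold Op; simpl; [ring|reflexivity].
Qed.

Lemma Op_add c f g : Op c (f + g) = Op c f + Op c g.
Proof.
  apply ps_ext; intros n. unfold Op. rewrite padd_k. revert c f g; induction n as [|n IH]; intros; simpl.
  - rewrite padd_k; ring.
  - rewrite (pm_add d Hd), IH, padd_k. ring.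
Qed.
Lemma Op_cmul c z f : Op c (pc (fcst z) * f) = pc (fcst z) * Op c f.
Proof.
  apply ps_ext; intros n. unfold Op. rewrite pc_mul_k. revert c f; induction n as [|n IH]; intros; simpl.
  - rewrite pc_mul_k; ring.
  - rewrite (pm_cmul d Hd), IH, pc_mul_k. ring.
Qed.
Lemma Op_opp c f : Op c (- f) = - Op c f.
Proof.
  assert (E : forall g, - g = pc (fcst (-1)) * g).
  { intros g; apply ps_ext; intros k; rewrite pc_mul_k; reflexivity. }
  now rewrite !E, Op_cmul.
Qed.
Lemma Op_sub c f g : Op c (f - g) = Op c f - Op c g.
Proof.
  replace (f - g) with (f + - g) by ring. rewrite Op_add, Op_opp. ring.
Qed.
Lemma Op_eps c f : Op c (eps * f) = eps * Op c f.
Proof.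
  apply ps_ext; intros n. revert c f; induction n as [|n IH]; intros c f.
  - rewrite eps_mul_0. unfold Op; simpl. rewrite eps_mul_0. ring.
  - rewrite Op_rec, padd_k, pc_mul_k, !eps_mul_S, (pm_epsmul d Hd), (Op_rec c f), padd_k, pc_mul_k.
    destruct n as [|n].
    + rewrite eps_mul_0. unfold Op; simpl. rewrite eps_mul_0. ring.
    + rewrite eps_mul_S, IH, eps_mul_S. reflexivity.
Qed.
Lemma Op_pm (d' : FA -> FA) c f : isder d' -> (forall a, d' (d a) = d (d' a)) ->
  pm d' (Op c f) = Op c (pm d' f).
Proof.
  intros H' Hc. apply ps_ext; intros n. unfold Op, pm at 1.
  revert c f; induction n as [|n IH]; intros; simpl.
  - now rewrite (der_cmul d' _ _ H').
  - rewrite (der_add d' H'), (der_cmul d' _ _ H'), IH. do 2 f_equal. 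
    apply ps_ext; intros k; apply Hc.
Qed.
Definition cmulser : (nat -> C) -> (nat -> C) -> nat -> C := gmul Cplus Cmult.
Lemma Op_cadd c e f : Op (fun n => c n + e n)%C f = Op c f + Op e f.
Proof.
  apply ps_ext; intros n. rewrite padd_k. unfold Op. revert c e f; induction n as [|n IH]; intros; simpl.
  - replace (fcst (c O + e O)%C) with (fadd (fcst (c O)) (fcst (e O))) by fa_ring. ring.
  - replace (fcst (c O + e O)%C) with (fadd (fcst (c O)) (fcst (e O))) by fa_ring.
    unfold gtl at 1. rewrite (IH (gtl c) (gtl e)). ring.
Qed.
Lemma Op_cscal z c f : Op (fun n => z * c n)%C f = pc (fcst z) * Op c f.
Proof.
  apply ps_ext; intros n. rewrite pc_mul_k. unfold Op. revert c f; induction n as [|n IH]; intros; simpl.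
  - replace (fcst (z * c O)%C) with (fmul (fcst z) (fcst (c O))) by fa_ring. ring.
  - replace (fcst (z * c O)%C) with (fmul (fcst z) (fcst (c O))) by fa_ring.
    unfold gtl at 1. rewrite (IH (gtl c)). ring.
Qed.
(** Constant coefficients commute with [d], so composition of operators is multiplication of
    symbols. Inverting S - 1 is thereby reduced to the numerical identity [cB_cem]. *)
Lemma Op_comp c e f : Op c (Op e f) = Op (cmulser c e) f.
Proof.
  apply ps_ext; intros n. revert c e f; induction n as [|n IH]; intros.
  - unfold Op, cmulser, gmul; simpl.
    replace (fcst (c O * e O)%C) with (fmul (fcst (c O)) (fcst (e O))) by fa_ring. ring.
  - rewrite (Op_rec (cmulser c e)), (Op_rec c), (Op_rec e).
    rewrite !padd_k, !pc_mul_k, !eps_mul_S.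
    assert (E : gtl (cmulser c e) = fun k => (c O * gtl e k + cmulser (gtl c) e k)%C)
      by exact (gtl_mul _ _ _ _ _ _ C_ring_theory c e).
    rewrite E, (Op_cadd (fun k => c O * gtl e k)%C (cmulser (gtl c) e)), Op_cscal, padd_k, pc_mul_k.
    rewrite padd_k, pc_mul_k, <- IH, <- (Op_rec e), (Op_pm d e f Hd), eps_mul_S by reflexivity.
    replace (fcst (cmulser c e O)) with (fmul (fcst (c O)) (fcst (e O)))
      by (unfold cmulser, gmul; simpl gsum; fa_ring). ring.
Qed.

Definition cexp (n : nat) : C := / INR (fact n).
Definition Sh : PS -> PS := Op cexp.

Lemma Sh_cst_S a n : fmul (nsc (S n)) (Sh (pc a) (S n)) = Sh (pc (d a)) n.
Proof.
  unfold Sh.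
  assert (K : forall n c a, Op c (pc a) (S n) = Op (gtl c) (pc (d a)) n).
  { intros m c b. rewrite Op_rec, padd_k, pc_mul_k, eps_mul_S, (pm_pc d Hd). unfold pc at 1, gcst. ring. }
  (* On a constant series only the single number [c n] enters the coefficient of index n, so a
     rescaling of that number passes through. *)
  assert (K2 : forall n c e z b, (c n = z * e n)%C -> Op c (pc b) n = fmul (fcst z) (Op e (pc b) n)).
  { clear n a. induction n as [|n IH]; intros c e z b E.
    - unfold Op; simpl. rewrite E. replace (fcst (z * e O)%C) with (fmul (fcst z) (fcst (e O))) by fa_ring. ring.
    - rewrite !K. apply IH, E. }
  rewrite K. rewrite (K2 n (gtl cexp) cexp (/ INR (S n))%C).
  - transitivity (fmul (fmul (fcst (/ INR (S n))) (nsc (S n))) (Op cexp (pc (d a)) n)); [ring|].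
    rewrite nsc_inv; ring.
  - unfold gtl, cexp. rewrite fact_simpl, mult_INR, RtoC_mult.
    assert (RtoC (INR (S n)) <> 0%C) by (intros E; apply RtoC_inj in E; revert E; apply not_0_INR; lia).
    assert (RtoC (INR (fact n)) <> 0%C) by (intros E; apply RtoC_inj in E; revert E; apply INR_fact_neq_0).
    field; split; assumption.
Qed.

Lemma Sh_0 f : Sh f O = f O.
Proof. unfold Sh, Op, cexp; simpl. replace (fcst (/ 1)) with (fcst 1) by (fa_ext; field). ring. Qed.

Lemma pN_Sh_pc a : pN (Sh (pc a)) = eps * Sh (pc (d a)).
Proof.
  apply ps_ext; intros [|n]; unfold pN; [rewrite eps_mul_0, nsc_0; ring|].
  rewrite eps_mul_S. apply Sh_cst_S.
Qed.

(** No binomial formula is needed: by [pN_Sh_pc] both sides satisfy the same differential equation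
    in eps, and multiplication by n + 1 is injective. *)
Lemma Sh_pc_mul a b : Sh (pc (fmul a b)) = Sh (pc a) * Sh (pc b).
Proof.
  apply ps_ext; intros n. revert a b; induction n as [|n IH]; intros.
  - rewrite pmul_0, !Sh_0. reflexivity.
  - apply (nsc_cancel n). rewrite Sh_cst_S, (der_mul d Hd), pc_add.
    change (fmul (nsc (S n)) ((Sh (pc a) * Sh (pc b)) (S n))) with (pN (Sh (pc a) * Sh (pc b)) (S n)).
    rewrite pN_mul, !pN_Sh_pc.
    replace (eps * Sh (pc (d a)) * Sh (pc b) + Sh (pc a) * (eps * Sh (pc (d b))))
      with (eps * (Sh (pc (d a)) * Sh (pc b) + Sh (pc a) * Sh (pc (d b)))) by ring.
    rewrite eps_mul_S, padd_k, <- !IH. unfold Sh; rewrite Op_add. reflexivity.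
Qed.

Lemma Sh_mul f g : Sh (f * g) = Sh f * Sh g.
Proof.
  assert (Hs : forall f, Sh f = Sh (pc (f O)) + eps * Sh (gtl f)).
  { intros h. rewrite (ps_split h) at 1. unfold Sh. now rewrite Op_add, Op_eps. }
  apply ps_ext; intros n. revert f g; induction n as [|n IH]; intros.
  - rewrite pmul_0, !Sh_0. reflexivity.
  - rewrite (ps_split f) at 1. rewrite (Hs f).
    replace ((pc (f O) + eps * gtl f) * g) with (pc (f O) * g + eps * (gtl f * g)) by ring.
    replace ((Sh (pc (f O)) + eps * Sh (gtl f)) * Sh g) with (Sh (pc (f O)) * Sh g + eps * (Sh (gtl f) * Sh g)) by ring.
    assert (E : Sh (pc (f O) * g + eps * (gtl f * g)) = Sh (pc (f O) * g) + eps * Sh (gtl f * g))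
      by (unfold Sh; now rewrite Op_add, Op_eps).
    rewrite E, !padd_k, !eps_mul_S, IH. f_equal.
    rewrite (Hs g). rewrite (ps_split g) at 1.
    replace (pc (f O) * (pc (g O) + eps * gtl g)) with (pc (fmul (f O) (g O)) + eps * (pc (f O) * gtl g))
      by (rewrite pc_mul; ring).
    assert (E2 : Sh (pc (fmul (f O) (g O)) + eps * (pc (f O) * gtl g))
      = Sh (pc (fmul (f O) (g O))) + eps * Sh (pc (f O) * gtl g)) by (unfold Sh; now rewrite Op_add, Op_eps).
    rewrite E2, Sh_pc_mul, padd_k, eps_mul_S, IH.
    replace (Sh (pc (f O)) * (Sh (pc (g O)) + eps * Sh (gtl g)))
      with (Sh (pc (f O)) * Sh (pc (g O)) + eps * (Sh (pc (f O)) * Sh (gtl g))) by ring.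
    rewrite padd_k, eps_mul_S. reflexivity.
Qed.

Lemma Sh_add f g : Sh (f + g) = Sh f + Sh g. Proof. apply Op_add. Qed.
Lemma Sh_sub f g : Sh (f - g) = Sh f - Sh g. Proof. apply Op_sub. Qed.
Lemma Sh_opp f : Sh (- f) = - Sh f. Proof. apply Op_opp. Qed.
Lemma Sh_pc_0 a : d a = fcst 0 -> Sh (pc a) = pc a.
Proof.
  intros H. apply ps_ext; intros [|n]; [apply Sh_0|].
  apply (nsc_cancel n). rewrite Sh_cst_S, H. unfold pc at 2, gcst.
  assert (E : Sh (pc (fcst 0)) = P0).
  { change (pc (fcst 0)) with P0. replace P0 with (P0 - P0) at 1 by ring. rewrite Sh_sub. ring. }
  rewrite E. destruct n; unfold P0, pc, gcst; ring.
Qed.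
Lemma Sh_eps : Sh eps = eps.
Proof.
  replace eps with (eps * P1) at 1 by ring. unfold Sh; rewrite Op_eps.
  change (Op cexp P1) with (Sh (pc (fcst 1))). rewrite Sh_pc_0 by apply (der_cst d Hd).
  change (pc (fcst 1)) with P1. ring.
Qed.
End Op.

(** * The derivations d/dt and d/dc *)

Declare Scope fa_scope.
Delimit Scope fa_scope with fa.
Infix "+" := fadd : fa_scope.
Infix "*" := fmul : fa_scope.
Infix "-" := fsub : fa_scope.
Notation "- x" := (fopp x) : fa_scope.
Notation f0 := (fcst 0).
Notation f1 := (fcst 1).

(* With u = lambda_0 / t and y = 1 / (lambda_0 sqrt Delta) one has c = 1 / u + 2 t u^2 and
   1 / y^2 = 1 - 4 t u^3, which gives [tA] and [cA]; differentiating these relations gives the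
   coefficients of [th] = t d/dt at fixed c and of [dc] = d/dc at fixed t in terms of
   [D1] = u d/du and [Dy] = d/dy. *)
Definition hA : FA := (fcst (/ 2) * (fy * fy - f1))%fa.
Definition qA : FA := (fcst (/ 4) * (fy * (fy * fy - f1) * (fcst 3 * fy * fy - f1)))%fa.
Definition rA : FA := (- (fu * fy * fy))%fa.
Definition sA : FA := (- (fcst (3 / 2) * (fu * (fy * fy * fy) * (fy * fy - f1))))%fa.
Definition th (a : FA) : FA := (hA * D1 a + qA * Dy a)%fa.
Definition dc (a : FA) : FA := (rA * D1 a + sA * Dy a)%fa.
Definition tA : FA := (fcst (/ 4) * ((fy * fy - f1) * (fui * fui * fui) * (fyi * fyi)))%fa.
Definition cA : FA := (fcst (/ 2) * ((fcst 3 * fy * fy - f1) * (fui * fyi * fyi)))%fa.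
Definition k0A : FA := (fcst (/ 4) * (fy * fy * (fy * fy - f1) * (fcst 3 * fy * fy - f1)))%fa.
Definition n0A : FA := (fcst (/ 4) * ((fy * fy - f1) * (fcst 3 * fy * fy + f1)))%fa.

Lemma isder_th : isder th.
Proof. apply isder_comb; [exact isder_D1|exact isder_Dy]. Qed.
Lemma isder_dc : isder dc.
Proof. apply isder_comb; [exact isder_D1|exact isder_Dy]. Qed.

Ltac dstep := repeat first [rewrite D1_mul | rewrite D1_add | rewrite Dy_mul | rewrite Dy_add
  | rewrite (der_opp D1 _ isder_D1) | rewrite (der_opp Dy _ isder_Dy)
  | rewrite (der_sub D1 _ _ isder_D1) | rewrite (der_sub Dy _ _ isder_Dy)
  | rewrite D1_cst | rewrite Dy_cst | rewrite D1_u | rewrite D1_ui | rewrite D1_y | rewrite D1_yi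
  | rewrite Dy_u | rewrite Dy_ui | rewrite Dy_y | rewrite Dy_yi].
Ltac cf := match goal with H : ok _ _ |- _ => destruct H as (? & ? & ?) end;
  field; repeat split; try assumption; try (intros E; apply RtoC_inj in E; lra).
Ltac ff := unfold th, dc; unfold hA, qA, rA, sA, tA, cA, k0A, n0A; dstep; fa_ext; cf.

Lemma th_u : th fu = (fu * hA)%fa. Proof. ff. Qed.
Lemma th_h : th hA = k0A. Proof. ff. Qed.
Lemma th_uy : th (fu * fy)%fa = (fu * fy * n0A)%fa. Proof. ff. Qed.
Lemma th_E : th (fui * fyi)%fa = (- (fui * fyi * n0A))%fa. Proof. ff. Qed.
Lemma th_c : th cA = f0. Proof. ff. Qed.
Lemma th_t : th tA = tA. Proof. ff. Qed.
Lemma dc_c : dc cA = f1. Proof. ff. Qed.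
Lemma dc_t : dc tA = f0. Proof. ff. Qed.
Lemma dc_u : dc fu = (- (fu * fu * fy * fy))%fa. Proof. ff. Qed.
Lemma dc_ui : dc fui = (fy * fy)%fa. Proof. ff. Qed.

(** Infinitesimal form of the scaling of (t, c, lambda) with weights (3, 1, 2), under which u has
    weight -1 and y has weight 0. *)
Lemma euler a : (fcst 3 * th a + cA * dc a)%fa = (- D1 a)%fa. Proof. ff. Qed.
Lemma th_dc a : th (dc a) = dc (th a).
Proof.
  unfold th, dc. dstep. rewrite D_comm. unfold hA, qA, rA, sA. dstep. fa_ext. cf.
Qed.
Lemma D1_th a : D1 (th a) = th (D1 a).
Proof. unfold th. dstep. rewrite <- D_comm. unfold hA, qA. dstep. fa_ext. cf. Qed.
Lemma D1_dc a : D1 (dc a) = (dc (D1 a) + dc a)%fa.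
Proof. unfold dc. dstep. rewrite <- D_comm. unfold rA, sA. dstep. fa_ext. cf. Qed.

Lemma rel_yyi : (fy * fyi)%fa = f1. Proof. ff. Qed.
Lemma rel_uui : (fu * fui)%fa = f1. Proof. ff. Qed.
Lemma rel_yy : (fy * fy)%fa = (hA + hA + f1)%fa. Proof. ff. Qed.
Lemma rel_t : (tA + tA)%fa = (hA * (fui * fui * fui * fyi * fyi))%fa. Proof. ff. Qed.
Lemma rel_c : cA = ((hA + hA + hA + f1) * (fui * fyi * fyi))%fa. Proof. ff. Qed.

(* [Sym a b] says that b is the image of a under the sheet exchange y -> -y. *)
Definition Sym (a b : FA) : Prop := forall u y, ok u y -> ok u (- y)%C -> ev a u (- y)%C = ev b u y.

Lemma Sym_add a b a' b' : Sym a b -> Sym a' b' -> Sym (a + a')%fa (b + b')%fa.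
Proof. intros H K u y Ho Ho'. rewrite !ev_add by assumption. now rewrite H, K. Qed.
Lemma Sym_mul a b a' b' : Sym a b -> Sym a' b' -> Sym (a * a')%fa (b * b')%fa.
Proof. intros H K u y Ho Ho'. rewrite !ev_mul by assumption. now rewrite H, K. Qed.
Lemma Sym_cst z : Sym (fcst z) (fcst z).
Proof. intros u y Ho Ho'. now rewrite !ev_cst. Qed.
Lemma Sym_opp a b : Sym a b -> Sym (- a)%fa (- b)%fa.
Proof. intros H; apply Sym_mul; [apply Sym_cst|exact H]. Qed.
Lemma Sym_sub a b a' b' : Sym a b -> Sym a' b' -> Sym (a - a')%fa (b - b')%fa.
Proof. intros H K; apply Sym_add; [exact H|now apply Sym_opp]. Qed.
Lemma Sym_u : Sym fu fu. Proof. intros u y H K; now rewrite !ev_u. Qed.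
Lemma Sym_ui : Sym fui fui. Proof. intros u y H K; now rewrite !ev_ui. Qed.
Lemma Sym_y : Sym fy (- fy)%fa. Proof. intros u y H K; now rewrite ev_opp, !ev_y. Qed.
Lemma Sym_yi : Sym fyi (- fyi)%fa.
Proof. intros u y H K; rewrite ev_opp, !ev_yi by assumption.
  destruct H as (_ & H & _). field; assumption. Qed.

Lemma Sym_derive a b u y p q : Sym a b -> ok u y -> ok u (- y)%C ->
  (ev (D1 a) u (- y) * / u * p + ev (Dy a) u (- y) * - q =
   ev (D1 b) u y * / u * p + ev (Dy b) u y * q)%C.
Proof.
  intros H Ho Ho'.
  set (U := fun s : R => (u + RtoC s * p)%C). set (Y := fun s : R => (y + RtoC s * q)%C).
  set (Y' := fun s : R => (- y + RtoC s * - q)%C).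
  assert (EU : U 0%R = u) by (unfold U; ring). assert (EY : Y 0%R = y) by (unfold Y; ring).
  assert (EY' : Y' 0%R = (- y)%C) by (unfold Y'; ring).
  assert (H1 : is_derive U 0%R p) by apply is_derive_line.
  assert (H2 : is_derive Y 0%R q) by apply is_derive_line.
  assert (H3 : is_derive Y' 0%R (- q)%C) by apply is_derive_line.
  assert (Hb : ok (U 0%R) (Y 0%R)) by (rewrite EU, EY; exact Ho).
  assert (Hb' : ok (U 0%R) (Y' 0%R)) by (rewrite EU, EY'; exact Ho').
  pose proof (ev_derive a U Y' 0%R p (- q) Hb' H1 H3) as K1.
  pose proof (ev_derive b U Y 0%R p q Hb H1 H2) as K2.
  rewrite EU, EY' in K1. rewrite EU, EY in K2.
  refine (is_derive_C_uniq (fun s => ev b (U s) (Y s)) 0%R _ _ _ K2).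
  apply (is_derive_ext_loc (V := CN)) with (2 := K1).
  destruct (ok_near U Y 0%R _ _ H1 H2 Hb) as [e1 E1].
  destruct (ok_near U Y' 0%R _ _ H1 H3 Hb') as [e2 E2].
  assert (L : locally 0%R (fun s => ok (U s) (Y s) /\ ok (U s) (Y' s))).
  { apply filter_and; [exists e1; exact E1|exists e2; exact E2]. }
  destruct L as [e L]. exists e. intros s Hs. destruct (L s Hs) as [L1 L2].
  assert (E : Y' s = (- Y s)%C) by (unfold Y, Y'; ring).
  rewrite E in L2 |- *. now apply H.
Qed.

Lemma Sym_D1 a b : Sym a b -> Sym (D1 a) (D1 b).
Proof.
  intros H u y Ho Ho'. pose proof (Sym_derive a b u y u 0 H Ho Ho') as E. destruct Ho as (Hu & _ & _).
  transitivity (ev (D1 a) u (- y) * / u * u + ev (Dy a) u (- y) * - 0)%C; [field; assumption|].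
  rewrite E. field; assumption.
Qed.
Lemma Sym_Dy a b : Sym a b -> Sym (Dy a) (- Dy b)%fa.
Proof.
  intros H u y Ho Ho'. pose proof (Sym_derive a b u y 0 1 H Ho Ho') as E. rewrite ev_opp by assumption.
  transitivity (- (ev (D1 a) u (- y) * / u * 0 + ev (Dy a) u (- y) * - (1)))%C; [ring|].
  rewrite E. ring.
Qed.
Lemma Sym_eq a b b' : Sym a b -> b = b' -> Sym a b'. Proof. now intros H <-. Qed.
Ltac sym_atoms := repeat first [apply Sym_opp | apply Sym_sub | apply Sym_add | apply Sym_mul
  | apply Sym_cst | apply Sym_u | apply Sym_ui | apply Sym_y | apply Sym_yi].
Ltac sym_poly := eapply Sym_eq; [sym_atoms|ring].
Lemma Sym_h : Sym hA hA. Proof. unfold hA. sym_poly. Qed.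
Lemma Sym_t : Sym tA tA. Proof. unfold tA. sym_poly. Qed.
Lemma Sym_c : Sym cA cA. Proof. unfold cA. sym_poly. Qed.
Lemma Sym_th a b : Sym a b -> Sym (th a) (th b).
Proof.
  intros H. unfold th, qA. eapply Sym_eq.
  - apply Sym_add; apply Sym_mul; [apply Sym_h|apply Sym_D1, H|sym_atoms|apply Sym_Dy, H].
  - ring.
Qed.
Lemma Sym_dc a b : Sym a b -> Sym (dc a) (dc b).
Proof.
  intros H. unfold dc, rA, sA. eapply Sym_eq.
  - apply Sym_add; apply Sym_mul; [sym_atoms|apply Sym_D1, H|sym_atoms|apply Sym_Dy, H].
  - ring.
Qed.

Definition SymP (f g : PS) : Prop := forall k, Sym (f k) (g k).
Lemma SymP_eq f g g' : SymP f g -> g = g' -> SymP f g'. Proof. now intros H <-. Qed.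
Lemma SymP_add f g f' g' : SymP f g -> SymP f' g' -> SymP (f + f') (g + g').
Proof. intros H K k; apply Sym_add; auto. Qed.
Lemma SymP_sub f g f' g' : SymP f g -> SymP f' g' -> SymP (f - f') (g - g').
Proof. intros H K k; apply Sym_sub; auto. Qed.
Lemma SymP_opp f g : SymP f g -> SymP (- f) (- g).
Proof. intros H k; apply Sym_opp; auto. Qed.
Lemma Sym_gsum (F G : nat -> FA) n :
  (forall i, Sym (F i) (G i)) -> Sym (gsum fadd F n) (gsum fadd G n).
Proof. intros H; induction n as [|n IH]; simpl; [apply H|apply Sym_add; [exact IH|apply H]]. Qed.
Lemma SymP_mul f g f' g' : SymP f g -> SymP f' g' -> SymP (f * f') (g * g').
Proof.
  intros H K k. apply Sym_gsum; intros i. apply Sym_mul; auto.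
Qed.
Lemma SymP_pc a b : Sym a b -> SymP (pc a) (pc b).
Proof. intros H [|k]; [exact H|apply Sym_cst]. Qed.
Lemma SymP_eps : SymP eps eps. Proof. intros [|[|k]]; apply Sym_cst. Qed.
Lemma SymP_th f g : SymP f g -> SymP (pm th f) (pm th g).
Proof. intros H k; apply Sym_th, H. Qed.
Lemma SymP_dc f g : SymP f g -> SymP (pm dc f) (pm dc g).
Proof. intros H k; apply Sym_dc, H. Qed.
Lemma SymP_Op c f g : SymP f g -> SymP (Op dc c f) (Op dc c g).
Proof.
  intros H k. unfold Op. revert c f g H; induction k as [|k IH]; intros c f g H; simpl.
  - apply Sym_mul; [apply Sym_cst|apply H].
  - apply Sym_add; [apply Sym_mul; [apply Sym_cst|apply H]|]. apply IH. now apply SymP_dc.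
Qed.

(* Coefficient k of a series in [Nice] is homogeneous of degree k in u and has parity k in y,
   like the k-th power of eps * u * y. *)
Definition Nice (f : PS) : Prop := pm D1 f = pN f /\ SymP f (star f).

Lemma Nice_add f g : Nice f -> Nice g -> Nice (f + g).
Proof.
  intros [H1 H2] [K1 K2]; split.
  - now rewrite (pm_add D1 isder_D1), pN_add, H1, K1.
  - rewrite star_add. now apply SymP_add.
Qed.
Lemma Nice_sub f g : Nice f -> Nice g -> Nice (f - g).
Proof.
  intros [H1 H2] [K1 K2]; split.
  - now rewrite (pm_sub D1 isder_D1), pN_sub, H1, K1.
  - rewrite star_sub. now apply SymP_sub.
Qed.
Lemma Nice_opp f : Nice f -> Nice (- f).
Proof.
  intros [H1 H2]; split.
  - now rewrite (pm_opp D1 isder_D1), pN_opp, H1.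
  - rewrite star_opp. now apply SymP_opp.
Qed.
Lemma Nice_mul f g : Nice f -> Nice g -> Nice (f * g).
Proof.
  intros [H1 H2] [K1 K2]; split.
  - now rewrite (pm_mul D1 isder_D1), pN_mul, H1, K1.
  - rewrite star_mul. now apply SymP_mul.
Qed.
Lemma Nice_th f : Nice f -> Nice (pm th f).
Proof.
  intros [H1 H2]; split.
  - rewrite pN_pm, <- H1 by exact isder_th. apply ps_ext; intros k; apply D1_th.
  - rewrite star_pm by exact isder_th. now apply SymP_th.
Qed.
Lemma Nice_pc a : D1 a = f0 -> Sym a a -> Nice (pc a).
Proof.
  intros H K; split.
  - rewrite (pm_pc D1 isder_D1), pN_pc, H. reflexivity.
  - rewrite star_pc. now apply SymP_pc.
Qed.
Definition zt : PS := eps * pc (fu * fy)%fa.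
Lemma Nice_zt : Nice zt.
Proof.
  unfold zt; split.
  - rewrite (pm_mul D1 isder_D1), pN_mul, (pm_eps D1 isder_D1), (pm_pc D1 isder_D1), pN_eps, pN_pc.
    replace (D1 (fu * fy)%fa) with (fu * fy)%fa by ff. ring.
  - rewrite star_mul, star_eps, star_pc.
    eapply SymP_eq; [apply SymP_mul; [apply SymP_eps|apply SymP_pc; apply Sym_mul; [apply Sym_u|apply Sym_y]]|].
    rewrite pc_mul, pc_opp, pc_mul. ring.
Qed.
Lemma Nice_P1 : Nice P1.
Proof. apply Nice_pc; [apply D1_cst|apply Sym_cst]. Qed.

Definition nice (k : nat) (a : FA) : Prop := D1 a = (nsc k * a)%fa /\ Sym a (sg k * a)%fa.
Lemma Nice_iff f : Nice f <-> forall k, nice k (f k).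
Proof.
  split.
  - intros [H1 H2] k; split; [exact (f_equal (fun g => g k) H1)|apply H2].
  - intros H; split; [apply ps_ext; intros k; apply H|intros k; apply H].
Qed.

(** * The formal solution and the Riccati solutions *)

Notation TH := (pm th).
Notation DC := (pm dc).
Notation hh := (pc hA).
Notation tt' := (pc tA).
Notation cc := (pc cA).
Notation U := (pc fu).
Notation Ui := (pc fui).
Notation Y := (pc fy).
Notation Yi := (pc fyi).
Notation kk := (pc k0A).
Notation nn := (pc n0A).
Notation half := (pc (fcst (/ 2))).

Lemma R_Y : Y * Yi = P1. Proof. rewrite <- pc_mul, rel_yyi. reflexivity. Qed.
Lemma R_U : U * Ui = P1. Proof. rewrite <- pc_mul, rel_uui. reflexivity. Qed.
Lemma R_YY : Y * Y = hh + hh + P1.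
Proof. rewrite <- pc_mul, rel_yy, !pc_add. reflexivity. Qed.
Lemma R_t : tt' + tt' = hh * (Ui * Ui * Ui * Yi * Yi).
Proof. rewrite <- pc_add, rel_t, !pc_mul. reflexivity. Qed.
Lemma R_c : cc = (hh + hh + hh + P1) * (Ui * Yi * Yi).
Proof. rewrite rel_c, !pc_mul, !pc_add. reflexivity. Qed.
Lemma R_half : half + half = P1.
Proof. rewrite <- pc_add. unfold P1. f_equal. fa_ext. field. Qed.
Lemma TH_U : TH U = U * hh. Proof. rewrite (pm_pc th isder_th), th_u, pc_mul. reflexivity. Qed.
Lemma TH_hh : TH hh = kk. Proof. rewrite (pm_pc th isder_th), th_h. reflexivity. Qed.
Lemma TH_c : TH cc = P0. Proof. rewrite (pm_pc th isder_th), th_c. reflexivity. Qed.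
Lemma TH_t : TH tt' = tt'. Proof. rewrite (pm_pc th isder_th), th_t. reflexivity. Qed.
Lemma TH_zt : TH zt = zt * nn.
Proof. unfold zt. rewrite (pm_epsmul th isder_th), (pm_pc th isder_th), th_uy, pc_mul. ring. Qed.
Lemma zt_uy : zt = eps * U * Y. Proof. unfold zt. rewrite pc_mul. ring. Qed.
Definition TH_mul := pm_mul th isder_th.
Definition TH_add := pm_add th isder_th.
Definition TH_sub := pm_sub th isder_th.
Definition TH_opp := pm_opp th isder_th.
Lemma TH_eps : TH eps = P0. Proof. exact (pm_eps th isder_th). Qed.
Lemma TH_P1 : TH P1 = P0. Proof. unfold P1; rewrite (pm_pc th isder_th), (der_cst th isder_th). reflexivity. Qed.

Lemma fix_eq (b : FA) (T : PS -> PS) :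
  (forall n f g, agree n f g -> agree n (T f) (T g)) ->
  gfix b T = pc b + eps * T (gfix b T).
Proof. exact (gfix_eq _ _ _ _ _ _ FA_ring b T). Qed.
Lemma fix_uniq (b : FA) (T : PS -> PS) :
  (forall n f g, agree n f g -> agree n (T f) (T g)) ->
  forall w, w = pc b + eps * T w -> w = gfix b T.
Proof. exact (gfix_uniq _ _ _ _ _ _ FA_ring b T). Qed.
Lemma fix_nice (b : FA) (T : PS -> PS) :
  (forall n f g, agree n f g -> agree n (T f) (T g)) ->
  nice 0 b -> (forall w, Nice w -> Nice (eps * T w)) -> Nice (gfix b T).
Proof.
  intros HT Hb H. apply Nice_iff.
  apply (gfix_ind _ _ _ _ _ _ FA_ring b T HT nice).
  - intros n. assert (K : nice n (((P1 - P1) : PS) n)) by (apply Nice_iff, Nice_sub; exact Nice_P1).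
    replace f0 with ((P1 - P1) n); [exact K|]. rewrite psub_k. ring.
  - exact Hb.
  - intros w Hw. apply Nice_iff, H, Nice_iff, Hw.
Qed.

Lemma agree_padd n (f f' g g' : PS) : agree n f f' -> agree n g g' -> agree n (f + g) (f' + g').
Proof. apply agree_add. Qed.
Lemma agree_psub n (f f' g g' : PS) : agree n f f' -> agree n g g' -> agree n (f - g) (f' - g').
Proof. apply agree_sub. Qed.
Lemma agree_popp n (f f' : PS) : agree n f f' -> agree n (- f) (- f').
Proof. apply agree_opp. Qed.
Lemma agree_pmul n (f f' g g' : PS) : agree n f f' -> agree n g g' -> agree n (f * g) (f' * g').
Proof. apply agree_mul. Qed.

Ltac agree_tac := lazymatch goal with
  | |- agree _ ?f ?f => apply agree_refl
  | |- agree _ (_ + _) _ => apply agree_padd; agree_tac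
  | |- agree _ (_ - _) _ => apply agree_psub; agree_tac
  | |- agree _ (- _) _ => apply agree_popp; agree_tac
  | |- agree _ (_ * _) _ => apply agree_pmul; agree_tac
  | |- agree _ (pm _ _) _ => apply agree_pm; agree_tac
  | |- _ => assumption end.
Ltac nice_tac := lazymatch goal with
  | |- Nice P1 => apply Nice_P1
  | |- Nice zt => apply Nice_zt
  | |- Nice (_ + _) => apply Nice_add; nice_tac
  | |- Nice (_ - _) => apply Nice_sub; nice_tac
  | |- Nice (- _) => apply Nice_opp; nice_tac
  | |- Nice (_ * _) => apply Nice_mul; nice_tac
  | |- Nice (pm th _) => apply Nice_th; nice_tac
  | |- _ => assumption end.

Lemma Nice_hh : Nice hh. Proof. apply Nice_pc; [ff|apply Sym_h]. Qed.
Lemma Nice_kk : Nice kk. Proof. apply Nice_pc; [ff|unfold k0A; sym_poly]. Qed.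
Lemma Nice_nn : Nice nn. Proof. apply Nice_pc; [ff|unfold n0A; sym_poly]. Qed.
Lemma Nice_half : Nice half. Proof. apply Nice_pc; [apply D1_cst|apply Sym_cst]. Qed.
Lemma nice_0 : nice 0 f0.
Proof. exact (proj1 (Nice_iff P0) (Nice_pc _ (D1_cst 0) (Sym_cst 0)) 0%nat). Qed.
Lemma nice_1 : nice 0 f1.
Proof. exact (proj1 (Nice_iff P1) Nice_P1 0%nat). Qed.

(* lambda = t * kap with kap = u * Lam and Lam = 1 + zt * ww; below, alp = t / lambda. *)
Definition Lf (w : PS) : PS := P1 + zt * w.
(** The Painlevé equation solved for its linear part. With o = Lam - 1 = zt w it reads o = zt^2 B +
    hA (3 o^2 + o^3), where B = k0A Lam^2 + Lam theta^2 Lam - (theta Lam)^2; division by zt gives w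
    = eps Tw w. *)
Definition Tw (w : PS) : PS :=
  pc (fu * fy)%fa * (kk * Lf w * Lf w + Lf w * TH (TH (Lf w)) - TH (Lf w) * TH (Lf w)
    + hh * ((P1 + P1 + P1) * (w * w) + zt * (w * w * w))).
Definition ww : PS := gfix f0 Tw.
Lemma Tw_agree n f g : agree n f g -> agree n (Tw f) (Tw g).
Proof. intros H; unfold Tw, Lf; agree_tac. Qed.
Lemma ww_eq : ww = eps * Tw ww.
Proof. unfold ww. rewrite (fix_eq f0 Tw Tw_agree) at 1. change (pc f0) with P0. ring. Qed.
Lemma ww_nice : Nice ww.
Proof.
  apply fix_nice; [exact Tw_agree|exact nice_0|].
  intros w Hw. unfold Tw.
  match goal with |- Nice (eps * (?a * ?b)) => replace (eps * (a * b)) with (zt * b) by (unfold zt; ring) end.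
  unfold Lf. pose proof Nice_hh. pose proof Nice_kk. nice_tac.
Qed.

Definition Lam : PS := Lf ww.
Lemma Lam_nice : Nice Lam. Proof. unfold Lam, Lf. pose proof ww_nice. nice_tac. Qed.
Lemma zt_star : star zt = - zt. Proof. unfold zt. rewrite star_mul, star_eps, star_pc. ring. Qed.
Lemma star_P1 : star P1 = P1. Proof. apply star_pc. Qed.
(** Under eps -> -eps the fixed-point equation of [ww] becomes that of [- ww], so uniqueness of the
    fixed point applies. Hence lambda contains only even powers of eps. *)
Lemma ww_star : star ww = - ww.
Proof.
  assert (H : - star ww = ww).
  { apply (fix_uniq f0 Tw Tw_agree).
    assert (EL : star (Lf ww) = Lf (- star ww)).
    { unfold Lf. rewrite star_add, star_P1, star_mul, zt_star. ring. }
    change (pc f0) with P0.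
    rewrite ww_eq at 1. unfold Tw.
    repeat rewrite ?star_mul, ?star_add, ?star_sub, ?star_eps, ?star_pc, ?star_P1, ?zt_star,
      ?(star_pm th _ isder_th), ?EL. ring. }
  rewrite <- H at 2. ring.
Qed.
Lemma Lam_star : star Lam = Lam.
Proof. unfold Lam, Lf. rewrite star_add, star_P1, star_mul, zt_star, ww_star. ring. Qed.

(** The inverse of [Lam] is built as a fixed point rather than by [g_inverse], so that [fix_nice]
    yields its homogeneity and parity. *)
Definition Ti (w : PS) : PS := - (pc (fu * fy)%fa * ww * w).
Definition ii : PS := gfix f1 Ti.
Lemma Ti_agree n f g : agree n f g -> agree n (Ti f) (Ti g).
Proof. intros H; unfold Ti; agree_tac. Qed.
Lemma ii_eq : ii = P1 - zt * ww * ii.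
Proof.
  unfold ii. rewrite (fix_eq f1 Ti Ti_agree) at 1. change (pc f1) with P1. unfold Ti at 1, zt. ring.
Qed.
Lemma ii_nice : Nice ii.
Proof.
  apply fix_nice; [exact Ti_agree|exact nice_1|].
  intros w Hw. unfold Ti. replace (eps * - (pc (fu * fy)%fa * ww * w)) with (- (zt * ww * w)) by (unfold zt; ring).
  pose proof ww_nice. nice_tac.
Qed.
Lemma Lam_ii : Lam * ii = P1.
Proof. unfold Lam, Lf. lin (dif ii_eq). Qed.

Definition kap : PS := U * Lam.
Definition alp : PS := Ui * ii.
Lemma kap_alp : kap * alp = P1.
Proof. unfold kap, alp. lin (Lam * ii * dif R_U + dif Lam_ii). Qed.
Lemma kap_star : star kap = kap.
Proof. unfold kap. now rewrite star_mul, star_pc, Lam_star. Qed.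
Lemma inv_uniq (a b b' : PS) : a * b = P1 -> a * b' = P1 -> b = b'.
Proof. intros H K. lin (b * - dif K + b' * dif H). Qed.
Lemma alp_star : star alp = alp.
Proof.
  apply (inv_uniq kap); [|exact kap_alp]. rewrite <- kap_star at 1. rewrite <- star_mul, kap_alp. apply star_P1.
Qed.

(** This is the Painlevé equation times eps^2 lambda. Its derivative terms are (lambda / t)^2
    theta^2 log lambda, and theta^2 log t = 0 allows kap = lambda / t to replace lambda under the
    logarithm. *)
Lemma kap_PIII : eps * eps * (kap * TH (TH kap) - TH kap * TH kap)
  = - ((tt' + tt') * (kap * kap * kap)) + cc * kap - P1.
Proof.
  set (B := kk * Lam * Lam + Lam * TH (TH Lam) - TH Lam * TH Lam).
  assert (E1 : kap * TH (TH kap) - TH kap * TH kap = U * U * B).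
  { unfold kap, B. repeat rewrite ?TH_mul, ?TH_add, ?TH_U, ?TH_hh. ring. }
  rewrite E1, R_t, R_c. unfold kap.
  assert (E2 : ww = zt * (B + hh * ((P1 + P1 + P1) * (ww * ww) + zt * (ww * ww * ww)))).
  { rewrite ww_eq at 1. unfold Tw. fold Lam. fold B. unfold zt. ring. }
  assert (E3 : Lam - P1 = zt * ww) by (unfold Lam, Lf; ring).
  set (o := Lam - P1).
  assert (E4 : o = zt * zt * B + hh * ((P1 + P1 + P1) * (o * o) + o * o * o)).
  { unfold o; rewrite E3. rewrite E2 at 1. ring. }
  assert (E5 : Y * Y * (eps * eps * (U * U * B)) = o - hh * ((P1 + P1 + P1) * (o * o) + o * o * o)).
  { rewrite E4 at 1. rewrite zt_uy. ring. }
  assert (E6 : Lam = P1 + o) by (unfold o; ring).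
  clearbody o. rewrite E6. clear E1 E2 E3 E4 E6. clearbody B.
  assert (HY := R_Y). assert (HU := R_U). assert (HYY := R_YY).
  generalize dependent eps. intros e E5.
  set (X := U * Ui) in *. 
  apply ps_sub0.
  (* The first term is the fixed-point equation divided by y^2; the others vanish by u * ui = 1, y *
     yi = 1 and y^2 = 1 + 2 hA. *)
  transitivity (Yi * Yi * dif E5 + (P1 - Y * Yi * (Y * Yi)) * (e * e * (U * U * B))
    + Yi * Yi * (o - hh * ((P1 + P1 + P1) * (o * o) + o * o * o)
       + hh * (X * X * X) * ((P1 + o) * (P1 + o) * (P1 + o)) - (hh + hh + hh + P1) * X * (P1 + o) + Y * Y)
    + (P1 - Y * Yi * (Y * Yi))).
  - unfold dif, X. ring.
  - rewrite dif0, HY. rewrite HU, HYY. ring.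
Qed.

Definition jj : PS := - (ww * ii).
(** Chosen such that [P1 + zt * Q1] is [QQ] divided by [EE * EE], the square of the leading term of
    the Riccati solutions; here [jj] is defined by ii = 1 + zt jj. *)
Definition Q1 : PS := ((P1 + P1 + P1 + P1) * (Y * Y) - (hh + hh + hh + P1)) * jj
   + (P1 + P1) * (Y * Y) * zt * (jj * jj) - hh * ww.
Definition Bq : PS := half * (Q1 - nn).
Definition Tq (w : PS) : PS := gtl Bq + pc (fu * fy)%fa * half * (TH w - w * w).
Definition qq : PS := gfix (Bq O) Tq.
Lemma Tq_agree n f g : agree n f g -> agree n (Tq f) (Tq g).
Proof. intros H; unfold Tq; agree_tac. Qed.
Lemma qq_eq : qq = Bq + zt * half * (TH qq - qq * qq).
Proof.
  unfold qq. rewrite (fix_eq _ Tq Tq_agree) at 1. unfold Tq at 1. 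
  set (q := gfix _ _). rewrite (ps_split Bq) at 3. unfold zt. ring.
Qed.
Lemma Bq_nice : Nice Bq.
Proof.
  unfold Bq, Q1, jj. rewrite R_YY.
  pose proof ww_nice. pose proof ii_nice. pose proof Nice_half. pose proof Nice_nn. pose proof Nice_hh.
  nice_tac.
Qed.
Lemma qq_nice : Nice qq.
Proof.
  apply fix_nice; [exact Tq_agree|apply Nice_iff, Bq_nice|].
  intros w Hw. unfold Tq.
  assert (K : Nice (Bq - pc (Bq O))).
  { apply Nice_sub; [exact Bq_nice|]. apply Nice_iff. intros [|k]; [exact (proj1 (Nice_iff Bq) Bq_nice O)|].
    assert (K : nice (S k) ((P1 - P1) (S k))) by (apply Nice_iff; nice_tac).
    rewrite psub_k in K. unfold pc, gcst. replace f0 with (P1 (S k) - P1 (S k))%fa by ring. exact K. }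
  replace (eps * (gtl Bq + pc (fu * fy)%fa * half * (TH w - w * w)))
    with (Bq - pc (Bq O) + zt * (half * (TH w - w * w))).
  - apply Nice_add; [exact K|]. pose proof Nice_half. nice_tac.
  - rewrite (ps_split Bq) at 1. unfold zt. ring.
Qed.

(* [rm] and [rp] are eps * t * (R - lambda' / lambda) for R = R_- and R = R_+. *)
Definition EE : PS := Ui * Yi.
Definition rm : PS := - (EE * (P1 + zt * qq)).
Definition rp : PS := - star rm.
Lemma zt_EE : zt * EE = eps.
Proof. rewrite zt_uy. unfold EE. lin (eps * (Y * Yi) * dif R_U + eps * dif R_Y). Qed.
Lemma TH_EE : TH EE = - (EE * nn).
Proof.
  unfold EE. rewrite <- pc_mul, (pm_pc th isder_th), th_E, pc_opp, !pc_mul. ring.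
Qed.

(** The substitution R = lambda' / lambda + r / (eps t) removes the linear term of the Riccati
    equation. What remains is this potential, which depends on eps only through lambda. *)
Definition QQ : PS := - ((tt' + tt') * kap) - cc * alp + (P1 + P1) * (alp * alp).
Lemma rm_riccati : eps * TH rm + rm * rm = QQ.
Proof.
  assert (E1 : eps * TH rm + rm * rm = EE * EE * (P1 + zt * (qq + qq + nn - zt * (TH qq - qq * qq)))).
  { unfold rm. repeat rewrite ?TH_opp, ?TH_mul, ?TH_add, ?TH_EE, ?TH_zt, ?TH_P1.
    lin (- (dif zt_EE) * (- (- (EE * nn) * (P1 + zt * qq) + EE * (P0 + (zt * nn * qq + zt * TH qq))))). }
  assert (E2 : qq + qq + nn - zt * (TH qq - qq * qq) = Q1).
  { assert (H := qq_eq). unfold Bq in H.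
    lin ((P1 + P1) * dif H + dif R_half * (Q1 - nn + zt * (TH qq - qq * qq))). }
  rewrite E1, E2. unfold QQ. rewrite R_t, R_c. unfold kap, alp.
  assert (E3 : ii = P1 + zt * jj) by (unfold jj; lin (dif ii_eq)).
  assert (E4 : Lam = P1 + zt * ww) by reflexivity.
  assert (E5 : P1 + zt * Q1 = - (hh * Lam) - (hh + hh + hh + P1) * ii + (P1 + P1) * (Y * Y) * (ii * ii)).
  { rewrite E3, E4. unfold Q1. 
    lin (- ((P1 + P1) * dif R_YY)). }
  rewrite E5. unfold EE. clear.
  lin (Ui * Ui * (hh * Lam * (Yi * Yi)) * dif R_U
     - Ui * Ui * (P1 + P1) * (ii * ii) * - (dif R_Y * (Y * Yi + P1))).
Qed.

(** * The Baecklund transformation c -> c + 1 / eta *)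

Notation SH := (Sh dc).
Notation t2 := (pc tA + pc tA).

Definition DC_mul := pm_mul dc isder_dc.
Definition DC_add := pm_add dc isder_dc.
Definition DC_sub := pm_sub dc isder_dc.
Definition DC_opp := pm_opp dc isder_dc.
Definition DC_epsmul := pm_epsmul dc isder_dc.
Definition SH_mul := Sh_mul dc isder_dc.
Definition SH_add := Sh_add dc isder_dc.
Definition SH_sub := Sh_sub dc isder_dc.
Definition SH_opp := Sh_opp dc isder_dc.
Definition SH_eps := Sh_eps dc isder_dc.
Lemma DC_P1 : DC P1 = P0. Proof. unfold P1; rewrite (pm_pc dc isder_dc), (der_cst dc isder_dc). reflexivity. Qed.

Lemma DC_eps : DC eps = P0. Proof. exact (pm_eps dc isder_dc). Qed.
Lemma DC_t : DC (pc tA) = P0. Proof. rewrite (pm_pc dc isder_dc), dc_t. reflexivity. Qed.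
Lemma TH_DC f : TH (DC f) = DC (TH f). Proof. apply ps_ext; intros k; apply th_dc. Qed.
Lemma TH_Op c f : TH (Op dc c f) = Op dc c (TH f).
Proof. apply Op_pm; [exact isder_th|exact th_dc]. Qed.
Lemma TH_SH f : TH (SH f) = SH (TH f). Proof. apply TH_Op. Qed.
Lemma DC_Op c f : DC (Op dc c f) = Op dc c (DC f).
Proof. apply Op_pm; [exact isder_dc|reflexivity]. Qed.
Lemma DC_SH f : DC (SH f) = SH (DC f). Proof. apply DC_Op. Qed.
Lemma SH_t : SH (pc tA) = pc tA. Proof. apply Sh_pc_0; [exact isder_dc|exact dc_t]. Qed.
Lemma SH_P1 : SH P1 = P1. Proof. apply Sh_pc_0; [exact isder_dc|apply (der_cst dc isder_dc)]. Qed.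
Lemma Op_P0 c : Op dc c P0 = P0.
Proof. replace P0 with (P0 - P0) at 1 by ring. rewrite (Op_sub dc isder_dc). ring. Qed.
Lemma SH_c : SH cc = cc + eps.
Proof.
  unfold Sh. rewrite Op_rec, (pm_pc dc isder_dc), dc_c. change (pc f1) with P1.
  rewrite Op_rec, DC_P1, Op_P0.
  replace (cexp 0) with (RtoC 1) by (unfold cexp; simpl; field).
  replace (gtl cexp 0) with (RtoC 1) by (unfold gtl, cexp; simpl; field).
  change (pc (fcst 1)) with P1. ring.
Qed.
Lemma SH_0 f : SH f O = f O. Proof. apply Sh_0. Qed.

Definition kap' : PS := SH kap.
Definition alp' : PS := SH alp.
Definition ppi : PS := eps * TH kap * alp.
Definition ppi' : PS := SH ppi.
Definition HH : PS := t2 * (kap * kap').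
Lemma kap_alp' : kap' * alp' = P1.
Proof. unfold kap', alp'. now rewrite <- SH_mul, kap_alp, SH_P1. Qed.
Lemma TH_alp : TH alp = - (TH kap * (alp * alp)).
Proof.
  assert (H : TH kap * alp + kap * TH alp = P0).
  { rewrite <- TH_mul, kap_alp. apply TH_P1. }
  lin (alp * dif H - dif kap_alp * TH alp).
Qed.
Lemma epsTH_alp : eps * TH alp = - (ppi * alp).
Proof. rewrite TH_alp. unfold ppi. ring. Qed.
Lemma epsTH_ppi : eps * TH ppi = - (t2 * kap) + cc * alp - alp * alp.
Proof.
  unfold ppi. rewrite !TH_mul, TH_eps, TH_alp.
  lin (alp * alp * dif kap_PIII - eps * eps * alp * TH (TH kap) * dif kap_alp
     - t2 * kap * dif kap_alp * (kap * alp + P1) + cc * alp * dif kap_alp).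
Qed.
Lemma epsTH_alp' : eps * TH alp' = - (ppi' * alp').
Proof.
  unfold alp', ppi'. rewrite TH_SH, <- SH_mul, <- SH_opp, <- epsTH_alp, SH_mul, SH_eps. reflexivity.
Qed.
Lemma epsTH_ppi' : eps * TH ppi' = - (t2 * kap') + (cc + eps) * alp' - alp' * alp'.
Proof.
  unfold ppi'. rewrite TH_SH, <- SH_eps at 1. rewrite <- SH_mul, epsTH_ppi.
  now rewrite SH_sub, SH_add, SH_opp, !SH_mul, SH_add, SH_c, SH_t.
Qed.
Lemma HH_alp : HH * alp = t2 * kap'.
Proof. unfold HH. lin (t2 * kap' * dif kap_alp). Qed.
Lemma HH_alp' : HH * alp' = t2 * kap.
Proof. unfold HH. lin (t2 * kap * dif kap_alp'). Qed.
Lemma ppi_kap' : ppi' = eps * TH kap' * alp'.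
Proof. unfold ppi', ppi, kap', alp'. now rewrite !SH_mul, SH_eps, TH_SH. Qed.
Lemma epsTH_HH : eps * TH HH = HH * (eps + ppi + ppi').
Proof.
  rewrite ppi_kap'. unfold ppi, HH. rewrite !TH_mul, TH_add, TH_t.
  lin (- (t2 * eps * kap' * TH kap * dif kap_alp) - t2 * eps * kap * TH kap' * dif kap_alp').
Qed.

(* The Baecklund transformation is GG = GG' = HH. Writing it as a homogeneous linear system for the two
   differences, invertible at leading order, avoids dividing by t. *)
Definition GG : PS := cc - alp - ppi.
Definition GG' : PS := ppi' + eps + cc - alp'.
Definition Z1 : PS := GG - HH.
Definition Z2 : PS := GG' - HH.
Lemma Z1_eq : (alp - HH) * Z1 + HH * Z2 = - (eps * TH Z1).
Proof.
  unfold Z1, Z2, GG, GG'. repeat rewrite ?TH_sub, ?TH_add, ?TH_c, ?TH_eps.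
  lin (- dif epsTH_alp - dif epsTH_ppi - dif epsTH_HH - dif HH_alp').
Qed.
Lemma Z2_eq : (alp' - HH) * Z2 + HH * Z1 = eps * TH Z2.
Proof.
  unfold Z1, Z2, GG, GG'. repeat rewrite ?TH_sub, ?TH_add, ?TH_c, ?TH_eps.
  lin (- dif epsTH_ppi' + dif epsTH_alp' + dif epsTH_HH - dif HH_alp).
Qed.

Lemma epsTH_low f n : (forall j, (j < n)%nat -> f j = f0) -> (eps * TH f) n = f0.
Proof.
  intros H. destruct n as [|n]; [apply eps_mul_0|]. rewrite eps_mul_S. unfold pm. rewrite H by lia.
  apply (der_cst th isder_th).
Qed.
Lemma pmul_low a f n : (forall j, (j < n)%nat -> f j = f0) -> (a * f) n = (a O * f n)%fa.
Proof. apply (gmul_low _ _ _ _ _ _ FA_ring). Qed.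
Lemma lead_zero (a f : PS) (b : FA) : (b * a O)%fa = f1 ->
  (forall n, (forall j, (j < n)%nat -> f j = f0) -> (a * f) n = f0) -> f = P0.
Proof. apply (g_lead_zero _ _ _ _ _ _ FA_ring). Qed.

Lemma ww_0 : ww O = f0. Proof. reflexivity. Qed.
Lemma kap_0 : kap O = fu.
Proof.
  unfold kap, Lam, Lf. rewrite pc_mul_k, padd_k, pmul_0, ww_0. change (P1 O) with f1. ring.
Qed.
Lemma alp_0 : alp O = fui.
Proof. unfold alp. rewrite pc_mul_k. change (ii O) with f1. ring. Qed.
Lemma HH_0 : HH O = (hA * (fui * fyi * fyi))%fa.
Proof.
  unfold HH, kap'. rewrite !pmul_0, SH_0, kap_0, padd_k. change (pc tA O) with tA. rewrite rel_t.
  fa_ext. cf.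
Qed.
Lemma rm_0 : rm O = (- (fui * fyi))%fa.
Proof.
  unfold rm, EE. rewrite popp_k, pmul_0, padd_k, !pmul_0. change (zt O) with ((eps * pc (fu * fy)%fa) O).
  rewrite eps_mul_0. change (P1 O) with f1. change (Ui O) with fui. change (Yi O) with fyi. ring.
Qed.
Lemma rp_0 : rp O = (fui * fyi)%fa.
Proof.
  unfold rp. rewrite popp_k. unfold star. rewrite rm_0. unfold sg. fa_ext. simpl. ring.
Qed.

Lemma Z_zero : Z1 = P0 /\ Z2 = P0.
Proof.
  assert (K : forall n, Z1 n = f0 /\ Z2 n = f0).
  { intros n. induction n as [n IH] using lt_wf_ind.
    assert (H1 : forall j, (j < n)%nat -> Z1 j = f0) by (intros j Hj; exact (proj1 (IH j Hj))).
    assert (H2 : forall j, (j < n)%nat -> Z2 j = f0) by (intros j Hj; exact (proj2 (IH j Hj))).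
    assert (E1 := f_equal (fun h : PS => h n) Z1_eq). assert (E2 := f_equal (fun h : PS => h n) Z2_eq).
    cbv beta in E1, E2. rewrite popp_k, epsTH_low in E1 by exact H1. rewrite epsTH_low in E2 by exact H2.
    rewrite padd_k, !pmul_low, psub_k in E1, E2 by assumption.
    unfold alp' in E2. rewrite SH_0 in E2. rewrite alp_0, HH_0 in E1, E2.
    set (z1 := Z1 n) in *. set (z2 := Z2 n) in *. clearbody z1 z2. clear -E1 E2.
    set (h := (hA * (fui * fyi * fyi))%fa) in *.
    (* Determinant of the system for the lowest coefficients, from which the derivative terms have
       dropped out: 1 / (u y)^2 is a unit. *)
    assert (D : ((fui - h) * (fui - h) - h * h = fui * fui * fyi * fyi)%fa) by (unfold h; ff).
    assert (I : ((fu * fu * fy * fy) * (fui * fui * fyi * fyi) = f1)%fa) by ff.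
    assert (F1 : ((fui * fui * fyi * fyi) * z1 = f0)%fa).
    { rewrite <- D. transitivity ((fui - h) * ((fui - h) * z1 + h * z2) - h * ((fui - h) * z2 + h * z1))%fa; [ring|].
      rewrite E1, E2. fa_ring. }
    assert (F2 : ((fui * fui * fyi * fyi) * z2 = f0)%fa).
    { rewrite <- D. transitivity ((fui - h) * ((fui - h) * z2 + h * z1) - h * ((fui - h) * z1 + h * z2))%fa; [ring|].
      rewrite E1, E2. fa_ring. }
    split.
    - transitivity ((fu * fu * fy * fy) * (fui * fui * fyi * fyi) * z1)%fa; [rewrite I; ring|].
      transitivity ((fu * fu * fy * fy) * ((fui * fui * fyi * fyi) * z1))%fa; [ring|rewrite F1; ring].
    - transitivity ((fu * fu * fy * fy) * (fui * fui * fyi * fyi) * z2)%fa; [rewrite I; ring|].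
      transitivity ((fu * fu * fy * fy) * ((fui * fui * fyi * fyi) * z2))%fa; [ring|rewrite F2; ring]. }
  split; apply ps_ext; intros n; (transitivity (fcst 0); [|destruct n; reflexivity]).
  - exact (proj1 (K n)).
  - exact (proj2 (K n)).
Qed.

Lemma HH_ppi : ppi = cc - alp - HH.
Proof. assert (H := proj1 Z_zero). unfold Z1, GG in H. lin (- dif H). Qed.
Lemma HH_ppi' : ppi' = HH - eps - cc + alp'.
Proof. assert (H := proj2 Z_zero). unfold Z2, GG' in H. lin (dif H). Qed.
Lemma epsTH_HH' : eps * TH HH = HH * (alp' - alp).
Proof. rewrite epsTH_HH. lin (HH * dif HH_ppi + HH * dif HH_ppi'). Qed.

Lemma QQ_SH : SH QQ = - (t2 * kap') - (cc + eps) * alp' + (P1 + P1) * (alp' * alp').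
Proof.
  unfold QQ. now rewrite SH_add, SH_sub, SH_opp, !SH_mul, !SH_add, SH_c, SH_t, SH_P1.
Qed.
Lemma QQ_star : star QQ = QQ.
Proof.
  unfold QQ. rewrite star_add, star_sub, star_opp, !star_mul, !star_add, !star_pc, star_P1, kap_star, alp_star.
  reflexivity.
Qed.
(** As [QQ] is even in eps, minus the image of a solution under eps -> -eps is again a solution. *)
Lemma rp_riccati : eps * TH rp + rp * rp = QQ.
Proof.
  rewrite <- QQ_star, <- rm_riccati. unfold rp.
  rewrite star_add, !star_mul, star_eps, (star_pm th _ isder_th), TH_opp. ring.
Qed.

(** * Linearization of the Baecklund transformation *)

Section Riccati.
Context (r : PS) (Hr : eps * TH r + r * r = QQ) (e : FA) (He : (e * r O)%fa = f1).
(** Perturb lambda to lambda (1 + phi) with eps theta phi = r phi. Linearizing [GG = HH] and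
    [GG' = HH] gives (alp - r) phi = HH (phi + S phi) and (S r + alp') S phi = HH (phi + S phi),
    that is, aa phi = HH S phi and bb S phi = HH phi. So aa / HH is the multiplier S phi / phi. *)
Definition aa (r : PS) : PS := alp - r - HH.
Definition bb (r : PS) : PS := SH r + alp' - HH.
Lemma Hr' : eps * TH (SH r) + SH r * SH r = SH QQ.
Proof. rewrite <- Hr, SH_add, !SH_mul, SH_eps, TH_SH. reflexivity. Qed.
Lemma epsTH_aa : eps * TH (aa r) = aa r * aa r + HH * HH - (P1 + P1) * (aa r * (alp - HH)).
Proof.
  unfold aa. rewrite !TH_sub.
  assert (HQ : QQ = - (t2 * kap) - cc * alp + (P1 + P1) * (alp * alp)) by reflexivity.
  lin (- dif Hr + dif epsTH_alp - dif epsTH_HH' - alp * dif HH_ppi - dif HH_alp' - dif HQ).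
Qed.
Lemma epsTH_bb : eps * TH (bb r) = - (bb r * bb r) - HH * HH + (P1 + P1) * (bb r * (alp' - HH)).
Proof.
  unfold bb. rewrite !TH_sub, TH_add.
  lin (dif Hr' + dif QQ_SH + dif epsTH_alp' - dif epsTH_HH' - alp' * dif HH_ppi' + dif HH_alp).
Qed.
(** The defect z of the identity satisfies a homogeneous equation A z = eps theta z. The leading
    coefficient of A is -2 r_0, a unit, so z vanishes order by order. *)
Lemma aa_bb : aa r * bb r = HH * HH.
Proof.
  set (z := aa r * bb r - HH * HH).
  assert (E : (aa r - bb r + (P1 + P1) * (alp' - alp)) * z = eps * TH z).
  { unfold z. rewrite TH_sub, !TH_mul.
    lin (- (bb r * dif epsTH_aa) - aa r * dif epsTH_bb + (P1 + P1) * HH * dif epsTH_HH'). }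
  assert (Hz : z = P0).
  { apply (lead_zero (aa r - bb r + (P1 + P1) * (alp' - alp)) z (fcst (- / 2) * e)%fa).
    - unfold aa, bb, alp'. rewrite !padd_k, !psub_k, pmul_0, psub_k, padd_k, !SH_0.
      change (P1 O) with f1. rewrite <- He. fa_ext. field.
    - intros n Hn. rewrite E. now apply epsTH_low. }
  unfold z in Hz. lin (dif Hz).
Qed.
Lemma dlog_aa : eps * TH (aa r) = aa r * (SH r - r + alp' - alp).
Proof. rewrite epsTH_aa. assert (E := aa_bb). unfold aa, bb in *. lin (- dif E). Qed.
Lemma dlog_bb : eps * TH (bb r) = bb r * (- SH r + r + alp' - alp).
Proof. rewrite epsTH_bb. assert (E := aa_bb). unfold aa, bb in *. lin (dif E). Qed.
End Riccati.

(** * The second c-derivative of the Voros potential *)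

Lemma bern_list_length n : length (bern_list n) = S n.
Proof. induction n as [|n IH]; simpl; [reflexivity|]. rewrite length_app, IH. simpl. lia. Qed.

Lemma nth_bern_list k n : (k <= n)%nat -> nth k (bern_list n) 0%R = bernoulli k.
Proof.
  induction n as [|n IH]; intros H.
  - now replace k with 0%nat by lia.
  - destruct (Nat.eq_dec k (S n)) as [->|Hk]; [reflexivity|].
    rewrite <- IH by lia. simpl. apply app_nth1. rewrite bern_list_length. lia.
Qed.

Lemma rsum_ext f g n : (forall i, (i <= n)%nat -> f i = g i) -> rsum f n = rsum g n.
Proof.
  induction n as [|n IH]; intros H; simpl; [apply H; lia|].
  rewrite IH by (intros i Hi; apply H; lia). now rewrite H by lia.
Qed.

Lemma bernoulli_S m : bernoulli (S m) =
  (- / INR (S (S m)) * rsum (fun k => Binomial.C (S (S m)) k * bernoulli k) m)%R.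
Proof.
  unfold bernoulli at 1. cbn [bern_list].
  rewrite app_nth2; rewrite bern_list_length; [|lia]. rewrite Nat.sub_diag. cbn [nth].
  f_equal. apply rsum_ext. intros i Hi. now rewrite nth_bern_list.
Qed.

(** With z for eps d/dc, this sequence and the next two are the symbols z / (e^z - 1), e^z - 1 and
    z. *)
Definition cB (n : nat) : C := (bernoulli n / INR (fact n))%R.
Definition cem (n : nat) : C := match n with O => 0%C | S _ => cexp n end.
Definition cz (n : nat) : C := match n with S O => 1%C | _ => 0%C end.

Lemma gsum_RtoC (f : nat -> R) n : gsum Cplus (fun i => RtoC (f i)) n = RtoC (rsum f n).
Proof. induction n as [|n IH]; simpl; [reflexivity|]. now rewrite IH, RtoC_plus. Qed.

Lemma rsum_scal z f n : rsum (fun i => z * f i)%R n = (z * rsum f n)%R.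
Proof. induction n as [|n IH]; simpl; [reflexivity|]. rewrite IH; ring. Qed.

Lemma bernoulli_rec k : rsum (fun i => Binomial.C (S k) i * bernoulli i)%R k =
  match k with O => 1%R | S _ => 0%R end.
Proof.
  destruct k as [|m]; simpl rsum.
  - unfold bernoulli, Binomial.C; simpl. field.
  - rewrite bernoulli_S. unfold Binomial.C at 2.
    replace (S (S m) - S m)%nat with 1%nat by lia. rewrite (fact_simpl (S m)), mult_INR.
    assert (H1 : INR (S (S m)) <> 0%R) by (apply not_0_INR; lia).
    pose proof (INR_fact_neq_0 (S m)) as H2. simpl (fact 1). simpl (INR 1). 
    field. split; assumption.
Qed.

Lemma cB_cem : cmulser cB cem = cz.
Proof.
  extensionality k. destruct k as [|k].
  - unfold cmulser, gmul; simpl. ring.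
  - unfold cmulser, gmul. cbn [gsum]. rewrite Nat.sub_diag. cbn [cem].
    rewrite (gsum_ext _ _ (fun i => RtoC (/ INR (fact (S k)) * (Binomial.C (S k) i * bernoulli i))%R)).
    + rewrite gsum_RtoC, rsum_scal, bernoulli_rec. destruct k as [|k].
      * unfold cz. simpl. rewrite Rinv_1, Rmult_1_l. ring.
      * unfold cz. rewrite Rmult_0_r. ring.
    + intros i Hi. replace (S k - i)%nat with (S (k - i)) by lia. cbn [cem].
      unfold cB, cexp, Binomial.C. replace (S k - i)%nat with (S (k - i)) by lia.
      rewrite <- RtoC_inv, <- RtoC_mult by apply INR_fact_neq_0.
      f_equal. field. repeat split; apply INR_fact_neq_0.
Qed.

Definition ro : PS := half * (rp - rm).
Definition am : PS := aa rm.
Definition ap : PS := aa rp.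
Definition bm : PS := bb rm.
Definition bp : PS := bb rp.

Lemma rm_unit : (- (fu * fy) * rm O)%fa = f1. Proof. rewrite rm_0. ff. Qed.
Lemma rp_unit : ((fu * fy) * rp O)%fa = f1. Proof. rewrite rp_0. ff. Qed.
Lemma am_bm : am * bm = HH * HH. Proof. exact (aa_bb rm rm_riccati _ rm_unit). Qed.
Lemma ap_bp : ap * bp = HH * HH. Proof. exact (aa_bb rp rp_riccati _ rp_unit). Qed.

(** The inverse of (1 + y)^2 / (2 u y^2), the common leading coefficient of a_- and b_+. For a_+ and
    b_- it is (1 - y)^2 / (2 u y^2), which is not invertible at y = 1. *)
Definition lead : FA := ((fcst 2) * fu * fy * fy * fz * fz)%fa.
Lemma am_lead : (am O * lead)%fa = f1.
Proof.
  unfold am, aa. rewrite !psub_k, alp_0, rm_0, HH_0. unfold lead. ff.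
Qed.
Lemma bp_lead : (bp O * lead)%fa = f1.
Proof.
  unfold bp, bb, alp'. rewrite psub_k, padd_k, !SH_0, alp_0, rp_0, HH_0. unfold lead. ff.
Qed.
Lemma ps_inverse (f : PS) (g0 : FA) : (f O * g0)%fa = f1 -> exists g, f * g = P1.
Proof.
  intros H. destruct (g_inverse _ _ _ _ _ _ FA_ring f g0 H) as [g [Hg _]]. exists g. exact Hg.
Qed.

(** Both sides are the mixed derivative of log f, expressed without a logarithm. *)
Lemma dlog_comm f g : f * g = P1 -> TH (DC f * g) = DC (TH f * g).
Proof.
  intros H.
  assert (HT : TH g = - (TH f * (g * g))).
  { assert (K : TH f * g + f * TH g = P0) by (rewrite <- TH_mul, H; apply TH_P1).
    lin (g * dif K - TH g * dif H). }
  assert (HD : DC g = - (DC f * (g * g))).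
  { assert (K : DC f * g + f * DC g = P0) by (rewrite <- DC_mul, H; apply DC_P1).
    lin (g * dif K - DC g * dif H). }
  rewrite TH_mul, DC_mul, HT, HD, TH_DC. ring.
Qed.

(** Coefficient k has degree k + z in u. The offset, absent from [Nice], is needed because the
    Riccati solutions start in degree -1 and d/dc raises the degree by one. *)
Definition Hom (z : C) (f : PS) : Prop := pm D1 f = pN f + pc (fcst z) * f.

Lemma pc_cst_add z w : pc (fcst (z + w)%C) = pc (fcst z) + pc (fcst w).
Proof. rewrite <- pc_add. f_equal. fa_ring. Qed.
Lemma Hom_Nice f : Nice f -> Hom 0 f.
Proof. intros [H _]. unfold Hom. rewrite H. change (pc f0) with P0. ring. Qed.
Lemma Hom_add z f g : Hom z f -> Hom z g -> Hom z (f + g).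
Proof. unfold Hom; intros H K. rewrite (pm_add D1 isder_D1), pN_add, H, K. ring. Qed.
Lemma Hom_opp z f : Hom z f -> Hom z (- f).
Proof. unfold Hom; intros H. rewrite (pm_opp D1 isder_D1), pN_opp, H. ring. Qed.
Lemma Hom_sub z f g : Hom z f -> Hom z g -> Hom z (f - g).
Proof. unfold Hom; intros H K. rewrite (pm_sub D1 isder_D1), pN_sub, H, K. ring. Qed.
Lemma Hom_mul z w f g : Hom z f -> Hom w g -> Hom (z + w)%C (f * g).
Proof.
  unfold Hom; intros H K. rewrite (pm_mul D1 isder_D1), pN_mul, H, K, pc_cst_add. ring.
Qed.
Lemma Hom_pc z a : D1 a = (fcst z * a)%fa -> Hom z (pc a).
Proof. intros H. unfold Hom. rewrite (pm_pc D1 isder_D1), pN_pc, H, pc_mul. ring. Qed.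
Lemma Hom_eq z w f : Hom z f -> z = w -> Hom w f. Proof. now intros H <-. Qed.
Lemma Hom_k z f k : Hom z f -> D1 (f k) = (fcst (INR k + z)%C * f k)%fa.
Proof.
  intros H. assert (E := f_equal (fun h : PS => h k) H). cbv beta in E.
  unfold pm in E. rewrite E, padd_k, pc_mul_k. unfold pN, nsc. fa_ring.
Qed.
Lemma Hom_of z f : (forall k, D1 (f k) = (fcst (INR k + z)%C * f k)%fa) -> Hom z f.
Proof.
  intros H. apply ps_ext; intros k. unfold pm. rewrite H, padd_k, pc_mul_k. unfold pN, nsc. fa_ring.
Qed.
Lemma Hom_star z f : Hom z f -> Hom z (star f).
Proof.
  intros H. apply Hom_of; intros k. unfold star, sg. rewrite (der_cmul _ _ _ isder_D1), (Hom_k z) by exact H. ring.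
Qed.
Lemma Hom_DC z f : Hom z f -> Hom (z + 1)%C (DC f).
Proof.
  intros H. apply Hom_of; intros k. unfold pm. rewrite D1_dc, (Hom_k z) by exact H.
  rewrite (der_cmul _ _ _ isder_dc). fa_ring.
Qed.
Lemma Hom_Op z c f : Hom z f -> Hom z (Op dc c f).
Proof.
  intros H. apply Hom_of; intros k. unfold Op.
  assert (K : forall k c z f, Hom z f -> D1 (opk dc k c f) = (fcst (INR k + z)%C * opk dc k c f)%fa).
  { clear. induction k as [|k IH]; intros c z f H.
    - simpl opk. rewrite (der_cmul _ _ _ isder_D1), (Hom_k z) by exact H. ring.
    - simpl opk. rewrite (der_add _ isder_D1), (der_cmul _ _ _ isder_D1), (Hom_k z) by exact H.
      rewrite (IH (gtl c) _ _ (Hom_DC z f H)). 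
      replace (fcst (INR k + (z + 1))%C) with (fcst (INR (S k) + z)%C).
      + ring.
      + f_equal. rewrite S_INR, RtoC_plus. ring. }
  apply K, H.
Qed.
Lemma Hom_inv z f g : Hom z f -> f * g = P1 -> Hom (- z)%C g.
Proof.
  unfold Hom; intros H K.
  assert (E1 : pm D1 f * g + f * pm D1 g = P0).
  { rewrite <- (pm_mul D1 isder_D1), K. unfold P1; rewrite (pm_pc D1 isder_D1), D1_cst. reflexivity. }
  assert (E2 : pN f * g + f * pN g = P0).
  { rewrite <- pN_mul, K. apply pN_pc. }
  replace (pc (fcst (- z)%C)) with (- pc (fcst z)) by (rewrite <- pc_opp; f_equal; fa_ring).
  rewrite H in E1.
  lin (g * dif E1 - g * dif E2 - dif K * (pm D1 g - pN g) - pc (fcst z) * g * dif K).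
Qed.

Lemma Hom_kap : Hom 1 kap.
Proof.
  eapply Hom_eq; [apply (Hom_mul 1 0)|ring]; [apply Hom_pc; ff|apply Hom_Nice, Lam_nice].
Qed.
Lemma Hom_alp : Hom (-1) alp.
Proof.
  eapply Hom_eq; [apply (Hom_mul (-1) 0)|ring]; [apply Hom_pc; ff|apply Hom_Nice, ii_nice].
Qed.
Lemma Hom_rm : Hom (-1) rm.
Proof.
  apply Hom_opp. eapply Hom_eq; [apply (Hom_mul (-1) 0)|ring].
  - unfold EE. rewrite <- pc_mul. apply Hom_pc; ff.
  - apply Hom_Nice, Nice_add; [apply Nice_P1|apply Nice_mul; [apply Nice_zt|apply qq_nice]].
Qed.
Lemma Hom_rp : Hom (-1) rp. Proof. apply Hom_opp, Hom_star, Hom_rm. Qed.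
Lemma Hom_HH : Hom (-1) HH.
Proof.
  eapply Hom_eq; [apply (Hom_mul (-3) 2)|ring].
  - apply Hom_add; apply Hom_pc; ff.
  - eapply Hom_eq; [apply (Hom_mul 1 1); [apply Hom_kap|apply Hom_Op, Hom_kap]|ring].
Qed.
Lemma Hom_cstmul z c f : Hom z f -> Hom z (pc (fcst c) * f).
Proof.
  intros H. eapply Hom_eq; [apply (Hom_mul 0 z); [|exact H]|ring]. apply Hom_pc. rewrite D1_cst. ring.
Qed.
Lemma Hom_ro : Hom (-1) ro.
Proof. apply Hom_cstmul, Hom_sub; [apply Hom_rp|apply Hom_rm]. Qed.
Lemma Hom_am : Hom (-1) am.
Proof. apply Hom_sub; [apply Hom_sub; [apply Hom_alp|apply Hom_rm]|apply Hom_HH]. Qed.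
Lemma Hom_bp : Hom (-1) bp.
Proof.
  apply Hom_sub; [apply Hom_add; [apply Hom_Op, Hom_rp|apply Hom_Op, Hom_alp]|apply Hom_HH].
Qed.

Definition ia : PS := proj1_sig (ClassicalEpsilon.constructive_indefinite_description _ (ps_inverse am lead am_lead)).
Definition ib : PS := proj1_sig (ClassicalEpsilon.constructive_indefinite_description _ (ps_inverse bp lead bp_lead)).
Lemma am_ia : am * ia = P1. Proof. exact (proj2_sig (ClassicalEpsilon.constructive_indefinite_description _ (ps_inverse am lead am_lead))). Qed.
Lemma bp_ib : bp * ib = P1. Proof. exact (proj2_sig (ClassicalEpsilon.constructive_indefinite_description _ (ps_inverse bp lead bp_lead))). Qed.

Definition wa : PS := DC am * ia.
Definition wb : PS := DC bp * ib.
Definition ll : PS := DC kap * alp.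
(** The c-derivative of (1/2) (log a_- + log b_+) - log H, up to sign that of the right side of the
    difference equation for the primitive. As t does not depend on c, [ll + SH ll] is the
    logarithmic c-derivative of [HH]. *)
Definition WW : PS := half * (wa + wb) - ll - SH ll.

Lemma Hom_WW : Hom 1 WW.
Proof.
  assert (H1 : Hom 1 ll).
  { eapply Hom_eq; [apply (Hom_mul 2 (-1)); [|exact Hom_alp]|ring].
    eapply Hom_eq; [apply Hom_DC, Hom_kap|ring]. }
  apply Hom_sub; [apply Hom_sub; [apply Hom_cstmul, Hom_add|exact H1]|apply Hom_Op, H1].
  - eapply Hom_eq; [apply (Hom_mul 0 1)|ring].
    + eapply Hom_eq; [apply Hom_DC, Hom_am|ring].
    + eapply Hom_eq; [apply (Hom_inv (-1) am ia Hom_am am_ia)|ring].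
  - eapply Hom_eq; [apply (Hom_mul 0 1)|ring].
    + eapply Hom_eq; [apply Hom_DC, Hom_bp|ring].
    + eapply Hom_eq; [apply (Hom_inv (-1) bp ib Hom_bp bp_ib)|ring].
Qed.

Lemma epsTH_WW : eps * TH WW = - DC (SH ro - ro).
Proof.
  unfold WW, wa, wb, ll. rewrite !TH_sub.
  assert (Eh : TH (half * (DC am * ia + DC bp * ib)) = half * TH (DC am * ia + DC bp * ib)).
  { apply (pm_cmul th isder_th). }
  rewrite Eh, TH_add, !TH_SH, (dlog_comm am ia am_ia), (dlog_comm bp ib bp_ib), (dlog_comm kap alp kap_alp).
  assert (E1 : eps * DC (TH am * ia) = DC (SH rm - rm + alp' - alp)).
  { rewrite <- DC_epsmul. f_equal.
    assert (E := dlog_aa rm rm_riccati _ rm_unit). fold am in E.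
    lin (ia * dif E + (SH rm - rm + alp' - alp) * dif am_ia). }
  assert (E2 : eps * DC (TH bp * ib) = DC (- SH rp + rp + alp' - alp)).
  { rewrite <- DC_epsmul. f_equal.
    assert (E := dlog_bb rp rp_riccati _ rp_unit). fold bp in E.
    lin (ib * dif E + (- SH rp + rp + alp' - alp) * dif bp_ib). }
  assert (E3 : eps * DC (TH kap * alp) = DC ppi).
  { rewrite <- DC_epsmul. f_equal. unfold ppi. ring. }
  assert (E4 : eps * SH (DC (TH kap * alp)) = DC ppi').
  { rewrite <- DC_SH, <- DC_epsmul. f_equal. unfold ppi', ppi. rewrite !SH_mul, SH_eps. ring. }
  (* The terms alp' - alp coming from a_- and b_+ cancel against the contribution of log H, up to a
     constant that d/dc kills. *)
  assert (E5 : ppi + ppi' = alp' - alp - eps) by (rewrite HH_ppi, HH_ppi'; ring).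
  assert (E6 : DC ppi + DC ppi' = DC alp' - DC alp).
  { rewrite <- DC_add, E5, !DC_sub, DC_eps. ring. }
  assert (E7 : SH ro = half * (SH rp - SH rm)).
  { unfold ro, Sh. rewrite (Op_cmul dc isder_dc), (Op_sub dc isder_dc). reflexivity. }
  rewrite E7. unfold ro.
  replace (half * (SH rp - SH rm) - half * (rp - rm)) with (half * (SH rp - SH rm - (rp - rm))) by ring.
  assert (E8 : forall x, DC (half * x) = half * DC x) by (intros x; apply (pm_cmul dc isder_dc)).
  rewrite E8. 
  repeat rewrite ?DC_sub, ?DC_add, ?DC_opp in E1.
  repeat rewrite ?DC_sub, ?DC_add, ?DC_opp in E2. repeat rewrite ?DC_sub, ?DC_add.
  lin (half * (dif E1 + dif E2) - dif E3 - dif E4 - dif E6 + dif R_half * (DC alp' - DC alp)).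
Qed.

(* cB is the sequence of coefficients of z / (exp z - 1), so VV inverts SH - 1 in epsTH_WW. *)
Definition VV : PS := Op dc cB WW.
Lemma Hom_VV : Hom 1 VV. Proof. apply Hom_Op, Hom_WW. Qed.
Lemma SH_cem f : SH f = f + Op dc cem f.
Proof.
  unfold Sh. rewrite Op_rec, (Op_rec dc cem).
  replace (cexp 0) with (RtoC 1) by (unfold cexp; simpl; field).
  change (gtl cem) with (gtl cexp). change (cem 0) with (RtoC 0).
  change (pc (fcst 1)) with P1. change (pc (fcst 0)) with P0. ring.
Qed.
Lemma Op_cz f : Op dc cz f = eps * DC f.
Proof.
  rewrite Op_rec, Op_rec. change (cz 0) with (RtoC 0). change (gtl cz 0) with (RtoC 1).
  replace (Op dc (gtl (gtl cz)) (DC (DC f))) with P0.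
  - change (pc (fcst 1)) with P1. change (pc (fcst 0)) with P0. ring.
  - apply ps_ext; intros n. symmetry. unfold Op. generalize (DC (DC f)). clear.
    assert (K : forall m c g, (forall i, c i = RtoC 0) -> opk dc m c g = P0 m).
    { induction m as [|m IH]; intros c g H; simpl.
      - rewrite H. change (P0 0%nat) with f0. ring.
      - rewrite H, IH by (intros i; apply H). unfold P0, pc, gcst. destruct m; ring. }
    intros g. apply K. reflexivity.
Qed.

Lemma eps_inj f g : eps * f = eps * g -> f = g.
Proof.
  intros H. apply ps_ext; intros k. rewrite <- (eps_mul_S f), <- (eps_mul_S g), H. reflexivity.
Qed.

Lemma TH_VV : TH VV = - DC (DC ro).
Proof.
  apply eps_inj. unfold VV. rewrite TH_Op, <- (Op_eps dc isder_dc), epsTH_WW, (Op_opp dc isder_dc), <- DC_Op.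
  rewrite SH_cem. replace (ro + Op dc cem ro - ro) with (Op dc cem ro) by ring.
  rewrite (Op_comp dc isder_dc), cB_cem, Op_cz, DC_epsmul. ring.
Qed.

(** * The primitive of the odd part *)

Definition CS : Type := nat -> C.
Definition sadd : CS -> CS -> CS := gadd Cplus.
Definition smul : CS -> CS -> CS := gmul Cplus Cmult.
Definition ssub : CS -> CS -> CS := gsub Cminus.
Definition sopp : CS -> CS := gopp Copp.
Definition S0 : CS := gcst (RtoC 0) (RtoC 0).
Definition S1 : CS := gcst (RtoC 0) (RtoC 1).
Lemma CS_ring : ring_theory S0 S1 sadd smul ssub sopp eq.
Proof. exact (g_ring _ _ _ _ _ _ C_ring_theory). Qed.
Add Ring CSring : CS_ring.

Definition evp (u y : C) (f : PS) : CS := fun k => ev (f k) u y.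

Section Evp.
Context (u y : C) (Ho : ok u y).
Lemma evp_add f g : evp u y (f + g) = sadd (evp u y f) (evp u y g).
Proof. extensionality k; apply ev_add, Ho. Qed.
Lemma evp_opp f : evp u y (- f) = sopp (evp u y f).
Proof. extensionality k; apply ev_opp, Ho. Qed.
Lemma evp_sub f g : evp u y (f - g) = ssub (evp u y f) (evp u y g).
Proof. extensionality k; apply ev_sub, Ho. Qed.
Lemma ev_gsum F n : ev (gsum fadd F n) u y = gsum Cplus (fun i => ev (F i) u y) n.
Proof. induction n as [|n IH]; cbn [gsum]; [reflexivity|]. now rewrite (ev_add _ _ _ _ Ho), IH. Qed.
Lemma evp_mul f g : evp u y (f * g) = smul (evp u y f) (evp u y g).
Proof.
  extensionality k. unfold evp, pmul, smul, gmul. rewrite ev_gsum. apply gsum_ext.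
  intros i _. apply ev_mul, Ho.
Qed.
Lemma evp_P0 : evp u y P0 = S0.
Proof. extensionality k; destruct k; apply ev_cst, Ho. Qed.
Lemma evp_P1 : evp u y P1 = S1.
Proof. extensionality k; destruct k; apply ev_cst, Ho. Qed.
End Evp.

Lemma S_cancel (a f : CS) : a O <> 0%C -> smul a f = S0 -> f = S0.
Proof.
  intros H E. apply (g_cancel _ _ _ _ _ _ C_ring_theory a f (/ a O)%C); [now apply Cinv_l|exact E].
Qed.

Lemma Sym_sym a b : Sym a b -> Sym b a.
Proof.
  intros H u y Ho Ho'. rewrite <- (H u (- y)%C Ho').
  - now replace (- - y)%C with y by ring.
  - now replace (- - y)%C with y by ring.
Qed.
Lemma SymP_sym f g : SymP f g -> SymP g f.
Proof. intros H k; apply Sym_sym, H. Qed.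
Lemma SymP_evp f g u y : SymP f g -> ok u y -> ok u (- y)%C -> evp u (- y)%C f = evp u y g.
Proof. intros H Ho Ho'; extensionality k; apply H; assumption. Qed.

Lemma SymP_rm : SymP rm rp.
Proof.
  assert (H : Nice (P1 + zt * qq)).
  { apply Nice_add; [apply Nice_P1|apply Nice_mul; [apply Nice_zt|apply qq_nice]]. }
  unfold rp, rm. set (x := P1 + zt * qq) in *. clearbody x.
  eapply SymP_eq.
  - apply SymP_opp, SymP_mul; [|apply H]. unfold EE.
    apply SymP_mul; apply SymP_pc; [apply Sym_ui|apply Sym_yi].
  - unfold EE. rewrite star_opp, !star_mul, !star_pc, pc_opp. ring.
Qed.
Lemma SymP_kap : SymP kap kap.
Proof.
  eapply SymP_eq; [apply SymP_mul; [apply SymP_pc, Sym_u|apply Lam_nice]|].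
  rewrite Lam_star. reflexivity.
Qed.
Lemma SymP_alp : SymP alp alp.
Proof.
  eapply SymP_eq; [apply SymP_mul; [apply SymP_pc, Sym_ui|apply ii_nice]|].
  rewrite <- alp_star at 1. unfold alp. now rewrite star_mul, star_pc.
Qed.
Lemma SymP_HH : SymP HH HH.
Proof.
  apply SymP_mul; [apply SymP_add; apply SymP_pc, Sym_t|].
  apply SymP_mul; [apply SymP_kap|apply SymP_Op, SymP_kap].
Qed.
Lemma SymP_am : SymP am ap.
Proof. apply SymP_sub; [apply SymP_sub; [apply SymP_alp|apply SymP_rm]|apply SymP_HH]. Qed.
Lemma SymP_bm : SymP bm bp.
Proof.
  apply SymP_sub; [apply SymP_add; [apply SymP_Op, SymP_rm|apply SymP_Op, SymP_alp]|apply SymP_HH].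
Qed.

Lemma DC_HH : DC HH = HH * (ll + SH ll).
Proof.
  unfold ll. rewrite SH_mul, <- DC_SH. fold alp'. unfold HH, kap'. rewrite !DC_mul, DC_add, DC_t.
  fold kap'. lin (- (t2 * kap' * DC kap * dif kap_alp) - t2 * kap * DC kap' * dif kap_alp').
Qed.

Lemma HH_0_neq u y : ok u y -> ok u (- y)%C -> evp u y HH O <> 0%C.
Proof.
  intros Ho Ho'. unfold evp. rewrite HH_0. unfold hA. evs.
  destruct Ho as (Hu & Hy & Hz), Ho' as (_ & _ & Hz').
  replace (/ 2 * (y * y - 1) * (/ u * / y * / y))%C
    with (- (/ 2 * ((1 + y) * (1 + - y)) * (/ u * / y * / y)))%C by (field; split; assumption).
  intros E. 
  assert (E2 : ((1 + y) * (1 + - y) = 0)%C).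
  { transitivity (- (2 * u * y * y) * (- (/ 2 * ((1 + y) * (1 + - y)) * (/ u * / y * / y))))%C.
    - field; split; assumption.
    - rewrite E; ring. }
  exact (Cmult_neq_0 _ _ Hz Hz' E2).
Qed.

(* The relation [a_+ * b_+ = HH^2] trades the logarithmic derivative of a_+ for that of b_+. *)
Lemma dlog_swap (A B H wA wB m dA dB dH : CS) :
  smul A B = smul H H -> smul A wA = dA -> smul B wB = dB -> smul H m = dH ->
  sadd (smul dA B) (smul A dB) = sadd (smul dH H) (smul H dH) -> H O <> 0%C ->
  sadd wA wB = sadd m m.
Proof.
  intros E1 E2 E3 E4 E5 HO.
  assert (K : smul (smul H H) (ssub (sadd wA wB) (sadd m m)) = S0).
  { transitivity (ssub (sadd (smul (smul A wA) B) (smul A (smul B wB)))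
                       (sadd (smul (smul H m) H) (smul H (smul H m)))).
    - rewrite <- E1 at 1.
      transitivity (ssub (smul (smul A B) (sadd wA wB)) (smul (smul A B) (sadd m m))); [ring|].
      rewrite E1 at 2. ring.
    - rewrite E2, E3, E4, E5. ring. }
  apply S_cancel in K.
  - transitivity (sadd (ssub (sadd wA wB) (sadd m m)) (sadd m m)); [ring|]. rewrite K. ring.
  - unfold smul, gmul; simpl. exact (Cmult_neq_0 _ _ HO HO).
Qed.

(** The exchange turns log a_- + log b_+ into log a_+ + log b_-, and by the product relations the
    two add up to 4 log H, so [WW] plus its image is zero. The argument runs at points because the
    logarithmic derivatives of a_+ and b_- may have a pole at y = 1 and need not lie in [FA]. *)
Lemma SymP_WW : SymP WW (- WW).
Proof.
  assert (K : forall u y, ok u y -> ok u (- y)%C -> evp u (- y)%C WW = evp u y (- WW)).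
  { intros u y Ho Ho'.
    assert (S1' : forall f g, SymP f g -> evp u (- y)%C f = evp u y g) by (intros; now apply SymP_evp).
    assert (Hm : evp u (- y)%C (ll + SH ll) = evp u y (ll + SH ll)).
    { apply S1'. assert (Hl : SymP ll ll) by (apply SymP_mul; [apply SymP_dc, SymP_kap|apply SymP_alp]).
      apply SymP_add; [exact Hl|apply SymP_Op, Hl]. }
    assert (EH := DC_HH). 
    assert (F1 : sadd (evp u (- y)%C wa) (evp u y wb) = sadd (evp u y (ll + SH ll)) (evp u y (ll + SH ll))).
    { apply (dlog_swap (evp u y ap) (evp u y bp) (evp u y HH) _ _ _ (evp u y (DC ap)) (evp u y (DC bp)) (evp u y (DC HH))).
      - rewrite <- !evp_mul by exact Ho. f_equal. exact ap_bp.
      - rewrite <- (S1' _ _ SymP_am), <- (S1' _ _ (SymP_dc _ _ SymP_am)).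
        rewrite <- evp_mul by exact Ho'. f_equal. unfold wa. lin (DC am * dif am_ia).
      - rewrite <- evp_mul by exact Ho. f_equal. unfold wb. lin (DC bp * dif bp_ib).
      - rewrite <- evp_mul by exact Ho. f_equal. now rewrite EH.
      - rewrite <- !evp_mul, <- !evp_add by exact Ho. f_equal. rewrite <- !DC_mul. f_equal. exact ap_bp.
      - now apply HH_0_neq. }
    assert (F2 : sadd (evp u y wa) (evp u (- y)%C wb) = sadd (evp u y (ll + SH ll)) (evp u y (ll + SH ll))).
    { apply (dlog_swap (evp u y am) (evp u y bm) (evp u y HH) _ _ _ (evp u y (DC am)) (evp u y (DC bm)) (evp u y (DC HH))).
      - rewrite <- !evp_mul by exact Ho. f_equal. exact am_bm.
      - rewrite <- evp_mul by exact Ho. f_equal. unfold wa. lin (DC am * dif am_ia).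
      - rewrite <- (S1' _ _ (SymP_sym _ _ SymP_bm)), <- (S1' _ _ (SymP_dc _ _ (SymP_sym _ _ SymP_bm))).
        rewrite <- evp_mul by exact Ho'. f_equal. unfold wb. lin (DC bp * dif bp_ib).
      - rewrite <- evp_mul by exact Ho. f_equal. now rewrite EH.
      - rewrite <- !evp_mul, <- !evp_add by exact Ho. f_equal. rewrite <- !DC_mul. f_equal. exact am_bm.
      - now apply HH_0_neq. }
    assert (Eh : evp u (- y)%C half = evp u y half) by (apply S1', SymP_pc, Sym_cst).
    assert (EW : forall v, ok u v -> evp u v WW = ssub (smul (evp u v half) (sadd (evp u v wa) (evp u v wb))) (evp u v (ll + SH ll))).
    { intros v Hv. rewrite <- evp_add, <- evp_mul, <- evp_sub by exact Hv. f_equal. unfold WW. ring. }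
    rewrite evp_opp by exact Ho. rewrite (EW _ Ho), (EW _ Ho'), Hm, Eh.
    assert (R2 : sadd (evp u y half) (evp u y half) = S1) by (rewrite <- evp_add, R_half, evp_P1 by exact Ho; reflexivity).
    set (h := evp u y half) in *. set (m := evp u y (ll + SH ll)) in *.
    transitivity (ssub (ssub (smul h (sadd (sadd (evp u (- y)%C wa) (evp u y wb)) (sadd (evp u y wa) (evp u (- y)%C wb)))) m)
       (smul h (sadd (evp u y wa) (evp u y wb)))); [ring|].
    rewrite F1, F2.
    transitivity (ssub (ssub (smul (sadd h h) (sadd m m)) m) (smul h (sadd (evp u y wa) (evp u y wb)))); [ring|].
    rewrite R2. ring. }
  intros k u y Ho Ho'. exact (f_equal (fun f : CS => f k) (K u y Ho Ho')).
Qed.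

Lemma SymP_VV : SymP VV (- VV).
Proof. eapply SymP_eq; [apply SymP_Op, SymP_WW|]. apply (Op_opp dc isder_dc). Qed.
Lemma SymP_ro : SymP ro (- ro).
Proof.
  eapply SymP_eq; [apply SymP_mul; [apply SymP_pc, Sym_cst|apply SymP_sub; [apply SymP_sym, SymP_rm|apply SymP_rm]]|].
  unfold ro. ring.
Qed.

(* Primitives of dc ro_k and of ro_k supplied by Euler's identity: no integration is needed. *)
Definition Xk (k : nat) : FA := (fcst (- / INR k) * (fcst 3 * dc (ro k) - cA * VV k))%fa.
Definition Phi (k : nat) : FA := (fcst (- / INR (k - 1)) * (fcst 3 * ro k + cA * Xk k))%fa.

Lemma th_VV k : th (VV k) = (- dc (dc (ro k)))%fa.
Proof. exact (f_equal (fun h : PS => h k) TH_VV). Qed.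

Lemma INRC_neq k : (k <> 0)%nat -> RtoC (INR k) <> 0%C.
Proof. intros H E. apply RtoC_inj in E. revert E. now apply not_0_INR. Qed.

Lemma D1_ro k : (1 <= k)%nat -> D1 (ro k) = (fcst (INR (k - 1)) * ro k)%fa.
Proof.
  intros H. rewrite (Hom_k (-1) _ _ Hom_ro). f_equal. f_equal. rewrite minus_INR by exact H.
  rewrite RtoC_minus. simpl. ring.
Qed.
Lemma D1_dcro k : D1 (dc (ro k)) = (fcst (INR k) * dc (ro k))%fa.
Proof.
  rewrite D1_dc, (Hom_k (-1) _ _ Hom_ro), (der_cmul _ _ _ isder_dc). fa_ring.
Qed.

(** As theta of [VV] is minus the second c-derivative of [ro] and theta kills c, theta of the
    bracket in [Xk] is Euler's operator applied to [dc (ro k)], which has degree k. *)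
Lemma th_X k : (1 <= k)%nat -> th (Xk k) = dc (ro k).
Proof.
  intros H. unfold Xk. rewrite (der_cmul _ _ _ isder_th), (der_sub _ _ _ isder_th), (der_cmul _ _ _ isder_th),
    (der_mul _ isder_th), th_c, th_VV.
  assert (E := euler (dc (ro k))). rewrite D1_dcro in E.
  transitivity (fcst (- / INR k) * (fcst 3 * th (dc (ro k)) + cA * dc (dc (ro k))))%fa; [fa_ring|].
  rewrite E. fa_ext. field. apply INRC_neq; lia.
Qed.

(** The same step once more, now with degree k - 1. That degree vanishes for k = 1, an order left to
    [ro_odd]. *)
Lemma th_Phi k : (2 <= k)%nat -> th (Phi k) = ro k.
Proof.
  intros H. unfold Phi. rewrite (der_cmul _ _ _ isder_th), (der_add _ isder_th), (der_cmul _ _ _ isder_th),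
    (der_mul _ isder_th), th_c, th_X by lia.
  assert (E := euler (ro k)). rewrite D1_ro in E by lia.
  transitivity (fcst (- / INR (k - 1)) * (fcst 3 * th (ro k) + cA * dc (ro k)))%fa; [fa_ring|].
  rewrite E. fa_ext. field. apply INRC_neq; lia.
Qed.

Lemma D1_c : D1 cA = (- cA)%fa. Proof. ff. Qed.
Lemma D1_X k : D1 (Xk k) = (fcst (INR k) * Xk k)%fa.
Proof.
  unfold Xk. rewrite (der_cmul _ _ _ isder_D1), (der_sub _ _ _ isder_D1), (der_cmul _ _ _ isder_D1),
    (der_mul _ isder_D1), D1_dcro, (Hom_k 1 _ _ Hom_VV), D1_c. fa_ring.
Qed.
Lemma D1_Phi k : (1 <= k)%nat -> D1 (Phi k) = (fcst (INR (k - 1)) * Phi k)%fa.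
Proof.
  intros H. unfold Phi. rewrite (der_cmul _ _ _ isder_D1), (der_add _ isder_D1), (der_cmul _ _ _ isder_D1),
    (der_mul _ isder_D1), D1_ro, D1_X, D1_c by exact H.
  replace (fcst (INR k)) with (fcst (INR (k - 1)) + f1)%fa.
  - ring.
  - rewrite minus_INR by exact H. fa_ext. rewrite RtoC_minus. simpl. ring.
Qed.
Lemma Sym_Phi k : Sym (Phi k) (- Phi k)%fa.
Proof.
  assert (Hr := SymP_ro k). assert (HV := SymP_VV k). rewrite popp_k in Hr, HV.
  unfold Phi, Xk. eapply Sym_eq.
  - repeat first [exact HV | exact Hr | apply Sym_dc, Hr | apply Sym_c | apply Sym_cst
      | apply Sym_mul | apply Sym_sub | apply Sym_add].
  - rewrite (der_opp _ _ isder_dc). fa_ring.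
Qed.

(** * Values at t = 0 *)

Lemma ok1 (u : C) : u <> 0%C -> ok u 1.
Proof.
  intros H. split; [exact H|split]; intros E.
  - apply RtoC_inj in E; lra.
  - rewrite <- RtoC_plus in E. apply RtoC_inj in E; lra.
Qed.

(* Agreement on y = 1, i.e. at the endpoint t = 0, lambda_0 = t / c. *)
Definition e1 (a b : FA) : Prop := forall u : C, u <> 0%C -> ev a u 1 = ev b u 1.
Definition E1 (f g : PS) : Prop := forall k, e1 (f k) (g k).

Lemma E1_evp f g : E1 f g <-> forall u : C, u <> 0%C -> evp u 1 f = evp u 1 g.
Proof.
  split; intros H.
  - intros u Hu. extensionality k. now apply H.
  - intros k u Hu. exact (f_equal (fun h : CS => h k) (H u Hu)).
Qed.
Lemma E1_refl f : E1 f f. Proof. intros k u _; reflexivity. Qed.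
Lemma E1_sym f g : E1 f g -> E1 g f. Proof. intros H k u Hu; symmetry; now apply H. Qed.
Lemma E1_trans f g h : E1 f g -> E1 g h -> E1 f h.
Proof. intros H K k u Hu; rewrite H by exact Hu; now apply K. Qed.
Lemma E1_add f g f' g' : E1 f g -> E1 f' g' -> E1 (f + f') (g + g').
Proof.
  rewrite !E1_evp; intros H K u Hu. rewrite !evp_add by (now apply ok1). now rewrite H, K.
Qed.
Lemma E1_sub f g f' g' : E1 f g -> E1 f' g' -> E1 (f - f') (g - g').
Proof.
  rewrite !E1_evp; intros H K u Hu. rewrite !evp_sub by (now apply ok1). now rewrite H, K.
Qed.
Lemma E1_mul f g f' g' : E1 f g -> E1 f' g' -> E1 (f * f') (g * g').
Proof.
  rewrite !E1_evp; intros H K u Hu. rewrite !evp_mul by (now apply ok1). now rewrite H, K.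
Qed.
Lemma E1_opp f g : E1 f g -> E1 (- f) (- g).
Proof.
  rewrite !E1_evp; intros H u Hu. rewrite !evp_opp by (now apply ok1). now rewrite H.
Qed.
Lemma E1_star f g : E1 f g -> E1 (star f) (star g).
Proof. intros H k u Hu. unfold star. rewrite !ev_mul by (now apply ok1). now rewrite H. Qed.
Lemma E1_pc a b : e1 a b -> E1 (pc a) (pc b).
Proof. intros H [|k]; [exact H|intros u _; reflexivity]. Qed.
Lemma e1_D1 a b : e1 a b -> e1 (D1 a) (D1 b).
Proof.
  intros H u Hu.
  set (V := fun s : R => (u + RtoC s * u)%C).
  assert (HV : is_derive V 0%R u) by apply is_derive_line.
  assert (EV : V 0%R = u) by (unfold V; ring).
  assert (HY : is_derive (fun _ : R => RtoC 1) 0%R (RtoC 0)) by apply is_derive_C_const.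
  assert (Ho : ok (V 0%R) 1) by (rewrite EV; now apply ok1).
  pose proof (ev_derive a V (fun _ => RtoC 1) 0%R _ _ Ho HV HY) as K1.
  pose proof (ev_derive b V (fun _ => RtoC 1) 0%R _ _ Ho HV HY) as K2.
  cbv beta in K1, K2. rewrite EV in K1, K2.
  transitivity (ev (D1 a) u 1 * / u * u + ev (Dy a) u 1 * 0)%C; [field; exact Hu|].
  transitivity (ev (D1 b) u 1 * / u * u + ev (Dy b) u 1 * 0)%C; [|field; exact Hu].
  refine (is_derive_C_uniq (fun s => ev b (V s) 1) 0%R _ _ _ K2).
  apply (is_derive_ext_loc (V := CN)) with (2 := K1).
  destruct (ok_near V (fun _ => RtoC 1) 0%R _ _ HV HY Ho) as [e E].
  exists e. intros s Hs. apply H. apply (E s Hs).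
Qed.
(** The y-component of d/dc carries the factor y^2 - 1, so d/dc restricts to the line y = 1, where c
    = 1 / u, and acts there as -u^2 d/du. Hence S can be computed after restriction. *)
Lemma ev_dc_1 a (u : C) : u <> 0%C -> ev (dc a) u 1 = (- u * ev (D1 a) u 1)%C.
Proof.
  intros Hu. assert (Ho := ok1 u Hu). unfold dc, rA, sA. evs. ring.
Qed.
Lemma e1_dc a b : e1 a b -> e1 (dc a) (dc b).
Proof. intros H u Hu. rewrite !ev_dc_1 by exact Hu. now rewrite (e1_D1 a b H u Hu). Qed.
Lemma E1_dc f g : E1 f g -> E1 (DC f) (DC g).
Proof. intros H k; apply e1_dc, H. Qed.
Lemma E1_Op c f g : E1 f g -> E1 (Op dc c f) (Op dc c g).
Proof.
  intros H k. unfold Op. revert c f g H; induction k as [|k IH]; intros c f g H u Hu; cbn [opk].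
  - rewrite !ev_mul by (now apply ok1). now rewrite H.
  - rewrite !ev_add, !ev_mul by (now apply ok1). rewrite H by exact Hu. f_equal.
    apply IH; [now apply E1_dc|exact Hu].
Qed.
(** Both components of theta carry the factor y^2 - 1, as t itself does. *)
Lemma E1_th f : E1 (TH f) P0.
Proof.
  intros k u Hu. assert (Ho := ok1 u Hu). replace (ev (P0 k) u 1) with (RtoC 0).
  - unfold pm, th, hA, qA. evs. ring.
  - symmetry. destruct k; apply ev_cst, Ho.
Qed.
Ltac e1_val := intros u Hu; assert (Ho := ok1 u Hu); evs.
Lemma E1_hh : E1 hh P0. Proof. apply E1_pc. unfold hA. e1_val. ring. Qed.
Lemma E1_kk : E1 kk P0. Proof. apply E1_pc. unfold k0A. e1_val. ring. Qed.
Lemma E1_nn : E1 nn P0. Proof. apply E1_pc. unfold n0A. e1_val. ring. Qed.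
Lemma E1_t : E1 (pc tA) P0. Proof. apply E1_pc. unfold tA. e1_val. ring. Qed.
Lemma E1_Yi : E1 Yi P1. Proof. apply E1_pc. e1_val. field. Qed.

Lemma E1_mul0 f g : E1 f P0 -> E1 (f * g) P0.
Proof.
  intros H. replace P0 with (P0 * g) by ring. apply E1_mul; [exact H|apply E1_refl].
Qed.
Lemma E1_mul0r f g : E1 g P0 -> E1 (f * g) P0.
Proof. intros H. replace (f * g) with (g * f) by ring. now apply E1_mul0. Qed.
Lemma E1_add0 f g : E1 f P0 -> E1 g P0 -> E1 (f + g) P0.
Proof. intros H K. replace P0 with (P0 + P0) by ring. now apply E1_add. Qed.
Lemma E1_sub0 f g : E1 f P0 -> E1 g P0 -> E1 (f - g) P0.
Proof. intros H K. replace P0 with (P0 - P0) by ring. now apply E1_sub. Qed.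
Lemma E1_opp0 f : E1 f P0 -> E1 (- f) P0.
Proof. intros H. replace P0 with (- P0) by ring. now apply E1_opp. Qed.
Lemma E1_addr0 f g h : E1 f h -> E1 g P0 -> E1 (f + g) h.
Proof. intros H K. replace h with (h + P0) by ring. now apply E1_add. Qed.
Lemma E1_eq f g g' : E1 f g -> g = g' -> E1 f g'. Proof. now intros H <-. Qed.

Lemma E1_ww : E1 ww P0.
Proof.
  rewrite ww_eq. apply E1_mul0r. unfold Tw. apply E1_mul0r.
  apply E1_add0; [apply E1_sub0; [apply E1_add0|]|].
  - apply E1_mul0, E1_mul0, E1_kk.
  - apply E1_mul0r, E1_th.
  - apply E1_mul0, E1_th.
  - apply E1_mul0, E1_hh.
Qed.
Lemma E1_Lam : E1 Lam P1.
Proof. apply E1_addr0; [apply E1_refl|apply E1_mul0r, E1_ww]. Qed.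
Lemma E1_ii : E1 ii P1.
Proof.
  rewrite ii_eq. eapply E1_eq; [apply E1_sub; [apply E1_refl|apply E1_mul0, E1_mul0r, E1_ww]|ring].
Qed.
Lemma E1_kap : E1 kap U.
Proof. eapply E1_eq; [apply E1_mul; [apply E1_refl|apply E1_Lam]|ring]. Qed.
Lemma E1_alp : E1 alp Ui.
Proof. eapply E1_eq; [apply E1_mul; [apply E1_refl|apply E1_ii]|ring]. Qed.
Lemma E1_jj : E1 jj P0.
Proof. apply E1_opp0, E1_mul0, E1_ww. Qed.
Lemma E1_Bq : E1 Bq P0.
Proof.
  apply E1_mul0r. apply E1_sub0; [|apply E1_nn].
  apply E1_sub0; [apply E1_add0|apply E1_mul0, E1_hh].
  - apply E1_mul0r, E1_jj.
  - apply E1_mul0r, E1_mul0, E1_jj.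
Qed.
(** At y = 1 the source and the derivative drop out of the recursion and leave (1 + zt qq / 2) qq =
    0, whose first factor has constant term 1. *)
Lemma E1_qq : E1 qq P0.
Proof.
  assert (H : E1 ((P1 + zt * (half * qq)) * qq) P0).
  { replace ((P1 + zt * (half * qq)) * qq) with (Bq + zt * half * TH qq) by (lin (- dif qq_eq)).
    apply E1_add0; [apply E1_Bq|apply E1_mul0r, E1_th]. }
  apply E1_evp. intros u Hu. assert (Ho := ok1 u Hu). rewrite evp_P0 by exact Ho.
  rewrite E1_evp in H. specialize (H u Hu). rewrite evp_mul, evp_P0 in H by exact Ho.
  apply S_cancel in H; [exact H|].
  rewrite evp_add, evp_P1 by exact Ho. unfold sadd, gadd, evp. rewrite pmul_0.
  change (zt O) with ((eps * pc (fu * fy)%fa) O). rewrite eps_mul_0. evs.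
  change (S1 O) with (RtoC 1). intros E.
  rewrite Cmult_0_l, Cplus_0_r in E.
  apply RtoC_inj in E; lra.
Qed.
Lemma E1_rm : E1 rm (- Ui).
Proof.
  eapply E1_eq.
  - apply E1_opp, E1_mul; [apply E1_mul; [apply E1_refl|apply E1_Yi]|].
    apply E1_add; [apply E1_refl|apply E1_mul0r, E1_qq].
  - ring.
Qed.
Lemma E1_rp : E1 rp Ui.
Proof.
  eapply E1_eq; [apply E1_opp, E1_star, E1_rm|]. rewrite star_opp, star_pc. ring.
Qed.
Lemma E1_HH : E1 HH P0.
Proof. apply E1_mul0, E1_add0; apply E1_t. Qed.
Lemma E1_ro_DC : E1 (ro - Ui) P0.
Proof.
  eapply E1_eq.
  - apply E1_sub; [apply E1_mul; [apply E1_refl|apply E1_sub; [apply E1_rp|apply E1_rm]]|apply E1_refl].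
  - lin (dif R_half * Ui).
Qed.

Lemma E1_cancel a g x b : E1 (a * g) P1 -> E1 (a * x) b -> E1 x (b * g).
Proof.
  intros H K. apply E1_sym. eapply E1_trans; [apply E1_mul; [apply E1_sym, K|apply E1_refl]|].
  replace (a * x * g) with (a * g * x) by ring.
  eapply E1_eq; [apply E1_mul; [exact H|apply E1_refl]|ring].
Qed.

Lemma E1_DCUi : E1 (DC (Ui + Ui)) (P1 + P1).
Proof.
  rewrite DC_add, (pm_pc dc isder_dc), dc_ui.
  apply E1_add; (apply E1_pc; e1_val; ring).
Qed.
Lemma E1_am : E1 am (Ui + Ui).
Proof.
  eapply E1_eq; [apply E1_sub; [apply E1_sub; [apply E1_alp|apply E1_rm]|apply E1_HH]|ring].
Qed.
Lemma E1_bp : E1 bp (SH (Ui + Ui)).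
Proof.
  rewrite SH_add. eapply E1_eq.
  - apply E1_sub; [apply E1_add; [apply E1_Op, E1_rp|apply E1_Op, E1_alp]|apply E1_HH].
  - unfold Sh. ring.
Qed.
Lemma half_inv f g : f * g = P1 -> (f + f) * (half * g) = P1.
Proof. intros H. lin (dif R_half * f * g + dif H). Qed.
Lemma E1_wa : E1 wa U.
Proof.
  eapply E1_eq; [apply (E1_cancel am (half * U) wa (P1 + P1))|lin (dif R_half * U)].
  - eapply E1_eq; [apply E1_mul; [apply E1_am|apply E1_refl]|].
    apply half_inv. lin (dif R_U).
  - replace (am * wa) with (DC am) by (unfold wa; lin (- (DC am * dif am_ia))).
    eapply E1_trans; [apply E1_dc, E1_am|apply E1_DCUi].
Qed.
Lemma SH_U : SH Ui * SH U = P1.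
Proof. rewrite <- SH_mul. replace (Ui * U) with P1 by (lin (- dif R_U)). apply SH_P1. Qed.
Lemma E1_wb : E1 wb (SH U).
Proof.
  eapply E1_eq; [apply (E1_cancel bp (half * SH U) wb (P1 + P1))|lin (dif R_half * SH U)].
  - eapply E1_eq; [apply E1_mul; [apply E1_bp|apply E1_refl]|].
    rewrite SH_add. apply half_inv, SH_U.
  - replace (bp * wb) with (DC bp) by (unfold wb; lin (- (DC bp * dif bp_ib))).
    eapply E1_trans; [apply E1_dc, E1_bp|]. rewrite DC_SH.
    eapply E1_eq; [apply E1_Op, E1_DCUi|]. change (SH (P1 + P1) = P1 + P1). now rewrite SH_add, SH_P1.
Qed.
Lemma E1_ll : E1 ll (- U).
Proof.
  eapply E1_eq.
  - apply E1_mul; [|apply E1_alp]. eapply E1_trans; [apply E1_dc, E1_kap|].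
    rewrite (pm_pc dc isder_dc), dc_u.
    instantiate (1 := - (U * U)). rewrite <- pc_mul, <- pc_opp. apply E1_pc. e1_val. ring.
  - lin (- (U * dif R_U)).
Qed.
(** On y = 1 the series [HH] vanishes together with t, but its logarithmic c-derivative does not: it
    is that of kap (S kap) = 1 / (c (c + eps)). The negative sign makes the contributions add up,
    1/2 from a_- and b_+ and 1 from H. *)
Lemma E1_WW : E1 WW (half * (P1 + P1 + P1) * (U + SH U)).
Proof.
  eapply E1_eq.
  - apply E1_sub; [apply E1_sub; [apply E1_mul; [apply E1_refl|apply E1_add; [apply E1_wa|apply E1_wb]]|apply E1_ll]|].
    apply E1_Op, E1_ll.
  - change (Op dc cexp (- U)) with (SH (- U)). rewrite SH_opp. lin (- (dif R_half * (U + SH U))).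
Qed.
(** The symbol identity is (1 + e^z) z / (e^z - 1) = 2 z / (e^z - 1) + z; the extra z affects only
    the coefficient of order eps. *)
Lemma E1_VV : E1 VV ((P1 + P1 + P1) * Op dc cB U + half * (P1 + P1 + P1) * (eps * DC U)).
Proof.
  eapply E1_trans; [apply E1_Op, E1_WW|].
  assert (E : Op dc cB (half * (P1 + P1 + P1) * (U + SH U)) = half * (P1 + P1 + P1) * Op dc cB (U + SH U)).
  { assert (Ec : half * (P1 + P1 + P1) = pc (fcst (3 / 2)%C)).
    { unfold P1. rewrite <- !pc_add, <- pc_mul. f_equal. fa_ext. field. }
    rewrite Ec. apply (Op_cmul dc isder_dc). }
  rewrite E, (Op_add dc isder_dc), (SH_cem U), (Op_add dc isder_dc), (Op_comp dc isder_dc), cB_cem, Op_cz.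
  eapply E1_eq; [apply E1_refl|].
  lin (dif R_half * (P1 + P1 + P1) * Op dc cB U).
Qed.

(** The rising factorial, from (-u^2 d/du)^n u^m = (-1)^n m (m + 1) ... (m + n - 1) u^(m + n). *)
Fixpoint rf (m n : nat) : R := match n with O => 1%R | S p => (INR m * rf (S m) p)%R end.
Lemma rf_fact m n : (INR (fact m) * rf (S m) n)%R = INR (fact (m + n)).
Proof.
  revert m; induction n as [|n IH]; intros m; cbn [rf].
  - rewrite Nat.add_0_r; ring.
  - replace (m + S n)%nat with (S m + n)%nat by lia. rewrite <- IH, fact_simpl, mult_INR. ring.
Qed.

Lemma ev_Op_pow n : forall (m : nat) (c : nat -> C) (x : FA) (z : C),
  (forall u : C, u <> 0%C -> ev x u 1 = z * u ^ m)%C ->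
  forall u : C, u <> 0%C -> ev (opk dc n c (pc x)) u 1 = (c n * z * (- 1) ^ n * rf m n * u ^ (m + n))%C.
Proof.
  induction n as [|n IH]; intros m c x z Hx u Hu; cbn [opk].
  - rewrite ev_mul, ev_cst by (now apply ok1). change (pc x O) with x. rewrite Hx by exact Hu.
    rewrite Nat.add_0_r. simpl. ring.
  - rewrite ev_add, ev_mul, ev_cst, (pm_pc dc isder_dc) by (now apply ok1).
    change (pc x (S n)) with f0. rewrite ev_cst by (now apply ok1).
    rewrite (IH (S m) (gtl c) (dc x) (- z * INR m)%C).
    + unfold gtl. cbn [rf]. rewrite RtoC_mult. replace (m + S n)%nat with (S m + n)%nat by lia. simpl. ring.
    + intros v Hv. rewrite ev_dc_1 by exact Hv.
      (* [Hx] gives the values of [x] on y = 1 only. These determine [D1 x] there, so it can be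
         computed on an explicit expression for z u^m. *)
      assert (Hx' : e1 (D1 x) (fcst (z * INR m)%C * mk (nat_rect _ (Ec 1) (fun _ e => Emul Eu e) m))%fa).
      { assert (K : e1 x (fcst z * mk (nat_rect _ (Ec 1) (fun _ e => Emul Eu e) m))%fa).
        { intros w Hw. assert (Ho := ok1 w Hw). rewrite Hx by exact Hw. evs. rewrite ev_mk by exact Ho.
          f_equal. clear. induction m as [|m IH]; simpl; [reflexivity|]. now rewrite IH. }
        apply e1_D1 in K. intros w Hw. rewrite K by exact Hw. assert (Ho := ok1 w Hw).
        rewrite (der_cmul _ _ _ isder_D1), (proj1 (D_mk _)). evs. rewrite !ev_mk by exact Ho.
        clear. induction m as [|m IH]; [simpl; ring|]. cbn [nat_rect dru sem]. rewrite S_INR, RtoC_plus.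
        set (P := sem (nat_rect _ _ _ m) w 1) in *. set (D := sem (dru _) w 1) in *.
        transitivity (z * (w * P) + w * (z * D))%C; [ring|]. rewrite IH. ring. }
      rewrite Hx' by exact Hv. assert (Ho := ok1 v Hv). evs. rewrite ev_mk by exact Ho.
      assert (Ep : sem (nat_rect _ (Ec 1) (fun _ e => Emul Eu e) m) v 1 = (v ^ m)%C).
      { clear. induction m as [|m IH]; simpl; [reflexivity|]. now rewrite IH. }
      rewrite Ep. simpl. ring.
    + exact Hu.
Qed.

Lemma ev_VV_1 k (u : C) : (2 <= k)%nat -> u <> 0%C ->
  ev (VV k) u 1 = (3 * bernoulli k * (- 1) ^ k * u ^ (S k))%C.
Proof.
  intros Hk Hu. assert (Ho := ok1 u Hu). rewrite (E1_VV k u Hu).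
  destruct k as [|[|k]]; [lia|lia|].
  assert (E3 : P1 + P1 + P1 = pc (fcst 3)).
  { unfold P1. rewrite <- !pc_add. f_equal. fa_ext. ring. }
  rewrite E3, padd_k, pc_mul_k, <- pc_mul, pc_mul_k, eps_mul_S, (pm_pc dc isder_dc).
  change (pc (dc fu) (S k)) with f0. evs. unfold Op.
  rewrite (ev_Op_pow (S (S k)) 1 cB fu 1); [| |exact Hu].
  - pose proof (rf_fact 0 (S (S k))) as F. rewrite Nat.add_0_l in F. change (INR (fact 0)) with 1%R in F.
    rewrite Rmult_1_l in F. rewrite F. unfold cB.
    assert (Hf := INR_fact_neq_0 (S (S k))).
    assert (Hf' : RtoC (INR (fact (S (S k)))) <> 0%C) by (intros E; apply RtoC_inj in E; contradiction).
    rewrite RtoC_div by exact Hf. change (1 + S (S k))%nat with (S (S (S k))). field. exact Hf'.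
  - intros v Hv. rewrite ev_u by (now apply ok1). simpl. ring.
Qed.

Lemma ev_ro_1 k (u : C) : (1 <= k)%nat -> u <> 0%C -> ev (ro k) u 1 = 0%C /\ ev (dc (ro k)) u 1 = 0%C.
Proof.
  intros Hk Hu.
  assert (H : e1 (ro k) f0).
  { intros v Hv. assert (Ho := ok1 v Hv). rewrite ev_cst by exact Ho.
    pose proof (E1_ro_DC k v Hv) as E. rewrite psub_k in E. destruct k as [|k]; [lia|].
    change (Ui (S k)) with f0 in E. change (P0 (S k)) with f0 in E.
    rewrite ev_sub, ev_cst in E by exact Ho. rewrite <- E. ring. }
  assert (Ho := ok1 u Hu). split.
  - rewrite H by exact Hu. now apply ev_cst.
  - apply e1_dc in H. rewrite H by exact Hu. rewrite (der_cst dc isder_dc). now apply ev_cst.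
Qed.

Lemma ev_Phi_1 k (u : C) : (2 <= k)%nat -> u <> 0%C ->
  ev (Phi k) u 1 = (- (3 * bernoulli k * (- 1) ^ k / (INR k * INR (k - 1)) * u ^ (k - 1)))%C.
Proof.
  intros Hk Hu. assert (Ho := ok1 u Hu). destruct (ev_ro_1 k u) as [R1 R2]; [lia|exact Hu|].
  unfold Phi, Xk, cA. evs. rewrite R1, R2, ev_VV_1 by assumption.
  (* Only the term c^2 * [VV k] survives in [Phi k], and c^2 = u^(-2) takes away two powers of u. *)
  replace (S k) with (2 + (k - 1))%nat by lia. rewrite Cpow_add_r.
  assert (N1 : RtoC (INR k) <> 0%C) by (apply INRC_neq; lia).
  assert (N2 : RtoC (INR (k - 1)) <> 0%C) by (apply INRC_neq; lia).
  simpl (u ^ 2)%C. field. repeat split; assumption.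
Qed.

(** * Restriction to a path *)

Open Scope C_scope.

Lemma C_eq_dec (z : C) : z = 0 \/ z <> 0.
Proof. destruct (Ceq_dec z 0); [now left|now right]. Qed.
Lemma Cinv_neq_0 (z : C) : z <> 0 -> / z <> 0.
Proof.
  intros H E. pose proof (Cinv_r z H) as K. rewrite E, Cmult_0_r in K. apply RtoC_inj in K. lra.
Qed.
Lemma csum_gsum f n : csum f n = gsum Cplus f n.
Proof. induction n as [|n IH]; simpl; [reflexivity|]. now rewrite IH. Qed.
Lemma cprod_smul : cprod = smul.
Proof. extensionality a; extensionality b; extensionality k. apply csum_gsum. Qed.
Lemma cprod_ext a a' b b' n : agree n a a' -> agree n b b' -> cprod a b n = cprod a' b' n.
Proof. intros H K. rewrite cprod_smul. apply (agree_mul Cplus Cmult n a a' b b' H K n). lia. Qed.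
Lemma cprod_agree a a' b b' n : agree n a a' -> agree n b b' -> agree n (cprod a b) (cprod a' b').
Proof. intros H K j Hj. apply cprod_ext; intros i Hi; [apply H|apply K]; lia. Qed.
Lemma cprod_scal_l z a b k : cprod (fun i => z * a i) b k = z * cprod a b k.
Proof.
  rewrite cprod_smul. exact (f_equal (fun f => f k) (gmul_scal _ _ _ _ _ _ C_ring_theory z a b)).
Qed.
Lemma cprod_comm a b : cprod a b = cprod b a.
Proof. rewrite cprod_smul. apply (gmul_comm _ _ _ _ _ _ C_ring_theory). Qed.
Lemma cprod_scal_r z a b k : cprod a (fun i => z * b i) k = z * cprod a b k.
Proof. rewrite cprod_comm, cprod_scal_l, cprod_comm. reflexivity. Qed.
Lemma cprod_top a a' b b' n :
  (forall j, (j <= n)%nat -> a j = a' j) -> (forall j, (j <= n)%nat -> b j = b' j) ->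
  cprod a b (S n) - cprod a' b' (S n) = a O * (b (S n) - b' (S n)) + (a (S n) - a' (S n)) * b O.
Proof.
  intros H K. rewrite cprod_smul.
  apply (gmul_top _ _ _ _ _ _ C_ring_theory); intros j Hj; [apply H|apply K]; lia.
Qed.

Lemma der_uniq_01 (f g : R -> C) (s : R) (a b : C) :
  (forall x, (0 < x < 1)%R -> f x = g x) -> (0 < s < 1)%R ->
  is_derive f s a -> is_derive g s b -> a = b.
Proof.
  intros H Hs Hf Hg. refine (is_derive_C_uniq g s _ _ _ Hg).
  apply (is_derive_ext_loc (V := CN)) with (2 := Hf).
  apply (locally_interval _ s 0 1); [exact (proj1 Hs)|exact (proj2 Hs)|].
  intros x Hx1 Hx2. apply H. split; assumption.
Qed.

Definition lam : PS := (pc tA * kap)%ps.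
(** This is eps t R: the first two terms are eps theta log lambda, as lambda = t kap. *)
Definition Rf (r : PS) : PS := (eps + ppi + r)%ps.

Lemma ps_shift2 (f : PS) m : (eps * eps * f)%ps m = match m with S (S j) => f j | _ => fcst 0 end.
Proof.
  replace (eps * eps * f)%ps with (eps * (eps * f))%ps by ring.
  destruct m as [|[|m]]; [apply eps_mul_0|rewrite eps_mul_S; apply eps_mul_0|now rewrite !eps_mul_S].
Qed.
Lemma evp_shift2 u y (f : PS) m : ok u y -> evp u y (eps * eps * f)%ps m = shift2 (evp u y f) m.
Proof.
  intros Ho. unfold evp. rewrite ps_shift2. destruct m as [|[|m]]; simpl; try apply ev_cst; trivial.
Qed.
Lemma evp_shift1 u y (f : PS) : ok u y -> evp u y (eps * f)%ps = shift1 (evp u y f).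
Proof.
  intros Ho. extensionality m. unfold evp. destruct m as [|m]; cbn [shift1].
  - rewrite eps_mul_0. now apply ev_cst.
  - now rewrite eps_mul_S.
Qed.
Lemma evp_kron u y m : ok u y -> evp u y P1 m = kron0 m.
Proof. intros Ho. destruct m; apply ev_cst, Ho. Qed.

Lemma TH_lam : TH lam = (lam + pc tA * TH kap)%ps.
Proof. unfold lam. rewrite TH_mul, TH_t. ring. Qed.

(** Returns to the Riccati equation for R itself, times (eps lambda)^2; [TH (Rf r) - Rf r] arises
    from t^2 d/dt (f / t) = (theta - 1) f. *)
Lemma Rf_eq r : (eps * TH r + r * r)%ps = QQ ->
  (kap * kap * (Rf r * Rf r) + kap * kap * (eps * (TH (Rf r) - Rf r)))%ps =
  ((kap * (kap + TH kap) + kap * (kap + TH kap) - kap * kap) * (eps * Rf r)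
   - (t2 + t2) * (kap * kap * kap) + P1 - eps * eps * ((kap + TH kap) * (kap + TH kap)))%ps.
Proof.
  intros Hr. assert (HQ : QQ = (- (t2 * kap) - cc * alp + (P1 + P1) * (alp * alp))%ps) by reflexivity.
  assert (Hk := kap_alp). assert (Hp := epsTH_ppi).
  assert (Hpi : (ppi * kap)%ps = (eps * TH kap)%ps) by (unfold ppi; lin (eps * TH kap * dif Hk)%ps).
  unfold Rf. rewrite !TH_add, TH_eps.
  lin (kap * kap * (dif Hr + dif HQ + dif Hp) + dif Hk * (kap * alp + P1)
    + dif Hpi * ((P1 + P1) * kap * (eps + ppi + r) - (P1 + P1) * (eps * kap + ppi * kap) + dif Hpi))%ps.
Qed.

Fixpoint fpow (f : FA) (n : nat) : FA := match n with O => fcst 1 | S m => fmul f (fpow f m) end.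
Lemma ev_fpow f n u y : ok u y -> ev (fpow f n) u y = (ev f u y) ^ n.
Proof.
  intros H; induction n as [|n IH]; cbn [fpow]; [now apply ev_cst|].
  rewrite ev_mul, IH by exact H. reflexivity.
Qed.
Lemma D1_fpow_ui n : D1 (fpow fui n) = (fcst (- INR n) * fpow fui n)%fa.
Proof.
  induction n as [|n IH]; cbn [fpow].
  - rewrite D1_cst. fa_ext. simpl. ring.
  - rewrite D1_mul, D1_ui, IH. rewrite S_INR. fa_ext. rewrite RtoC_plus. ring.
Qed.

Lemma const_seg (f : FA) (p q y : C) : D1 f = fcst 0 -> ok 1 y ->
  (forall x : R, (0 <= x <= 1)%R -> p + RtoC x * (q - p) <> 0) -> ev f p y = ev f q y.
Proof.
  intros HD (_ & Hy & Hz) Hs.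
  assert (E : ev f (p + RtoC 0 * (q - p)) y = ev f (p + RtoC 1 * (q - p)) y).
  { apply (eq_is_derive (V := CN) (fun x : R => ev f (p + RtoC x * (q - p)) y) 0 1); [|lra].
    intros x Hx. assert (Ho : ok (p + RtoC x * (q - p)) y) by (split; [now apply Hs|split; assumption]).
    apply (is_derive_C_eq _ _ _ _ (ev_derive f (fun x : R => p + RtoC x * (q - p)) (fun _ => y) x _ _ Ho
      (is_derive_line p (q - p) x) (is_derive_C_const y x))).
    rewrite HD, ev_cst by exact Ho. transitivity (RtoC 0); [ring|reflexivity]. }
  transitivity (ev f (p + RtoC 0 * (q - p)) y); [f_equal; ring|]. rewrite E. f_equal; ring.
Qed.

(* The punctured plane is connected: join 1 to u by a segment, or through i if u is real. *)
Lemma ev_indep_u (f : FA) (u y : C) : D1 f = fcst 0 -> ok u y -> ev f u y = ev f 1 y.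
Proof.
  intros HD (Hu & Hy & Hz).
  assert (Ho : ok 1 y) by (split; [intros E; apply RtoC_inj in E; lra|split; assumption]).
  assert (Hi : ev f Ci y = ev f 1 y).
  { apply const_seg; [exact HD|exact Ho|]. intros x Hx E.
    pose proof (f_equal Re E) as E1. pose proof (f_equal Im E) as E2. simpl in E1, E2. lra. }
  destruct (Req_dec (Im u) 0) as [K|K].
  - rewrite <- Hi. apply const_seg; [exact HD|exact Ho|]. intros x Hx E.
    pose proof (f_equal Re E) as E1. pose proof (f_equal Im E) as E2. simpl in E1, E2.
    unfold Im in K. rewrite K in E1, E2. assert (Ex : (x = 0)%R) by lra. subst x.
    apply Hu. apply injective_projections; simpl; lra.
  - apply const_seg; [exact HD|exact Ho|]. intros x Hx E.
    pose proof (f_equal Re E) as E1. pose proof (f_equal Im E) as E2. simpl in E1, E2. unfold Im in K.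
    assert (Ex : (x = 1)%R).
    { assert (((1 - x) * snd u = 0)%R) by nra. apply Rmult_integral in H. destruct H; [lra|contradiction]. }
    subst x. apply Hu. apply injective_projections; simpl; lra.
Qed.

(** The product of [Phi k] with u^(1 - k) has degree 0, hence does not depend on u. The power is
    split off because the value u = 0 at infinity lies outside [ok]. *)
Lemma Phi_scale k u y : (1 <= k)%nat -> ok u y -> ev (Phi k) u y = u ^ (k - 1) * ev (Phi k) 1 y.
Proof.
  intros Hk Ho.
  assert (Ho1 : ok 1 y) by (split; [intros E; apply RtoC_inj in E; lra|apply Ho]).
  assert (HD : D1 (fpow fui (k - 1) * Phi k)%fa = fcst 0).
  { rewrite D1_mul, D1_fpow_ui, D1_Phi by exact Hk. fa_ring. }
  pose proof (ev_indep_u _ u y HD Ho) as E.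
  rewrite !ev_mul, !ev_fpow, !ev_ui in E by assumption.
  assert (Eu : u ^ (k - 1) * (/ u) ^ (k - 1) = 1).
  { rewrite <- Cpow_mult_l, Cinv_r by apply Ho. apply Cpow_1_l. }
  assert (E1' : (/ 1) ^ (k - 1) = 1).
  { replace (/ 1) with (RtoC 1) by (field). apply Cpow_1_l. }
  rewrite E1' in E.
  transitivity (u ^ (k - 1) * (/ u) ^ (k - 1) * ev (Phi k) u y); [rewrite Eu; ring|].
  transitivity (u ^ (k - 1) * ((/ u) ^ (k - 1) * ev (Phi k) u y)); [ring|]. rewrite E. ring.
Qed.

(** [rp] is minus the image of [rm] under eps -> -eps, so the two coincide in odd orders. *)
Lemma ro_odd k : Nat.even k = false -> ro k = fcst 0.
Proof.
  intros H. unfold ro. rewrite pc_mul_k, psub_k. unfold rp. rewrite popp_k. unfold star, sg.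
  assert (E : (- 1) ^ k = - (1)).
  { assert (Hk : exists m, k = S (2 * m)).
    { assert (Ho : Nat.Odd k) by (apply Nat.odd_spec; unfold Nat.odd; now rewrite H).
      destruct Ho as [m Hm]. exists m. lia. }
    destruct Hk as [m ->]. simpl Cpow. clear H. induction m as [|m IH]; [simpl; ring|].
    replace (S m + (S m + 0))%nat with (S (S (m + (m + 0)))) by lia.
    simpl Cpow. rewrite IH. ring. }
  rewrite E. fa_ring.
Qed.

Section Path.
Context (c : C) (Hc : c <> 0) (gam gam' : R -> C) (L L1 L2 P P1' M M1 : nat -> R -> C)
  (HP : path_data c gam gam' L L1 L2 P P1' M M1).
Local Notation I01 s := (0 < s < 1)%R.

Lemma pd_gam s : I01 s -> is_derive gam s (gam' s). Proof. intros H; apply (HP s H). Qed.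
Lemma pd_gamc s : I01 s -> continuous gam' s. Proof. intros H; apply (HP s H). Qed.
Lemma pd_gam1 s : I01 s -> gam' s <> 0. Proof. intros H; apply (HP s H). Qed.
Lemma pd_gam0 s : I01 s -> gam s <> 0. Proof. intros H; apply (HP s H). Qed.
Lemma pd_L0 s : I01 s -> L O s <> 0. Proof. intros H; apply (HP s H). Qed.
Lemma pd_F s : I01 s -> F_D7 c (L O s) (gam s) = 0. Proof. intros H; apply (HP s H). Qed.
Lemma pd_dF s : I01 s -> dF_D7 (L O s) (gam s) <> 0. Proof. intros H; apply (HP s H). Qed.
Lemma pd_L s k : I01 s -> is_derive (L k) s (L1 k s * gam' s). Proof. intros H; apply (HP s H). Qed.
Lemma pd_L1 s k : I01 s -> is_derive (L1 k) s (L2 k s * gam' s). Proof. intros H; apply (HP s H). Qed.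
Lemma pd_P s k : I01 s -> is_derive (P k) s (P1' k s * gam' s). Proof. intros H; apply (HP s H). Qed.
Lemma pd_M s k : I01 s -> is_derive (M k) s (M1 k s * gam' s). Proof. intros H; apply (HP s H). Qed.
Lemma pd_PIII s m : I01 s ->
  PIII_coef_eq c (gam s) (fun k => L k s) (fun k => L1 k s) (fun k => L2 k s) m.
Proof. intros H; apply (HP s H). Qed.
Lemma pd_RP s m : I01 s ->
  Riccati_coef_eq (gam s) (fun k => L k s) (fun k => L1 k s) (fun k => P k s) (fun k => P1' k s) m.
Proof. intros H; apply (HP s H). Qed.
Lemma pd_RM s m : I01 s ->
  Riccati_coef_eq (gam s) (fun k => L k s) (fun k => L1 k s) (fun k => M k s) (fun k => M1 k s) m.
Proof. intros H; apply (HP s H). Qed.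
Lemma pd_M0 s : I01 s -> M O s = - P O s. Proof. intros H; apply (HP s H). Qed.

Definition uu (s : R) : C := L O s / gam s.
Definition vv (s : R) : C := L O s * P O s.
Definition yy (s : R) : C := / vv s.

Lemma F_uu s : I01 s -> c * uu s = 1 + 2 * gam s * uu s * uu s * uu s.
Proof.
  intros H. pose proof (pd_F s H) as E. pose proof (pd_gam0 s H). pose proof (pd_L0 s H).
  unfold F_D7 in E. unfold uu.
  assert (E2 : L O s * (- 2 * L O s * L O s / (gam s * gam s) + c / gam s - / L O s) = 0) by (rewrite E; ring).
  transitivity (L O s * (- 2 * L O s * L O s / (gam s * gam s) + c / gam s - / L O s)
     + (1 + 2 * gam s * (L O s / gam s) * (L O s / gam s) * (L O s / gam s))).
  - field; split; assumption.
  - rewrite E2; ring.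
Qed.
(** The Riccati equation at order zero says that P_0 is a square root of Delta. *)
Lemma vv_sq s : I01 s -> vv s * vv s = 1 - 4 * gam s * uu s * uu s * uu s.
Proof.
  intros H. pose proof (pd_RP s O H) as E. unfold Riccati_coef_eq in E.
  unfold cprod, shift1, shift2, kron0 in E; simpl in E. unfold vv, uu.
  pose proof (pd_gam0 s H). 
  transitivity (L O s * L O s * (P O s * P O s) + L O s * L O s * 0); [ring|]. rewrite E. field. assumption.
Qed.
Lemma vv_dF s : I01 s -> vv s * vv s = L O s * L O s * dF_D7 (L O s) (gam s).
Proof.
  intros H. rewrite vv_sq by exact H. pose proof (pd_gam0 s H). pose proof (pd_L0 s H).
  unfold dF_D7, uu. field. split; assumption.
Qed.
Lemma vv_0 s : I01 s -> vv s <> 0.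
Proof.
  intros H E. pose proof (vv_dF s H) as K. rewrite E in K.
  apply (Cmult_neq_0 (L O s * L O s) (dF_D7 (L O s) (gam s))).
  - apply Cmult_neq_0; now apply pd_L0.
  - now apply pd_dF.
  - rewrite <- K; ring.
Qed.
Lemma P0_0 s : I01 s -> P O s <> 0.
Proof. intros H E. apply (vv_0 s H). unfold vv; rewrite E; ring. Qed.
Lemma uu_0 s : I01 s -> uu s <> 0.
Proof.
  intros H. unfold uu, Cdiv. apply Cmult_neq_0; [now apply pd_L0|]. apply Cinv_neq_0. now apply pd_gam0.
Qed.
Lemma yy_0 s : I01 s -> yy s <> 0.
Proof. intros H. apply Cinv_neq_0. now apply vv_0. Qed.
Lemma vv_neq1 s : I01 s -> vv s * vv s <> 1.
Proof.
  intros H E. rewrite vv_sq in E by exact H.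
  assert (K : (4 * gam s * uu s * uu s * uu s = 0)) by (transitivity (1 - (1 - 4 * gam s * uu s * uu s * uu s)); [ring|rewrite E; ring]).
  revert K. pose proof (uu_0 s H).
  do 3 (apply Cmult_neq_0; [|assumption]). apply Cmult_neq_0; [|now apply pd_gam0].
  intros K; apply RtoC_inj in K; lra.
Qed.
Lemma uy_ok s : I01 s -> ok (uu s) (yy s).
Proof.
  intros H. split; [now apply uu_0|split; [now apply yy_0|]]. intros E.
  apply (vv_neq1 s H). pose proof (vv_0 s H). unfold yy in E.
  assert (K : vv s = - (1)).
  { transitivity (vv s * (1 + / vv s) - 1); [field; assumption|rewrite E; ring]. }
  rewrite K; ring.
Qed.
Lemma uy_ok' s : I01 s -> ok (uu s) (- yy s).
Proof.
  intros H. split; [now apply uu_0|split].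
  - intros E. apply (yy_0 s H). transitivity (- - yy s); [ring|rewrite E; ring].
  - intros E. apply (vv_neq1 s H). pose proof (vv_0 s H). unfold yy in E.
    assert (K : vv s = 1).
    { transitivity (vv s * (1 + - / vv s) + 1); [field; assumption|rewrite E; ring]. }
    rewrite K; ring.
Qed.
Definition eu (s : R) (f : FA) : C := ev f (uu s) (yy s).
Lemma eu_t s : I01 s -> eu s tA = gam s.
Proof.
  intros H. pose proof (uy_ok s H). unfold eu, tA. evs. pose proof (vv_sq s H) as E.
  pose proof (uu_0 s H). pose proof (vv_0 s H). unfold yy in *.
  transitivity ((1 - vv s * vv s) / (4 * uu s * uu s * uu s)); [field; repeat split; assumption|].
  rewrite E. field. assumption.
Qed.
Lemma vv_c s : I01 s -> vv s * vv s = 3 - 2 * c * uu s.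
Proof.
  intros H. rewrite vv_sq by exact H. 
  transitivity (3 - 2 * (1 + 2 * gam s * uu s * uu s * uu s)); [ring|]. rewrite <- (F_uu s H). ring.
Qed.
Lemma eu_c s : I01 s -> eu s cA = c.
Proof.
  intros H. pose proof (uy_ok s H). unfold eu, cA. evs. pose proof (vv_c s H) as E.
  pose proof (uu_0 s H). pose proof (vv_0 s H). unfold yy in *.
  transitivity ((3 - vv s * vv s) / (2 * uu s)); [field; split; assumption|].
  rewrite E. field. assumption.
Qed.

Lemma is_derive_C_div (f : R -> C) (x : R) (l : C) (g : R -> C) (m : C) :
  is_derive f x l -> is_derive g x m -> g x <> 0 ->
  is_derive (fun s => f s / g s) x (l / g x - f x * m / (g x * g x)).
Proof.
  intros Hf Hg Hn. apply (is_derive_C_eq _ _ _ _ (is_derive_C_mult _ _ _ _ _ Hf (is_derive_C_inv _ _ _ Hg Hn))).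
  field; assumption.
Qed.

Lemma uu_derive s : I01 s -> is_derive uu s (eu s (th fu) * (gam' s / gam s)).
Proof.
  intros H.
  pose proof (is_derive_C_div _ _ _ _ _ (pd_L s O H) (pd_gam s H) (pd_gam0 s H)) as D.
  set (d := L1 O s * gam' s / gam s - L O s * gam' s / (gam s * gam s)) in D.
  change (is_derive uu s d) in D.
  apply (is_derive_C_eq _ _ _ _ D).
  (* Implicit differentiation of [F_uu], as [d] is otherwise known only through [L1 0]. By [E2] the
     factor of [d] is v^2 / u, which is nonzero away from the turning points. *)
  assert (E : d * (c - 6 * gam s * uu s * uu s) = 2 * gam' s * uu s * uu s * uu s).
  { assert (Z : c * d - (2 * (gam' s * (uu s * uu s * uu s) + gam s * (d * (uu s * uu s) + uu s * (d * uu s + uu s * d)))) = 0).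
    { apply (der_uniq_01 (fun s => c * uu s + -2 * (gam s * (uu s * (uu s * uu s)))) (fun _ => 1) s _ _); [|exact H| |apply is_derive_C_const].
      - intros x Hx. rewrite (F_uu x Hx). ring.
      - apply (is_derive_C_eq _ _ (0 * uu s + c * d + (0 * (gam s * (uu s * (uu s * uu s)))
          + -2 * (gam' s * (uu s * (uu s * uu s)) + gam s * (d * (uu s * uu s) + uu s * (d * uu s + uu s * d)))))); [|ring].
        exact (is_derive_C_plus _ _ s _ _ (is_derive_C_mult _ _ s _ _ (is_derive_C_const c s) D)
          (is_derive_C_mult _ _ s _ _ (is_derive_C_const (-2) s)
          (is_derive_C_mult _ _ s _ _ (pd_gam s H) (is_derive_C_mult _ _ s _ _ D
            (is_derive_C_mult _ _ s _ _ D D))))). }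
    transitivity (c * d - (2 * (gam' s * (uu s * uu s * uu s) + gam s * (d * (uu s * uu s) + uu s * (d * uu s + uu s * d))))
      + 2 * gam' s * uu s * uu s * uu s); [ring|rewrite Z; ring]. }
  pose proof (uy_ok s H) as Ho. pose proof (uu_0 s H) as Hu. pose proof (vv_0 s H) as Hv. pose proof (pd_gam0 s H) as Hg.
  assert (E2 : uu s * (c - 6 * gam s * uu s * uu s) = vv s * vv s).
  { rewrite vv_sq by exact H. transitivity (c * uu s - 6 * gam s * uu s * uu s * uu s); [ring|].
    rewrite F_uu by exact H. ring. }
  assert (E3 : eu s (th fu) = uu s * (1 - vv s * vv s) / (2 * (vv s * vv s))).
  { rewrite th_u. unfold eu, hA. evs. unfold yy. field. exact Hv. }
  rewrite E3.
  transitivity (uu s * (d * (c - 6 * gam s * uu s * uu s)) / (vv s * vv s)).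
  - rewrite <- E2. field. split; [|exact Hu]. intros K. rewrite K in E2.
    apply (Cmult_neq_0 _ _ Hv Hv). rewrite <- E2; ring.
  - rewrite E. rewrite (vv_sq s H) at 2. field. split; assumption.
Qed.
Lemma yy_derive s : I01 s -> is_derive yy s (eu s (th fy) * (gam' s / gam s)).
Proof.
  intros H.
  pose proof (is_derive_C_mult _ _ _ _ _ (pd_L s O H) (pd_P s O H)) as D.
  set (d := L1 O s * gam' s * P O s + L O s * (P1' O s * gam' s)) in D.
  change (is_derive vv s d) in D.
  pose proof (is_derive_C_inv _ _ _ D (vv_0 s H)) as DI. change (is_derive yy s (- d / (vv s * vv s))) in DI.
  apply (is_derive_C_eq _ _ _ _ DI).
  pose proof (uy_ok s H) as Ho. pose proof (uu_0 s H) as Hu. pose proof (vv_0 s H) as Hv. pose proof (pd_gam0 s H) as Hg.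
  set (e := eu s (th fu) * (gam' s / gam s)).
  assert (Z : d * vv s + vv s * d = 0 + -2 * (0 * uu s + c * e)).
  { apply (der_uniq_01 (fun s => vv s * vv s) (fun s => 3 + -2 * (c * uu s)) s); [|exact H| |].
    - intros x Hx. rewrite (vv_c x Hx). ring.
    - exact (is_derive_C_mult _ _ s _ _ D D).
    - apply (is_derive_C_eq _ _ (0 + (0 * (c * uu s) + -2 * (0 * uu s + c * e)))); [|ring].
      exact (is_derive_C_plus _ _ s _ _ (is_derive_C_const 3 s) (is_derive_C_mult _ _ s _ _ (is_derive_C_const (-2) s)
        (is_derive_C_mult _ _ s _ _ (is_derive_C_const c s) (uu_derive s H)))). }
  assert (E3 : eu s (th fu) = uu s * (1 - vv s * vv s) / (2 * (vv s * vv s))).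
  { rewrite th_u. unfold eu, hA. evs. unfold yy. field. exact Hv. }
  assert (E4 : eu s (th fy) = (1 - vv s * vv s) * (3 - vv s * vv s) / (4 * vv s * vv s * vv s * vv s * vv s)).
  { replace (th fy) with qA by ff. unfold eu, qA. evs. unfold yy. field. exact Hv. }
  unfold e in Z. rewrite E3 in Z. rewrite E4.
  assert (Ec : 3 - vv s * vv s = 2 * c * uu s) by (rewrite (vv_c s H); ring).
  rewrite Ec.
  transitivity (- (d * vv s + vv s * d) / (2 * vv s * vv s * vv s)); [field; exact Hv|].
  rewrite Z. field. split; assumption.
Qed.
Lemma eu_derive s (f : FA) : I01 s -> is_derive (fun x => eu x f) s (eu s (th f) * (gam' s / gam s)).
Proof.
  intros H. pose proof (uy_ok s H) as Ho.
  apply (is_derive_C_eq _ _ _ _ (ev_derive f uu yy s _ _ Ho (uu_derive s H) (yy_derive s H))).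
  replace (th fy) with qA by ff. rewrite th_u. unfold eu. unfold th at 1. rewrite ev_add, !ev_mul, ev_u by exact Ho.
  destruct Ho as (Hu & _ & _). pose proof (pd_gam0 s H). field. split; assumption.
Qed.

Lemma eu_add s f g m : I01 s -> eu s ((f + g)%ps m) = eu s (f m) + eu s (g m).
Proof. intros H. apply ev_add. now apply uy_ok. Qed.
Lemma eu_sub s f g m : I01 s -> eu s ((f - g)%ps m) = eu s (f m) - eu s (g m).
Proof. intros H. apply ev_sub. now apply uy_ok. Qed.
Lemma eu_opp s f m : I01 s -> eu s ((- f)%ps m) = - eu s (f m).
Proof. intros H. apply ev_opp. now apply uy_ok. Qed.
Lemma eu_pct s f m : I01 s -> eu s ((pc tA * f)%ps m) = gam s * eu s (f m).
Proof. intros H. rewrite pc_mul_k. unfold eu at 1. rewrite ev_mul by (now apply uy_ok). now rewrite <- (eu_t s H). Qed.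
Lemma eu_pcc s f m : I01 s -> eu s ((cc * f)%ps m) = c * eu s (f m).
Proof.
  intros H. rewrite pc_mul_k. unfold eu at 1. rewrite ev_mul by (now apply uy_ok).
  change (eu s cA * eu s (f m) = c * eu s (f m)). now rewrite (eu_c s H).
Qed.
Lemma eu_cprod s f g : I01 s ->
  cprod (fun k => eu s (f k)) (fun k => eu s (g k)) = fun m => eu s ((f * g)%ps m).
Proof. intros H. rewrite cprod_smul. symmetry. exact (evp_mul _ _ (uy_ok s H) f g). Qed.
Lemma shift1_scal z f k : shift1 (fun i => z * f i) k = z * shift1 f k.
Proof. destruct k; simpl; ring. Qed.
Lemma shift2_scal z f k : shift2 (fun i => z * f i) k = z * shift2 f k.
Proof. destruct k as [|[|k]]; simpl; ring. Qed.
Lemma shift2_ext f g m : (forall k, f k = g k) -> shift2 f m = shift2 g m.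
Proof. intros H; destruct m as [|[|m]]; simpl; trivial. Qed.
Lemma eu_eps s f : I01 s -> shift1 (fun k => eu s (f k)) = fun m => eu s ((eps * f)%ps m).
Proof. intros H. symmetry. exact (evp_shift1 _ _ f (uy_ok s H)). Qed.
Lemma eu_eps2 s f m : I01 s -> shift2 (fun k => eu s (f k)) m = eu s ((eps * eps * f)%ps m).
Proof. intros H. symmetry. exact (evp_shift2 _ _ f m (uy_ok s H)). Qed.
Lemma eu_kron s m : I01 s -> eu s (P1 m) = kron0 m.
Proof. intros H. exact (evp_kron _ _ m (uy_ok s H)). Qed.

(** These encode d/dt = theta / t and d^2/dt^2 = (theta^2 - theta) / t^2. *)
Definition l1s (s : R) (f : PS) (k : nat) : C := / gam s * eu s (TH f k).
Definition l2s (s : R) (f : PS) (k : nat) : C := / (gam s * gam s) * eu s ((TH (TH f) - TH f)%ps k).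

Lemma formal_PIII s m : I01 s ->
  PIII_coef_eq c (gam s) (fun k => eu s (lam k)) (l1s s lam) (l2s s lam) m.
Proof.
  intros H. unfold PIII_coef_eq. pose proof (pd_gam0 s H) as Ht.
  set (K := (kap * TH (TH kap) - TH kap * TH kap)%ps).
  rewrite (shift2_ext _ (fun k => eu s (K k))).
  - rewrite eu_eps2 by exact H. unfold K. rewrite kap_PIII.
    rewrite !(eu_cprod s _ _ H).
    replace (lam * (lam * lam))%ps with (pc tA * (pc tA * (pc tA * (kap * kap * kap))))%ps by (unfold lam; ring).
    rewrite !(eu_pct s _ _ H).
    replace (- (t2 * (kap * kap * kap)) + cc * kap - P1)%ps
      with (- (pc tA * (kap * kap * kap)) - pc tA * (kap * kap * kap) + cc * kap - P1)%ps by ring.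
    rewrite eu_sub, eu_add, eu_sub, eu_opp, !eu_pct, eu_pcc, eu_kron by exact H.
    unfold lam at 1. rewrite eu_pct by exact H. field. exact Ht.
  - intros k. unfold l1s, l2s. rewrite !cprod_scal_l, !cprod_scal_r, !(eu_cprod s _ _ H).
    transitivity (/ (gam s * gam s) * eu s ((lam * (TH (TH lam) - TH lam) - TH lam * TH lam + lam * TH lam)%ps k)).
    + rewrite eu_add, eu_sub by exact H. field. exact Ht.
    + replace (lam * (TH (TH lam) - TH lam) - TH lam * TH lam + lam * TH lam)%ps with (pc tA * (pc tA * K))%ps.
      * rewrite !eu_pct by exact H. field. exact Ht.
      * rewrite !TH_lam, TH_add, TH_lam, TH_mul, TH_t. unfold K, lam. ring.
Qed.

Lemma formal_Riccati s r m : I01 s -> (eps * TH r + r * r)%ps = QQ ->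
  Riccati_coef_eq (gam s) (fun k => eu s (lam k)) (l1s s lam)
    (fun k => / gam s * eu s (Rf r k)) (fun k => / (gam s * gam s) * eu s ((TH (Rf r) - Rf r)%ps k)) m.
Proof.
  intros H Hr. unfold Riccati_coef_eq. pose proof (pd_gam0 s H) as Ht.
  pose proof (Rf_eq r Hr) as E. set (q := Rf r) in *. clearbody q.
  assert (Es : forall z f, shift1 (fun k => z * f k) = fun k => z * shift1 f k) by (intros; extensionality k; apply shift1_scal).
  rewrite !Es, !(eu_eps s _ H), !(eu_cprod s _ _ H).
  assert (Epp : cprod (fun k => / gam s * eu s (q k)) (fun k => / gam s * eu s (q k)) =
     fun k => / (gam s * gam s) * eu s ((q * q)%ps k)).
  { extensionality k. rewrite cprod_scal_l, cprod_scal_r, (eu_cprod s _ _ H). field. exact Ht. }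
  assert (Ell : (fun k => 2 * cprod (fun k => eu s (lam k)) (l1s s lam) k - eu s ((lam * lam)%ps k) / gam s) =
     fun k => / gam s * eu s ((lam * TH lam + lam * TH lam - lam * lam)%ps k)).
  { extensionality k. unfold l1s. rewrite cprod_scal_r, (eu_cprod s _ _ H), eu_sub, eu_add by exact H. field. exact Ht. }
  rewrite Epp, Ell. rewrite !cprod_scal_r, cprod_scal_l, !(eu_cprod s _ _ H).
  rewrite (shift2_ext (cprod (l1s s lam) (l1s s lam)) (fun k => / (gam s * gam s) * eu s ((TH lam * TH lam)%ps k))).
  2:{ intros k. unfold l1s. rewrite cprod_scal_l, cprod_scal_r, (eu_cprod s _ _ H). field. exact Ht. }
  rewrite shift2_scal, eu_eps2 by exact H.
  replace (lam * lam * (q * q))%ps with (pc tA * (pc tA * (kap * kap * (q * q))))%ps by (unfold lam; ring).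
  replace (lam * lam * (eps * (TH q - q)))%ps with (pc tA * (pc tA * (kap * kap * (eps * (TH q - q)))))%ps by (unfold lam; ring).
  replace ((lam * TH lam + lam * TH lam - lam * lam) * (eps * q))%ps
    with (pc tA * (pc tA * ((kap * (kap + TH kap) + kap * (kap + TH kap) - kap * kap) * (eps * q))))%ps
    by (rewrite TH_lam; unfold lam; ring).
  replace (lam * (lam * lam))%ps with (pc tA * (pc tA * (pc tA * (kap * kap * kap))))%ps by (unfold lam; ring).
  replace (eps * eps * (TH lam * TH lam))%ps
    with (pc tA * (pc tA * (eps * eps * ((kap + TH kap) * (kap + TH kap)))))%ps by (rewrite TH_lam; unfold lam; ring).
  rewrite !eu_pct by exact H.
  assert (E3 := f_equal (fun h : PS => eu s (h m)) E). cbv beta in E3.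
  replace ((t2 + t2) * (kap * kap * kap))%ps with
    (pc tA * (kap * kap * kap) + pc tA * (kap * kap * kap) + pc tA * (kap * kap * kap) + pc tA * (kap * kap * kap))%ps in E3 by ring.
  rewrite eu_add, eu_sub, eu_add, eu_sub, !eu_add, !eu_pct, eu_kron in E3 by exact H.
  match type of E3 with ?a + ?b = ?x - ?y + ?k - ?z =>
    transitivity (a + b); [field; exact Ht|rewrite E3; field; exact Ht] end.
Qed.

Lemma l1s_0 s k : I01 s -> (forall x, I01 x -> L k x = eu x (lam k)) -> L1 k s = l1s s lam k.
Proof.
  intros H E. pose proof (der_uniq_01 _ _ s _ _ E H (pd_L s k H) (eu_derive s (lam k) H)) as K.
  pose proof (pd_gam1 s H) as H1. pose proof (pd_gam0 s H) as H0. unfold l1s.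
  transitivity (L1 k s * gam' s / gam' s); [field; exact H1|]. rewrite K. unfold pm. field. split; assumption.
Qed.
Lemma div_derive s f : I01 s ->
  is_derive (fun x => / gam x * eu x f) s (/ (gam s * gam s) * eu s (th f - f)%fa * gam' s).
Proof.
  intros H. pose proof (pd_gam0 s H) as H0.
  apply (is_derive_C_eq _ _ _ _ (is_derive_C_mult _ _ s _ _ (is_derive_C_inv _ _ _ (pd_gam s H) H0) (eu_derive s f H))).
  replace (eu s (th f - f)%fa) with (eu s (th f) - eu s f) by (symmetry; apply ev_sub; now apply uy_ok).
  field. exact H0.
Qed.
Lemma l2s_0 s k : I01 s -> (forall x, I01 x -> L k x = eu x (lam k)) -> L2 k s = l2s s lam k.
Proof.
  intros H E.
  assert (E1 : forall x, I01 x -> L1 k x = / gam x * eu x (th (lam k))) by (intros x Hx; now apply l1s_0).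
  pose proof (der_uniq_01 _ _ s _ _ E1 H (pd_L1 s k H) (div_derive s _ H)) as K.
  pose proof (pd_gam1 s H) as H1. pose proof (pd_gam0 s H) as H0. unfold l2s.
  transitivity (L2 k s * gam' s / gam' s); [field; exact H1|]. rewrite K.
  change ((TH (TH lam) - TH lam)%ps k) with (th (th (lam k)) - th (lam k))%fa. field. split; assumption.
Qed.

(** * Uniqueness of the formal solutions along the path *)

Lemma shift2_agree f g n : agree n f g -> shift2 f (S n) = shift2 g (S n).
Proof. intros H. destruct n as [|n]; simpl; [reflexivity|apply H; lia]. Qed.

(** The derivative terms lag two orders behind, so the coefficient of order n + 1 enters linearly.
    Its factor is the lambda-derivative of lambda F, which equals lambda_0 Delta because F vanishes
    at lambda_0. *)
Lemma PIII_uniq (t : C) (a a1 a2 b b1 b2 : nat -> C) n : t <> 0 -> a O <> 0 -> dF_D7 (a O) t <> 0 ->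
  agree n a b -> agree n a1 b1 -> agree n a2 b2 -> F_D7 c (a O) t = 0 ->
  PIII_coef_eq c t a a1 a2 (S n) -> PIII_coef_eq c t b b1 b2 (S n) -> a (S n) = b (S n).
Proof.
  intros Ht Ha HF A0 A1 A2 HF0 Ea Eb. unfold PIII_coef_eq in Ea, Eb.
  rewrite (shift2_agree _ (fun k => cprod b b2 k - cprod b1 b1 k + cprod b b1 k / t)) in Ea.
  2:{ intros j Hj. rewrite (cprod_agree a b a2 b2 n A0 A2 j Hj), (cprod_agree a1 b1 a1 b1 n A1 A1 j Hj),
        (cprod_agree a b a1 b1 n A0 A1 j Hj). reflexivity. }
  rewrite Ea in Eb. clear Ea.
  assert (T1 := cprod_top a b a b n A0 A0).
  assert (T2 := cprod_top a b (cprod a a) (cprod b b) n A0 (cprod_agree a b a b n A0 A0)).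
  change (cprod a a O) with (a O * a O) in T2. rewrite T1 in T2.
  set (d := a (S n) - b (S n)) in *. set (x := cprod a (cprod a a) (S n)) in *. set (z := cprod b (cprod b b) (S n)) in *.
  assert (Ex : x = z + 3 * (a O * a O) * d).
  { transitivity (z + (x - z)); [ring|]. rewrite T2. ring. }
  assert (Ed : a (S n) = b (S n) + d) by (unfold d; ring).
  rewrite Ex, Ed in Eb.
  assert (E0 : dF_D7 (a O) t * (a O * d) = 0).
  { unfold F_D7 in HF0. unfold dF_D7.
    transitivity ((-2 * z / (t * t) + c * b (S n) / t - kron0 (S n) -
       (-2 * z / (t * t) + c * b (S n) / t - kron0 (S n))) * -1
        + (dF_D7 (a O) t * (a O * d))); [unfold dF_D7; ring|].
    rewrite <- Eb at 1. unfold dF_D7.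
    transitivity (- (- 2 * a O * a O / (t * t) + c / t - / a O) * d).
    - field. split; assumption.
    - rewrite HF0. ring. }
  assert (Hd : d = 0).
  { destruct (C_eq_dec d) as [K|K]; [exact K|]. exfalso.
    revert E0. apply Cmult_neq_0; [exact HF|]. now apply Cmult_neq_0. }
  rewrite Ed, Hd. ring.
Qed.

(** The derivative and the linear term lag one order behind, and the new coefficient is multiplied
    by 2 lambda_0^2 P_0. *)
Lemma Riccati_uniq (t : C) (a a1 b b1 p p1 q q1 : nat -> C) n : a O <> 0 -> p O <> 0 ->
  (forall k, a k = b k) -> (forall k, a1 k = b1 k) -> agree n p q -> agree n p1 q1 ->
  Riccati_coef_eq t a a1 p p1 (S n) -> Riccati_coef_eq t b b1 q q1 (S n) -> p (S n) = q (S n).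
Proof.
  intros Ha Hp A0 A1 B0 B1 Ea Eb.
  assert (Ea0 : b = a) by (extensionality k; symmetry; apply A0).
  assert (Ea1 : b1 = a1) by (extensionality k; symmetry; apply A1). subst b b1.
  unfold Riccati_coef_eq in Ea, Eb.
  assert (S1 : agree (S n) (shift1 p) (shift1 q)) by (intros [|j] Hj; simpl; [reflexivity|apply B0; lia]).
  assert (S2 : agree (S n) (shift1 p1) (shift1 q1)) by (intros [|j] Hj; simpl; [reflexivity|apply B1; lia]).
  rewrite (cprod_ext (cprod a a) (cprod a a) (shift1 p1) (shift1 q1) (S n) (fun _ _ => eq_refl) S2) in Ea.
  rewrite (cprod_ext _ _ (shift1 p) (shift1 q) (S n) (fun _ _ => eq_refl) S1) in Ea.
  rewrite <- Eb in Ea.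
  assert (T1 := cprod_top p q p q n B0 B0).
  assert (T2 := cprod_top (cprod a a) (cprod a a) (cprod p p) (cprod q q) n (fun _ _ => eq_refl) (cprod_agree p q p q n B0 B0)).
  change (cprod a a O) with (a O * a O) in T2. rewrite T1 in T2.
  set (d := p (S n) - q (S n)) in *.
  assert (E0 : 2 * (a O * (a O * (p O * d))) = 0).
  { transitivity (a O * a O * (p O * d + d * p O) + (cprod a a (S n) - cprod a a (S n)) * cprod p p O); [ring|].
    rewrite <- T2. 
    match type of Ea with ?x + ?w = ?y + ?w => transitivity ((x + w) - (y + w)); [ring|rewrite Ea; ring] end. }
  assert (Hd : d = 0).
  { destruct (C_eq_dec d) as [K|K]; [exact K|]. exfalso.
    revert E0. apply Cmult_neq_0; [intros K2; apply RtoC_inj in K2; lra|]. repeat (apply Cmult_neq_0; trivial). }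
  transitivity (q (S n) + d); [unfold d; ring|rewrite Hd; ring].
Qed.

(** Coefficients that agree on the whole interval have equal t-derivatives, since gam' does not
    vanish; this supplies the lower derivatives that the recursion consumes. *)
Lemma L_id k : forall s, I01 s -> L k s = eu s (lam k).
Proof.
  induction k as [k IH] using lt_wf_ind. intros s H. destruct k as [|n].
  - unfold lam. rewrite eu_pct by exact H. rewrite kap_0. unfold eu. rewrite ev_u by (now apply uy_ok).
    unfold uu. field. now apply pd_gam0.
  - apply (PIII_uniq (gam s) (fun k => L k s) (fun k => L1 k s) (fun k => L2 k s)
      (fun k => eu s (lam k)) (l1s s lam) (l2s s lam) n).
    + now apply pd_gam0.
    + now apply pd_L0.
    + now apply pd_dF.
    + intros j Hj. apply IH; [lia|exact H].
    + intros j Hj. apply l1s_0; [exact H|]. apply IH; lia.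
    + intros j Hj. apply l2s_0; [exact H|]. apply IH; lia.
    + now apply pd_F.
    + now apply pd_PIII.
    + now apply formal_PIII.
Qed.

(** Only the leading coefficient distinguishes R_+ from R_-, so one induction serves both. *)
Lemma P_id r (p p1 : nat -> R -> C) : (eps * TH r + r * r)%ps = QQ ->
  (forall s k, I01 s -> is_derive (p k) s (p1 k s * gam' s)) ->
  (forall s m, I01 s -> Riccati_coef_eq (gam s) (fun k => L k s) (fun k => L1 k s) (fun k => p k s) (fun k => p1 k s) m) ->
  (forall s, I01 s -> p O s <> 0 /\ p O s = / gam s * eu s (r O)) ->
  forall k s, I01 s -> p k s = / gam s * eu s (Rf r k).
Proof.
  intros Hr Hd HR H0 k. induction k as [k IH] using lt_wf_ind. intros s H. destruct k as [|n].
  - rewrite (proj2 (H0 s H)). f_equal. f_equal. unfold Rf, ppi. rewrite !padd_k, !pmul_0.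
    change (eps O) with (fcst 0). ring.
  - apply (Riccati_uniq (gam s) (fun k => L k s) (fun k => L1 k s) (fun k => eu s (lam k)) (l1s s lam)
      (fun k => p k s) (fun k => p1 k s) (fun k => / gam s * eu s (Rf r k))
      (fun k => / (gam s * gam s) * eu s ((TH (Rf r) - Rf r)%ps k)) n).
    + now apply pd_L0.
    + exact (proj1 (H0 s H)).
    + intros j. now apply L_id.
    + intros j. apply l1s_0; [exact H|]. apply L_id.
    + intros j Hj. apply IH; [lia|exact H].
    + intros j Hj. 
      assert (E1 : forall x, I01 x -> p j x = / gam x * eu x (Rf r j)) by (apply IH; lia).
      pose proof (der_uniq_01 _ _ s _ _ E1 H (Hd s j H) (div_derive s _ H)) as K.
      pose proof (pd_gam1 s H) as H1. pose proof (pd_gam0 s H).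
      transitivity (p1 j s * gam' s / gam' s); [field; exact H1|]. rewrite K.
      change ((TH (Rf r) - Rf r)%ps j) with (th (Rf r j) - Rf r j)%fa. field. split; assumption.
    + now apply HR.
    + now apply formal_Riccati.
Qed.

Lemma r0_val s : I01 s -> P O s = / gam s * eu s (fui * fyi)%fa.
Proof.
  intros H. pose proof (uy_ok s H) as Ho. unfold eu. evs. unfold yy, vv, uu.
  pose proof (pd_gam0 s H). pose proof (pd_L0 s H). pose proof (P0_0 s H). field. repeat split; assumption.
Qed.
Lemma odd_id k s : I01 s -> (P k s - M k s) / 2 = / gam s * eu s (ro k).
Proof.
  intros H. pose proof (uy_ok s H) as Ho.
  rewrite (P_id rp P P1' rp_riccati pd_P pd_RP), (P_id rm M M1 rm_riccati pd_M pd_RM); try exact H.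
  - unfold ro, Rf. rewrite pc_mul_k, !padd_k, psub_k. unfold eu. evs. field. now apply pd_gam0.
  - intros x Hx. rewrite pd_M0 by exact Hx. split.
    + intros E. apply (P0_0 x Hx). transitivity (- - P O x); [ring|rewrite E; ring].
    + rewrite r0_val, rm_0 by exact Hx. replace (eu x (- (fui * fyi))%fa) with (- eu x (fui * fyi)%fa).
      * ring.
      * symmetry. apply ev_opp. now apply uy_ok.
  - intros x Hx. split; [now apply P0_0|]. rewrite rp_0. now apply r0_val.
Qed.

(** * Limits at the two ends of the path *)

Lemma Cpow_lim0 {T} (F : (T -> Prop) -> Prop) {FF : Filter F} (f : T -> C) n :
  filterlim f F (locally (RtoC 0)) -> filterlim (fun s => f s ^ S n) F (locally (RtoC 0)).
Proof.
  intros H. induction n as [|n IH].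
  - apply (filterlim_ext f); [intros x; simpl; ring|exact H].
  - change (fun s => f s ^ S (S n)) with (fun s => f s * f s ^ S n).
    replace (RtoC 0) with (0 * 0) by ring. now apply lim_C_mult.
Qed.

Lemma I01_right : at_right 0 (fun s => I01 s).
Proof.
  exists (mkposreal 1 Rlt_0_1). intros y Hy Hl. unfold ball in Hy; simpl in Hy.
  unfold AbsRing_ball, abs, minus, plus, opp in Hy; simpl in Hy. apply Rabs_def2 in Hy. lra.
Qed.
Lemma I01_left : at_left 1 (fun s => I01 s).
Proof.
  exists (mkposreal 1 Rlt_0_1). intros y Hy Hl. unfold ball in Hy; simpl in Hy.
  unfold AbsRing_ball, abs, minus, plus, opp in Hy; simpl in Hy. apply Rabs_def2 in Hy. lra.
Qed.

Lemma voros_primitive k (f : FA) (la lb : C) : th f = ro k ->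
  filterlim (fun s => eu s f) (at_right 0) (locally la) ->
  filterlim (fun s => eu s f) (at_left 1) (locally lb) ->
  voros_coef_is gam' P M k (/ 2 * lb - / 2 * la).
Proof.
  intros Hf H0 H1. unfold voros_coef_is.
  apply (is_RInt_gen_C_derive (fun s => / 2 * eu s f)).
  - intros s Hs.
    apply (is_derive_C_eq _ _ _ _ (is_derive_C_mult _ _ s _ _ (is_derive_C_const (/ 2) s) (eu_derive s f Hs))).
    rewrite (odd_id k s Hs), Hf. pose proof (pd_gam0 s Hs). field. assumption.
  - intros s Hs.
    assert (HPM : filterlim (fun s => P k s - M k s) (locally s) (locally (P k s - M k s))).
    { apply lim_C_plus; [typeclasses eauto|exact (is_derive_C_continuous _ _ _ (pd_P s k Hs))|].
      replace (- M k s) with (-1 * M k s) by ring.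
      apply (filterlim_ext (fun s => -1 * M k s)); [intros x; ring|].
      apply lim_C_mult; [typeclasses eauto|apply lim_C_const; typeclasses eauto|].
      exact (is_derive_C_continuous _ _ _ (pd_M s k Hs)). }
    apply lim_C_mult; [typeclasses eauto|apply lim_C_const; typeclasses eauto|].
    apply lim_C_mult; [typeclasses eauto| |exact (pd_gamc s Hs)].
    apply lim_C_mult; [typeclasses eauto|exact HPM|apply lim_C_const; typeclasses eauto].
  - apply lim_C_mult; [typeclasses eauto|apply lim_C_const; typeclasses eauto|exact H0].
  - apply lim_C_mult; [typeclasses eauto|apply lim_C_const; typeclasses eauto|exact H1].
Qed.

Lemma voros_odd k : Nat.even k = false -> voros_coef_is gam' P M k 0.
Proof.
  intros H.
  assert (H0 : forall F : (R -> Prop) -> Prop, Filter F -> F (fun s => I01 s) ->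
    filterlim (fun s => eu s (fcst 0)) F (locally (RtoC 0))).
  { intros F FF HF. apply (filterlim_ext_loc (fun _ => RtoC 0)); [|now apply lim_C_const].
    refine (filter_imp _ _ _ HF). intros s Hs. symmetry. apply ev_cst. now apply uy_ok. }
  assert (K := voros_primitive k (fcst 0) 0 0).
  replace (RtoC 0) with (/ 2 * 0 - / 2 * 0) by ring. apply K.
  - rewrite ro_odd by exact H. apply (der_cst th isder_th).
  - apply H0; [typeclasses eauto|exact I01_right].
  - apply H0; [typeclasses eauto|exact I01_left].
Qed.

Section Ends.
Context (F : (R -> Prop) -> Prop) {FF : Filter F} (HF : F (fun s => I01 s)).

Lemma yy_lim (w : C) : w <> 0 -> filterlim vv F (locally w) -> filterlim yy F (locally (/ w)).
Proof. intros Hw H. now apply lim_C_inv. Qed.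
Lemma ok_ev : F (fun s => ok (uu s) (yy s)).
Proof. refine (filter_imp _ _ _ HF). intros s Hs. now apply uy_ok. Qed.
Lemma ok_ev' : F (fun s => ok (uu s) (- yy s)).
Proof. refine (filter_imp _ _ _ HF). intros s Hs. now apply uy_ok'. Qed.

(** For w = -1 the limit y = -1 lies outside [ok]; oddness of [Phi k] moves the evaluation to -y,
    which tends to 1. *)
Lemma Phi_lim_0c k (w : C) : w = 1 \/ w = - (1) ->
  filterlim uu F (locally (/ c)) -> filterlim vv F (locally w) ->
  filterlim (fun s => eu s (Phi k)) F (locally (w * ev (Phi k) (/ c) 1)).
Proof.
  intros Hw Hu Hv. pose proof (Cinv_neq_0 c Hc) as Hci.
  assert (H1 : RtoC 1 <> 0) by (intros E; apply RtoC_inj in E; lra).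
  destruct Hw as [-> | ->].
  - apply (yy_lim _ H1) in Hv. replace (/ 1) with (RtoC 1) in Hv by field.
    replace (1 * ev (Phi k) (/ c) 1) with (ev (Phi k) (/ c) 1) by ring.
    apply ev_lim; [exact FF|now apply ok1|exact Hu|exact Hv|exact ok_ev].
  - assert (H1' : - (1) <> RtoC 0) by (intros E; apply H1; transitivity (- - (1)); [ring|rewrite E; ring]).
    apply (yy_lim _ H1') in Hv.
    assert (Hv' : filterlim (fun s => - yy s) F (locally (RtoC 1))).
    { replace (RtoC 1) with (- (1) * / (- (1))) by (field; exact H1').
      apply (filterlim_ext (fun s => - (1) * yy s)); [intros x; ring|].
      apply lim_C_mult; [exact FF|now apply lim_C_const|exact Hv]. }
    apply (filterlim_ext_loc (fun s => - (1) * ev (Phi k) (uu s) (- yy s))).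
    + refine (filter_imp _ _ _ HF). intros s Hs. unfold eu.
      pose proof (uy_ok s Hs) as Ho. pose proof (uy_ok' s Hs) as Ho'.
      rewrite (Sym_Phi k (uu s) (yy s) Ho Ho'), ev_opp by exact Ho. ring.
    + apply lim_C_mult; [exact FF|now apply lim_C_const|].
      apply ev_lim; [exact FF|now apply ok1|exact Hu|exact Hv'|exact ok_ev'].
Qed.

(** Here u = (3 - v^2) / (2 c) tends to 0 while y tends to the regular point 1 / w, and k >= 2 makes
    the exponent of u in [Phi_scale] positive. *)
Lemma Phi_lim_infty k (w : C) : (2 <= k)%nat -> w * w = 3 -> filterlim vv F (locally w) ->
  filterlim (fun s => eu s (Phi k)) F (locally (RtoC 0)).
Proof.
  intros Hk Hw Hv.
  assert (H3 : RtoC 3 <> 0) by (intros E; apply RtoC_inj in E; lra).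
  assert (H2 : RtoC 2 <> 0) by (intros E; apply RtoC_inj in E; lra).
  assert (Hw0 : w <> 0) by (intros E; apply H3; rewrite <- Hw, E; ring).
  assert (Hu : filterlim uu F (locally (RtoC 0))).
  { replace (RtoC 0) with ((3 + -1 * (w * w)) * / (2 * c)) by (rewrite Hw; field; exact Hc).
    apply (filterlim_ext_loc (fun s => (3 + -1 * (vv s * vv s)) * / (2 * c))).
    - refine (filter_imp _ _ _ HF). intros s Hs. rewrite (vv_c s Hs). field. exact Hc.
    - apply lim_C_mult; [exact FF| |now apply lim_C_const].
      apply lim_C_plus; [exact FF|now apply lim_C_const|].
      apply lim_C_mult; [exact FF|now apply lim_C_const|now apply lim_C_mult]. }
  assert (Ho : ok 1 (/ w)).
  { split; [intros E; apply RtoC_inj in E; lra|split; [now apply Cinv_neq_0|]].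
    intros E. assert (E2 : w = - (1)).
    { transitivity (w * (1 + / w) - 1); [field; exact Hw0|rewrite E; ring]. }
    rewrite E2 in Hw. assert (E3 : RtoC 3 = 1) by (rewrite <- Hw; ring). apply RtoC_inj in E3; lra. }
  apply (filterlim_ext_loc (fun s => uu s ^ (k - 1) * ev (Phi k) 1 (yy s))).
  - refine (filter_imp _ _ _ HF). intros s Hs. symmetry. apply Phi_scale; [lia|now apply uy_ok].
  - replace (RtoC 0) with (0 * ev (Phi k) 1 (/ w)) by ring.
    apply lim_C_mult; [exact FF| |].
    + replace (k - 1)%nat with (S (k - 2)) by lia. now apply Cpow_lim0.
    + apply ev_lim; [exact FF|exact Ho|now apply lim_C_const|now apply yy_lim|].
      refine (filter_imp _ _ _ HF). intros s Hs. split; [apply Ho|apply (uy_ok s Hs)].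
Qed.
End Ends.

Lemma voros_infty (sigma : R) k : (sigma = 1 \/ sigma = -1)%R -> (1 <= k)%nat ->
  ends_at_infty sigma gam L P -> voros_coef_is gam' P M k 0.
Proof.
  intros Hs Hk (_ & _ & _ & _ & H0 & H1).
  destruct (Nat.even k) eqn:Ek; [|now apply voros_odd].
  assert (Hk2 : (2 <= k)%nat) by (destruct k as [|[|k]]; [lia|discriminate|lia]).
  assert (Hq : RtoC (sigma * sqrt 3) * RtoC (sigma * sqrt 3) = 3).
  { rewrite <- RtoC_mult. f_equal. transitivity (sigma * sigma * (sqrt 3 * sqrt 3))%R; [ring|].
    rewrite sqrt_sqrt by lra. destruct Hs; subst; ring. }
  replace (RtoC 0) with (/ 2 * 0 - / 2 * 0) by ring.
  apply (voros_primitive k (Phi k)); [now apply th_Phi| |].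
  - apply (Phi_lim_infty _ I01_right k (- RtoC (sigma * sqrt 3)) Hk2); [rewrite <- Hq; ring|].
    apply (filterlim_ext (fun s => P 0%nat s * L 0%nat s)); [intros x; unfold vv; ring|exact H0].
  - apply (Phi_lim_infty _ I01_left k (RtoC (sigma * sqrt 3)) Hk2); [exact Hq|].
    apply (filterlim_ext (fun s => P 0%nat s * L 0%nat s)); [intros x; unfold vv; ring|exact H1].
Qed.

Lemma G_coef_even k : Nat.even k = true -> (2 <= k)%nat ->
  ev (Phi k) (/ c) 1 = - (3 * G_coef c k).
Proof.
  intros He Hk. rewrite ev_Phi_1 by (trivial; now apply Cinv_neq_0).
  unfold G_coef. rewrite He. destruct k as [|k]; [lia|]. set (n := S k) in *.
  assert (E : (- 1) ^ n = 1).
  { apply Nat.even_spec in He. destruct He as [m ->]. rewrite Cpow_mult_r.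
    replace ((- 1) ^ 2) with (RtoC 1) by (simpl; ring). apply Cpow_1_l. }
  rewrite E. rewrite RtoC_div, RtoC_mult.
  - assert (Hp : c ^ (n - 1) <> 0) by now apply Cpow_nz.
    rewrite Cpow_inv by exact Hc.
    assert (N1 : RtoC (INR n) <> 0) by (apply INRC_neq; lia).
    assert (N2 : RtoC (INR (n - 1)) <> 0) by (apply INRC_neq; lia).
    field. repeat split; assumption.
  - apply Rmult_integral_contrapositive_currified; apply not_0_INR; lia.
Qed.

Lemma voros_0c (sigma : R) k : (sigma = 1 \/ sigma = -1)%R -> (1 <= k)%nat ->
  ends_at_0c c sigma gam L P -> voros_coef_is gam' P M k (- RtoC sigma * 3 * G_coef c k).
Proof.
  intros Hs Hk (_ & _ & U0 & U1 & H0 & H1).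
  destruct (Nat.even k) eqn:Ek.
  2:{ unfold G_coef. rewrite Ek. replace (- RtoC sigma * 3 * 0) with (RtoC 0) by ring. now apply voros_odd. }
  assert (Hk2 : (2 <= k)%nat) by (destruct k as [|[|k]]; [lia|discriminate|lia]).
  assert (Hsg : RtoC sigma = 1 \/ RtoC sigma = - (1)).
  { destruct Hs as [-> | ->]; [now left|right; ring]. }
  assert (Hv : forall F : (R -> Prop) -> Prop, Filter F -> F (fun s => I01 s) -> forall w,
    filterlim (fun s => L 0%nat s / gam s) F (locally (/ c)) ->
    filterlim (fun s => P 0%nat s * gam s) F (locally (w * c)) -> filterlim vv F (locally w)).
  { intros F FF HF w A B.
    (* v = lambda_0 sqrt Delta is the product of lambda_0 / t and t sqrt Delta. *)
    replace w with (/ c * (w * c)) by (field; exact Hc).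
    apply (filterlim_ext_loc (fun s => L 0%nat s / gam s * (P 0%nat s * gam s))).
    - refine (filter_imp _ _ _ HF). intros s Hx. unfold vv. field. now apply pd_gam0.
    - now apply lim_C_mult. }
  (* The two ends are copies of the endpoint on opposite sheets, where [Phi k] tends to opposite
     values; half the difference is a single endpoint value. *)
  replace (- RtoC sigma * 3 * G_coef c k)
    with (/ 2 * (RtoC sigma * ev (Phi k) (/ c) 1) - / 2 * (- RtoC sigma * ev (Phi k) (/ c) 1))
    by (rewrite G_coef_even by assumption; field).
  apply (voros_primitive k (Phi k)); [now apply th_Phi| |].
  - apply (Phi_lim_0c _ I01_right).
    + destruct Hsg as [E|E]; rewrite E; [right|left]; ring.
    + exact U0.
    + now apply Hv; [typeclasses eauto|exact I01_right|..].
  - apply (Phi_lim_0c _ I01_left).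
    + exact Hsg.
    + exact U1.
    + now apply Hv; [typeclasses eauto|exact I01_left|..].
Qed.
End Path.

Theorem theoremD1 :
  forall (c : C), c <> 0 ->
  forall (sigma : R), (sigma = 1 \/ sigma = -1)%R ->
  forall (gam gam' : R -> C) (L L1 L2 P P1 M M1 : nat -> R -> C),
    path_data c gam gam' L L1 L2 P P1 M M1 ->
    (ends_at_infty sigma gam L P ->
       forall k : nat, (1 <= k)%nat -> voros_coef_is gam' P M k 0) /\
    (ends_at_0c c sigma gam L P ->
       forall k : nat, (1 <= k)%nat ->
         voros_coef_is gam' P M k (- RtoC sigma * 3 * G_coef c k)).
Proof.
  intros c Hc sigma Hs gam gam' L L1 L2 P P1 M M1 H. split; intros He k Hk.
  - exact (voros_infty c Hc gam gam' L L1 L2 P P1 M M1 H sigma k Hs Hk He).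
  - exact (voros_0c c Hc gam gam' L L1 L2 P P1 M M1 H sigma k Hs Hk He).
Qed.
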